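(* Let $\Omega$ be a bounded open set in $\mathbb{R}^n$, $n\ge 2$. Suppose that the Neumann Laplacian $-\Delta_N$ on $\Omega$ has a discrete spectrum $0=\gamma_1\le\gamma_2\le\gamma_3\le\cdots$. Then for every $\gamma>0$, $$\sum_{k:\,\gamma_k<\gamma}(\gamma-\gamma_k)\ge \frac{\omega(n)|\Omega|}{(2\pi)^{n}}\,\frac{2\gamma^{1+\frac n2}}{n+2}\left(1+\frac{n(n+2)}{3}\,\frac{J_1^4}{\gamma^{1/2}\,(4J_1^2+\gamma)^{3/2}}\right).$$
   Context: $\Omega$ is a nonempty bounded open subset of $\mathbb{R}^n$, $|\Omega|$ is its Lebesgue measure, $\omega(n)$ is the volume of the unit ball of $\mathbb{R}^n$. Discrete spectrum means the spectrum consists of eigenvalues of finite multiplicity tending to infinity; $\gamma_1\le\gamma_2\le\cdots$ lists them with multiplicity. The moment of inertia of $\Omega$ is $I(\Omega)=\inf_{a\in\mathbb{R}^n}\int_\Omega|x-a|^2\,dx$, and $J_1=\dfrac{|\Omega|^{1/2}}{2\,I(\Omega)^{1/2}}$. *)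

(* Defs.v *)
From HB Require Import structures.
From mathcomp Require Import all_boot all_order all_algebra.
From mathcomp Require Import all_classical all_reals all_analysis.

Set Implicit Arguments.
Unset Strict Implicit.
Unset Printing Implicit Defensive.
Import Order.TTheory GRing.Theory Num.Theory.
Import numFieldNormedType.Exports.
Local Open Scope classical_set_scope.
Local Open Scope ring_scope.

(* The Borel sigma-algebra of R^n, generated by the coordinates. *)
Section measurable_rV.
Variables (R : realType) (n : nat).

Definition coord_rV (i : 'I_n) (x : 'rV[R]_n) : measurableTypeR R := x ord0 i.

Definition measurable_rV : set (set 'rV[R]_n) := g_sigma_preimage coord_rV.

Let rV_set0 : measurable_rV set0.
Proof. exact: sigma_algebra0. Qed.

Let rV_setC A : measurable_rV A -> measurable_rV (~` A).
Proof. exact: sigma_algebraC. Qed.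

Let rV_bigcup (F : (set 'rV[R]_n)^nat) :
  (forall i, measurable_rV (F i)) -> measurable_rV (\bigcup_i F i).
Proof. exact: sigma_algebra_bigcup. Qed.

Definition rV_display : measure_display.
Proof. exact: default_measure_display. Qed.

HB.instance Definition _ := @isMeasurable.Build
  rV_display 'rV[R]_n measurable_rV rV_set0 rV_setC rV_bigcup.

End measurable_rV.

Section cons_rV.
Variables (R : realType) (n : nat).

Definition cons_rV (p : measurableTypeR R * 'rV[R]_n) : 'rV[R]_n.+1 :=
  row_mx (p.1)%:M p.2 : 'rV[R]_(1 + n).

Lemma measurable_coord_rV (i : 'I_n) : measurable_fun setT (@coord_rV R n i).
Proof.
move=> _ Y mY; rewrite setTI; apply: sub_sigma_algebra => /=.
rewrite -bigcup_seq/=; exists i => /=; first by rewrite mem_index_enum.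
by exists Y => //; rewrite setTI.
Qed.
End cons_rV.

Lemma measurable_fun_rVP (R : realType) n d (T : measurableType d)
    (f : T -> 'rV[R]_n) :
  (forall i, measurable_fun setT (@coord_rV R n i \o f)) ->
  measurable_fun setT f.
Proof.
move=> mf.
have : measurable_rV (R:=R) (n:=n) `<=` [set A | d.-measurable (f @^-1` A)].
  apply: smallest_sub.
    split=> /=.
    - by rewrite preimage_set0.
    - by move=> A mA; rewrite setTD preimage_setC; exact: measurableC.
    - by move=> F mF; rewrite preimage_bigcup; exact: bigcup_measurable.
  rewrite -bigcup_seq; apply: bigcup_sub => i _ A [B mB <-] /=.
  by rewrite setTI -[X in _ X]setTI; exact: mf.
by move=> h _ A mA; rewrite setTI; exact: h.
Qed.

Lemma cons_rV0 (R : realType) n (a : R) (x : 'rV[R]_n) :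
  cons_rV (a, x) ord0 ord0 = a.
Proof.
rewrite /cons_rV (_ : ord0 = lshift n ord0 :> 'I_(1 + n)); last exact: val_inj.
by rewrite (@row_mxEl _ 1 1 n) mxE eqxx.
Qed.

Lemma cons_rV_lift (R : realType) n (a : R) (x : 'rV[R]_n) (i : 'I_n) :
  cons_rV (a, x) ord0 (lift ord0 i) = x ord0 i.
Proof.
rewrite /cons_rV (_ : lift ord0 i = @rshift 1 n i); last exact: val_inj.
by rewrite (@row_mxEr _ 1 1 n).
Qed.

Lemma measurable_cons_rV (R : realType) n : measurable_fun setT (@cons_rV R n).
Proof.
apply: measurable_fun_rVP => i; case: (unliftP ord0 i) => [j ->|->].
  rewrite (_ : _ \o _ = @coord_rV R n j \o snd).
    by apply: measurableT_comp => //; exact: measurable_coord_rV.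
  by apply/funext => -[a x] /=; rewrite /coord_rV cons_rV_lift.
rewrite (_ : _ \o _ = fst)//.
by apply/funext => -[a x] /=; rewrite /coord_rV cons_rV0.
Qed.

Definition uncons_rV (R : realType) n (x : 'rV[R]_n.+1) :
    measurableTypeR R * 'rV[R]_n :=
  (@lsubmx R 1 1 n x ord0 ord0, @rsubmx R 1 1 n x).

Lemma cons_rVK (R : realType) n : cancel (@cons_rV R n) (@uncons_rV R n).
Proof.
move=> [a x]; rewrite /cons_rV /uncons_rV row_mxKl row_mxKr.
by rewrite mxE eqxx.
Qed.

Lemma measurable_uncons_rV (R : realType) n :
  measurable_fun setT (@uncons_rV R n).
Proof.
apply/measurable_fun_pairP; split.
  rewrite (_ : _ \o _ = @coord_rV R n.+1 ord0).
    exact: measurable_coord_rV.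
  by apply/funext => x /=; rewrite mxE /coord_rV; congr (x _ _); exact: val_inj.
apply: measurable_fun_rVP => i.
rewrite (_ : _ \o _ = @coord_rV R n.+1 (@rshift 1 n i)).
  exact: measurable_coord_rV.
by apply/funext => x /=; rewrite /coord_rV mxE.
Qed.

Section lebesgue_rV_step.
Local Open Scope ereal_scope.
Variables (R : realType) (n : nat).
Variable mu : {sigma_finite_measure set 'rV[R]_n -> \bar R}.

Definition lebesgue_rV_step : set 'rV[R]_n.+1 -> \bar R :=
  pushforward (@lebesgue_measure R \x mu) (@cons_rV R n).

Let step0 : lebesgue_rV_step set0 = 0.
Proof. by rewrite /lebesgue_rV_step /pushforward preimage_set0 measure0. Qed.

Let step_ge0 A : 0 <= lebesgue_rV_step A.
Proof. exact: (measure_ge0 (@lebesgue_measure R \x mu)). Qed.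

Let step_sigma_additive : semi_sigma_additive lebesgue_rV_step.
Proof.
move=> F mF tF mUF; rewrite /lebesgue_rV_step /pushforward preimage_bigcup.
apply: measure_semi_sigma_additive.
- by move=> k; rewrite -[X in measurable X]setTI; exact: measurable_cons_rV.
- apply/trivIsetP => /= i j _ _ ij; rewrite -preimage_setI.
  by move/trivIsetP : tF => /(_ _ _ _ _ ij) ->//; rewrite preimage_set0.
- by rewrite -preimage_bigcup -[X in measurable X]setTI; exact: measurable_cons_rV.
Qed.

HB.instance Definition _ := isMeasure.Build _ _ _ lebesgue_rV_step
  step0 step_ge0 step_sigma_additive.

Let step_sigma_finite : sigma_finite setT lebesgue_rV_step.
Proof.
have /sigma_finiteP[F [FT ndF Foo]] := sigma_finiteT (@lebesgue_measure R).
have /sigma_finiteP[G [GT ndG Goo]] := sigma_finiteT mu.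
exists (fun k => @uncons_rV R n @^-1` (F k `*` G k)).
  rewrite -preimage_bigcup (_ : \bigcup_k _ = setT) ?preimage_setT//.
  apply/seteqP; split=> // -[a x] _.
  have [k _ Fa] : (\bigcup_k F k) a by rewrite -FT.
  have [l _ Gx] : (\bigcup_k G k) x by rewrite -GT.
  exists (maxn k l) => //; split=> /=.
    by move: a Fa; exact/subsetPset/ndF/leq_maxl.
  by move: x Gx; exact/subsetPset/ndG/leq_maxr.
move=> k; have [mF Fk] := Foo k; have [mG Gk] := Goo k; split.
  rewrite -[X in measurable X]setTI.
  by apply: measurable_uncons_rV => //; exact: measurableX.
rewrite /lebesgue_rV_step /pushforward -comp_preimage.
rewrite (_ : _ \o _ = id) ?preimage_id; last first.
  by apply/funext => p /=; rewrite cons_rVK.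
by rewrite product_measure1E// lte_mul_pinfty// ge0_fin_numE.
Qed.

HB.instance Definition _ := Measure_isSigmaFinite.Build _ _ _ lebesgue_rV_step
  step_sigma_finite.

End lebesgue_rV_step.

Fixpoint lebesgue_rV (R : realType) n :
    {sigma_finite_measure set 'rV[R]_n -> \bar R} :=
  if n is n'.+1 then lebesgue_rV_step (lebesgue_rV R n') else \d_(0 : 'rV[R]_0).

Lemma lebesgue_rV_box (R : realType) n (A : 'I_n -> set (measurableTypeR R)) :
  (forall i, measurable (A i)) ->
  lebesgue_rV R n ([set x | forall i, A i (x ord0 i)] : set 'rV[R]_n) =
  (\prod_(i < n) lebesgue_measure (A i))%E.
Proof.
elim: n A => [|n IHn] A mA.
  rewrite big_ord0 /= diracE (_ : _ \in _ = true)//.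
  by apply/mem_set => -[].
rewrite big_ord_recl -(IHn (fun i => A (lift ord0 i)))//.
pose B := [set x : 'rV[R]_n | forall i, A (lift ord0 i) (x ord0 i)].
have mB : measurable B.
  rewrite (_ : B = \bigcap_(i in [set: 'I_n])
    (@coord_rV R n i @^-1` A (lift ord0 i))); last first.
    by apply/seteqP; split=> x /= h i; [move=> _|]; apply: h.
  apply: fin_bigcap_measurable => // i _.
  by rewrite -[X in measurable X]setTI; exact: measurable_coord_rV.
rewrite /= /lebesgue_rV_step /pushforward -/B -product_measure1E//.
congr (_ _); apply/seteqP; split=> -[a x] /=.
  move=> h; split; first by rewrite -(cons_rV0 a x); exact: h.
  by move=> i; rewrite -(cons_rV_lift a x); exact: h.
move=> [Aa Bx] i; case: (unliftP ord0 i) => [j ->|->].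
  by rewrite cons_rV_lift; exact: Bx.
by rewrite cons_rV0.
Qed.

Section geometry.
Variables (R : realType) (n : nat).

(* The norm of the library on 'rV[R]_n is the max norm; lengths in this file
   are Euclidean. *)
Definition sqnorm (x : 'rV[R]_n) : R := \sum_i x ord0 i ^+ 2.

Definition volume (A : set 'rV[R]_n) : R := fine (lebesgue_rV R n A).

Definition ball_volume : R := volume [set x | sqnorm x < 1].

Definition moment_of_inertia (Omega : set 'rV[R]_n) : R :=
  inf (range (fun a => \int[lebesgue_rV R n]_(x in Omega) sqnorm (x - a))).

Definition J1 (Omega : set 'rV[R]_n) : R :=
  Num.sqrt (volume Omega) / (2 * Num.sqrt (moment_of_inertia Omega)).

End geometry.
Arguments ball_volume R n : clear implicits.

(* L^2(Omega), H^1(Omega) and the Neumann Laplacian, with real scalars.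
   Elements of L^2(Omega) are represented by functions on R^n, of which only
   the restriction to Omega matters, up to almost everywhere equality. *)
Section neumann_laplacian.
Variables (R : realType) (n : nat) (Omega : set 'rV[R]_n).
Implicit Types (u v f g phi : 'rV[R]_n -> R) (G H : 'I_n -> 'rV[R]_n -> R).

Local Notation leb := (lebesgue_rV R n).

Definition L2 u : Prop := u \_ Omega \in Lfun leb 2%:E.

Definition L2norm u : \bar R := 'N[leb]_2%:E[EFin \o u \_ Omega].

Definition partial_deriv (i : 'I_n) phi : 'rV[R]_n -> R :=
  'D_(delta_mx ord0 i) phi.

Fixpoint Ck (k : nat) phi : Prop :=
  if k is k'.+1 then
    [/\ continuous phi,
        forall (i : 'I_n) x, derivable phi x (delta_mx ord0 i)
      & forall i, Ck k' (partial_deriv i phi)]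
  else continuous phi.

(* C_c^oo(Omega) *)
Definition test_function phi : Prop :=
  (forall k, Ck k phi) /\
  exists K : set 'rV[R]_n,
    [/\ compact K, K `<=` Omega & forall x, ~ K x -> phi x = 0].

Definition weak_partial (i : 'I_n) u g : Prop :=
  forall phi, test_function phi ->
    \int[leb]_(x in Omega) (u x * partial_deriv i phi x) =
    - \int[leb]_(x in Omega) (g x * phi x).

(* u is in H^1(Omega), with weak gradient G *)
Definition H1_grad u G : Prop :=
  L2 u /\ forall i, L2 (G i) /\ weak_partial i u (G i).

(* The graph of -Delta_N, the self-adjoint operator associated with the closed
   quadratic form \int_Omega |grad u|^2 of domain H^1(Omega): u is in the
   domain and -Delta_N u = f. *)
Definition neumann u f : Prop :=
  L2 f /\
  exists2 G, H1_grad u G &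
    forall v H, H1_grad v H ->
      \sum_(i < n) \int[leb]_(x in Omega) (G i x * H i x) =
      \int[leb]_(x in Omega) (f x * v x).

(* -Delta_N - lambda is a bijection of its domain onto L^2(Omega), and its
   inverse is bounded. *)
Definition resolvent_set : set R := [set lambda |
  [/\ forall f, L2 f -> exists u h,
        neumann u h /\
        (fun x => h x - lambda * u x) = f %[ae leb in Omega],
      forall u h, neumann u h ->
        (fun x => h x - lambda * u x) = (fun=> 0) %[ae leb in Omega] ->
        u = (fun=> 0) %[ae leb in Omega]
    & exists C : R, forall u h, neumann u h ->
        (L2norm u <= C%:E * L2norm (fun x => h x - lambda * u x)%R)%E]].

Definition spectrum : set R := ~` resolvent_set.

Definition neumann_eigenspace (lambda : R) : set ('rV[R]_n -> R) :=
  [set u | neumann u (fun x => lambda * u x)].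

(* E has dimension m, modulo almost everywhere equality. *)
Definition has_dim (E : set ('rV[R]_n -> R)) (m : nat) : Prop :=
  exists e : 'I_m -> 'rV[R]_n -> R,
    [/\ forall i, E (e i),
        forall c : 'I_m -> R,
          (fun x => \sum_i c i * e i x) = (fun=> 0) %[ae leb in Omega] ->
          forall i, c i = 0
      & forall u, E u -> exists c : 'I_m -> R,
          u = (fun x => \sum_i c i * e i x) %[ae leb in Omega]].

(* The sequence gamma is indexed from 0: gamma k is the (k+1)-st eigenvalue. *)
Definition discrete_spectrum (gamma : R^nat) : Prop :=
  [/\ {homo gamma : i j / (i <= j)%N >-> i <= j},
      gamma @ \oo --> +oo,
      spectrum = range gamma
    & forall lambda, exists m : nat,
        ([set k | gamma k = lambda] #= `I_m)%card /\
        has_dim (neumann_eigenspace lambda) m].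

End neumann_laplacian.

(* Main.v *)
Require Import Defs.
From HB Require Import structures.
From mathcomp Require Import all_boot all_order all_algebra.
From mathcomp Require Import all_classical all_reals all_analysis.
From mathcomp Require Import measurable_realfun.
From mathcomp Require Import ring lra.
Set Implicit Arguments.
Unset Strict Implicit.
Unset Printing Implicit Defensive.
Import Order.TTheory GRing.Theory Num.Theory.
Import numFieldNormedType.Exports.
Local Open Scope classical_set_scope.
Local Open Scope ring_scope.

(** Why the inequality holds. Let e_k, k < K, be orthonormal eigenfunctions for
    the eigenvalues gamma_k < g, extended by zero outside Omega, and put
    H(xi) = sum_k (g - gamma_k) |F e_k(xi)|^2, with F the Fourier transform.
    Plancherel's inequality bounds the integral of H by
    (2 pi)^n sum_k (g - gamma_k), so the task is to bound H from below.

    The first lower bound is the averaged variational principle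
    [riesz_mean_ge]. A function of H^1(Omega) deprived of its components along
    the e_k has Dirichlet integral at least g times its squared norm; expanding
    this gives, for every v in H^1(Omega),
      sum_k (g - gamma_k) (e_k, v)^2 >= g |v|^2 - |grad v|^2.
    For v = cos(xi . x) and v = sin(xi . x) the sum of the two inequalities is
    H(xi) >= |Omega| (g - |xi|^2), and integrating over the ball |xi|^2 < g
    yields the leading term.

    The correction comes from the region |xi|^2 >= g, where H cannot vanish at
    once: sqrt H is Lipschitz with constant sqrt (g I(Omega))
    [energy_lipschitz]. Indeed translating x by a only changes the phase of
    F e_k, Bessel's inequality compares H at xi and eta with the norm of
    e^(i xi . (x - a)) - e^(i eta . (x - a)), and this function is at most
    |xi - eta| |x - a|; then a is optimized. Starting from the first bound at
    radius g / r, with r = sqrt (4 J_1^2 + g), the Lipschitz bound gives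
    H(xi) >= g I(Omega) (r - |xi|)^2 for sqrt g <= |xi| < r [skirt_le]. The
    integral of this profile, with s^n - q^n >= n q^(n-1) (s - q) and
    r - sqrt g >= 2 J_1^2 / r, is at least the correction term.

    Two analytic facts are proved by direct arguments. The bound on the
    orthogonal complement of the eigenspaces below g [spectral_bound] is a
    statement on the bounded symmetric operator A = (1 - Delta_N)^(-1); it is
    obtained from the numbers (p(A) u, u), for polynomials p, instead of a
    spectral measure. Plancherel's inequality [plancherel_le] is obtained by
    inserting the weight exp(- a sum_i |xi_i|), whose Fourier transform is a
    product of Poisson kernels, hence positive with known integral: Schur's
    test applies, and the weight is removed with Fatou's lemma. *)

(** * Semi-inner products *)

Lemma discriminant_le0 (R : realFieldType) (a b c : R) : 0 <= c ->
  (forall x, 0 <= a + x * (2 * b) + x ^+ 2 * c) -> b ^+ 2 <= a * c.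
Proof.
rewrite le_eqVlt => /orP[/eqP <- h|c0 h].
  rewrite mulr0; have [->|b0] := eqVneq b 0; first by rewrite expr0n.
  have := h (- (a + 1) / (2 * b)); rewrite mulr0 addr0.
  rewrite divfK ?mulf_neq0 ?pnatr_eq0//; lra.
have := h (- b / c).
have -> : a + - b / c * (2 * b) + (- b / c) ^+ 2 * c = (a * c - b ^+ 2) / c.
  by field; rewrite gt_eqF.
by rewrite pmulr_lge0 ?invr_gt0// subr_ge0.
Qed.

(** A positive semidefinite symmetric bilinear form; vectors of length zero
    need not vanish, so that square-integrable functions can be used without
    passing to classes modulo almost everywhere equality. *)
Record semi_inner (R : realFieldType) (V : lmodType R) (ip : V -> V -> R) :
    Prop := SemiInner {
  ipC : forall u v, ip u v = ip v u ;
  ipDl : forall u v w, ip (u + v) w = ip u w + ip v w ;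
  ipZl : forall a u w, ip (a *: u) w = a * ip u w ;
  ip_ge0 : forall u, 0 <= ip u u }.

Section SemiInnerTheory.
Variables (R : realFieldType) (V : lmodType R) (ip : V -> V -> R).
Hypothesis sip : semi_inner ip.

Lemma ipDr u v w : ip u (v + w) = ip u v + ip u w.
Proof. by rewrite !(ipC sip u) (ipDl sip). Qed.

Lemma ipZr a u w : ip u (a *: w) = a * ip u w.
Proof. by rewrite !(ipC sip u) (ipZl sip). Qed.

Lemma ipNl u w : ip (- u) w = - ip u w.
Proof. by rewrite -scaleN1r (ipZl sip) mulN1r. Qed.

Lemma ipNr u w : ip u (- w) = - ip u w.
Proof. by rewrite -scaleN1r ipZr mulN1r. Qed.

Lemma ip0l w : ip 0 w = 0.
Proof. by rewrite -(scale0r (0 : V)) (ipZl sip) mul0r. Qed.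

Lemma ip0r w : ip w 0 = 0.
Proof. by rewrite (ipC sip) ip0l. Qed.

Definition ipE :=
  (ipDl sip, ipDr, ipZl sip, ipZr, ipNl, ipNr, ip0l, ip0r).

Lemma ip_suml I (r : seq I) (P : pred I) (F : I -> V) w :
  ip (\sum_(i <- r | P i) F i) w = \sum_(i <- r | P i) ip (F i) w.
Proof. by apply: (big_morph (ip^~ w)) => [u v|]; rewrite ipE. Qed.

Lemma ip_sumr I (r : seq I) (P : pred I) (F : I -> V) w :
  ip w (\sum_(i <- r | P i) F i) = \sum_(i <- r | P i) ip w (F i).
Proof. by apply: (big_morph (ip w)) => [u v|]; rewrite ipE. Qed.

Lemma cauchy_schwarz u v : ip u v ^+ 2 <= ip u u * ip v v.
Proof.
apply: discriminant_le0 => [|x]; first exact: (ip_ge0 sip).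
have := ip_ge0 sip (u + x *: v); rewrite !ipE (ipC sip v u).
by congr (_ <= _); ring.
Qed.

Lemma ip_null u v : ip u u = 0 -> ip u v = 0.
Proof.
move=> u0; apply/eqP; rewrite -sqrf_eq0 eq_le sqr_ge0 andbT.
by rewrite (le_trans (cauchy_schwarz u v))// u0 mul0r.
Qed.

(** Parallelogram-type bound replacing the triangle inequality. *)
Lemma ip_add_le u v : ip (u + v) (u + v) <= 2 * ip u u + 2 * ip v v.
Proof.
have := ip_ge0 sip (u - v); rewrite !ipE (ipC sip v u); lra.
Qed.

End SemiInnerTheory.

(** * Moments of a symmetric operator *)

Section Moments.
Variables (R : realFieldType) (V : lmodType R) (ip : V -> V -> R).
Hypothesis sip : semi_inner ip.
Variable A : V -> V.
Hypothesis Asym : forall f g, ip (A f) g = ip f (A g).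

(** The vector p(A)u. *)
Definition opoly (p : {poly R}) u : V := \sum_(i < size p) p`_i *: iter i A u.

(** The scalar product of p(A)u and u, which plays the part of the integral of p
    against the spectral measure of A at u. *)
Definition moment u (p : {poly R}) : R := ip (opoly p u) u.

Lemma opoly_widen n (p : {poly R}) u : (size p <= n)%N ->
  opoly p u = \sum_(i < n) p`_i *: iter i A u.
Proof.
move=> pn; rewrite /opoly (big_ord_widen _ (fun i => p`_i *: iter i A u) pn).
rewrite big_mkcond; apply: eq_bigr => i _; case: ltnP => // pi.
by rewrite nth_default// scale0r.
Qed.

Lemma opolyD p q u : opoly (p + q) u = opoly p u + opoly q u.
Proof.
pose n := maxn (size p) (size q).
rewrite !(@opoly_widen n) ?leq_maxl ?leq_maxr ?(leq_trans (size_polyD _ _))//.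
by rewrite -big_split; apply: eq_bigr => i _; rewrite coefD scalerDl.
Qed.

Lemma opolyZ a p u : opoly (a *: p) u = a *: opoly p u.
Proof.
rewrite (@opoly_widen (size p)) ?size_scale_leq// scaler_sumr.
by apply: eq_bigr => i _; rewrite coefZ scalerA.
Qed.

Lemma opolyXn n u : opoly 'X^n u = iter n A u.
Proof.
rewrite (@opoly_widen n.+1) ?size_polyXn// big_ord_recr /= coefXn eqxx scale1r.
by rewrite big1 ?add0r// => i _; rewrite coefXn ltn_eqF// scale0r.
Qed.

Lemma opoly1 u : opoly 1 u = u.
Proof. by rewrite -(expr0 'X) opolyXn. Qed.

Lemma momentD u p q : moment u (p + q) = moment u p + moment u q.
Proof. by rewrite /moment opolyD (ipE sip). Qed.

Lemma momentZ u a p : moment u (a *: p) = a * moment u p.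
Proof. by rewrite /moment opolyZ (ipE sip). Qed.

Lemma momentC u a p : moment u (a%:P * p) = a * moment u p.
Proof. by rewrite mul_polyC momentZ. Qed.

Lemma momentN u p : moment u (- p) = - moment u p.
Proof. by rewrite -scaleN1r momentZ mulN1r. Qed.

Definition momentE := (momentD, momentN, momentC, momentZ).

Lemma ip_iter u i j : ip (iter i A u) (iter j A u) = ip (iter (i + j) A u) u.
Proof. by elim: j i => [|j IHj] i; rewrite ?addn0// iterS -Asym -iterS IHj addSnnS. Qed.

(** Symmetry of A makes p(A) symmetric, so multiplication of polynomials
    becomes the scalar product. *)
Lemma momentM u p q : moment u (p * q) = ip (opoly p u) (opoly q u).
Proof.
have H (P : {poly R} -> Prop) : P 0 -> (forall a b, P a -> P b -> P (a + b)) ->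
    (forall c n, P (c *: 'X^n)) -> forall r, P r.
  move=> P0 PD PX r; rewrite -[r]coefK poly_def.
  by elim/big_ind: _.
have z u' : opoly 0 u' = 0 by rewrite -(scale0r (0 : {poly R})) opolyZ scale0r.
have m0 : moment u 0 = 0 by rewrite /moment z (ipE sip).
elim/H: p => [|p p' Hp Hp'|a n]; first by rewrite mul0r m0 z (ipE sip).
  by rewrite mulrDl momentD opolyD (ipE sip) Hp Hp'.
elim/H: q => [|q q' Hq Hq'|b m]; first by rewrite mulr0 m0 z (ipE sip).
  by rewrite mulrDr momentD opolyD (ipE sip) Hq Hq'.
rewrite -scalerAl -scalerAr !momentZ -exprD !opolyZ !(ipE sip) /moment !opolyXn.
by rewrite ip_iter.
Qed.

Lemma moment_sqr u p : moment u (p * p) = ip (opoly p u) (opoly p u).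
Proof. exact: momentM. Qed.

Lemma ip_A_opoly u p w : ip (A (opoly p u)) w = ip (opoly ('X * p) u) w.
Proof.
rewrite Asym /opoly (ip_suml sip).
rewrite -/(opoly _ _) (@opoly_widen (size p).+1); last first.
  by have [->|p0] := eqVneq p 0; rewrite ?mulr0 ?size_poly0// mulrC size_mulX.
rewrite (ip_suml sip) big_ord_recl coefXM eqxx !(ipE sip) mul0r add0r.
apply: eq_bigr => i _; rewrite !(ipE sip) coefXM /=.
by rewrite -Asym.
Qed.

Lemma momentX u p : moment u ('X * (p * p)) = ip (A (opoly p u)) (opoly p u).
Proof. by rewrite ip_A_opoly mulrA momentM. Qed.

Lemma moment_shift u p c :
  ip (A (opoly p u) - c *: opoly p u) (A (opoly p u) - c *: opoly p u) =
  moment u (('X - c%:P) * p * (('X - c%:P) * p)).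
Proof.
have E : opoly (('X - c%:P) * p) u = opoly ('X * p) u - c *: opoly p u.
  by rewrite mulrBl opolyD -mulNr -polyCN mul_polyC opolyZ scaleNr.
rewrite [RHS]momentM E; set P := opoly p u; set P' := opoly _ u.
have AP w : ip (A P) w = ip P' w by exact: ip_A_opoly.
have PA w : ip w (A P) = ip w P' by rewrite !(ipC sip w) AP.
by rewrite !(ipE sip) !(AP, PA).
Qed.

(** Cauchy-Schwarz for the form attached to a polynomial q whose values q(A)
    are nonnegative on the vectors p(A)u. *)
Lemma moment_CS u q f g :
  (forall p, 0 <= moment u (q * (p * p))) ->
  moment u (q * (f * g)) ^+ 2 <= moment u (q * (f * f)) * moment u (q * (g * g)).
Proof.
move=> q0; apply: discriminant_le0 => // x.
have := q0 (f + x%:P * g).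
have -> : q * ((f + x%:P * g) * (f + x%:P * g)) =
    q * (f * f) + x%:P * (2%:P * (q * (f * g))) + (x ^+ 2)%:P * (q * (g * g)).
  by rewrite polyC_exp polyCMn; ring.
by rewrite !momentE.
Qed.

End Moments.

(** * A spectral bound without a spectral measure *)

Definition complete_ip (R : realType) (V : lmodType R) (ip : V -> V -> R) :=
  forall f : nat -> V,
    (forall e, 0 < e -> exists N, forall m n, (N <= m)%N -> (N <= n)%N ->
       ip (f m - f n) (f m - f n) <= e) ->
    exists z, forall e, 0 < e -> exists N, forall n, (N <= n)%N ->
      ip (f n - z) (f n - z) <= e.

(** A finite set of exceptional values leaves a gap immediately below M, even if
    M itself is exceptional. *)
Lemma left_gap (R : realFieldType) (S : seq R) (mu0 M : R) : mu0 < M ->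
  exists2 e, 0 < e & forall mu, M - e < mu -> mu < M -> mu0 < mu /\ mu \notin S.
Proof.
move=> muM; elim: S => [|s S [e e0 IH]].
  by exists (M - mu0) => [|mu ? ?]; [lra|split => //; lra].
have [sM|Ms] := ltP s M.
  exists (Num.min e (M - s)) => [|mu h muM']; first by rewrite lt_min e0 subr_gt0.
  have [le1 le2] : Num.min e (M - s) <= e /\ Num.min e (M - s) <= M - s.
    by rewrite !ge_min !lexx orbT.
  have [||? ?] := IH mu => //; first by lra.
  split => //; rewrite inE negb_or; apply/andP; split => //.
  by rewrite gt_eqF//; lra.
exists e => // mu h muM'; have [? ?] := IH mu h muM'; split => //.
by rewrite inE negb_or lt_eqF ?(lt_le_trans muM' Ms).
Qed.

Section SpectralBound.
Variables (R : realType) (V : lmodType R) (ip : V -> V -> R).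
Hypothesis sip : semi_inner ip.
Hypothesis cpl : complete_ip ip.
Variable A : V -> V.
Hypothesis Asym : forall f g, ip (A f) g = ip f (A g).
Hypothesis A_ge0 : forall f, 0 <= ip (A f) f.
Hypothesis A_le1 : forall f, ip (A f) f <= ip f f.
Variables (mu0 : R) (S : seq R).
Hypothesis mu0_gt0 : 0 < mu0.
Hypothesis bounded_below : forall mu, mu0 < mu -> mu \notin S ->
  exists2 c, 0 < c & forall f,
    c * ip f f <= ip (A f - mu *: f) (A f - mu *: f).

Definition orth_eigen u := forall s v, s \in S ->
  ip (A v - s *: v) (A v - s *: v) = 0 -> ip u v = 0.

Local Notation W := orth_eigen.
Local Notation L u p := (moment ip A u p).
Local Notation oA p u := (opoly A p u).

Let mE := momentE sip A.

(** The orthogonal complement of eigenspaces is invariant under A. *)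
Lemma orth_eigen_opoly p u : W u -> W (oA p u).
Proof.
move=> Wu s v sS sv; rewrite /opoly (ip_suml sip) big1// => i _.
rewrite !(ipE sip); suff -> : ip (iter i A u) v = 0 by rewrite mulr0.
elim: (i : nat) => [|j IHj]; first exact: Wu sv.
rewrite iterS Asym -[A v](subrK (s *: v)) (ipDr sip) (ipZr sip) IHj mulr0 addr0.
by rewrite (ipC sip) (ip_null sip).
Qed.

Lemma moment_one u : L u 1 = ip u u.
Proof. by rewrite /moment opoly1. Qed.

Lemma moment_op u : L u 'X = ip (A u) u.
Proof. by rewrite -['X]mulr1 -[1]mulr1 (momentX sip Asym) opoly1. Qed.

Lemma moment_sqr_ge0 u p : 0 <= L u (p * p).
Proof. by rewrite (moment_sqr sip)//; exact: (ip_ge0 sip). Qed.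

Lemma moment_op_ge0 u p : 0 <= L u ('X * (p * p)).
Proof. by rewrite (momentX sip). Qed.

Lemma moment_op_le u p : L u ('X * (p * p)) <= L u (p * p).
Proof. by rewrite (momentX sip)// (moment_sqr sip). Qed.

(** From A <= 1 and A >= 0 follows A^2 <= 1: Cauchy-Schwarz for the form of A
    gives |Av|^4 <= (Av, v) (A Av, Av) <= |v|^2 |Av|^2. *)
Lemma moment_op2_le u p : L u ('X * 'X * (p * p)) <= L u (p * p).
Proof.
have h := moment_CS sip p ('X * p) (fun q => moment_op_ge0 u q).
have h1 := moment_op_le u p; have h2 := moment_op_le u ('X * p).
have h3 := moment_op_ge0 u p; have h4 := moment_sqr_ge0 u p.
have h5 := moment_sqr_ge0 u ('X * p); have h6 := moment_op_ge0 u ('X * p).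
have -> : 'X * 'X * (p * p) = ('X * p) * ('X * p) by ring.
have E : 'X * (p * ('X * p)) = ('X * p) * ('X * p) by ring.
rewrite E in h.
rewrite leNgt; apply/negP => lt.
have : L u ('X * p * ('X * p)) ^+ 2 <= L u (p * p) * L u ('X * p * ('X * p)).
  by apply: le_trans h _; apply: ler_pM.
rewrite expr2 ler_pM2r; last by rewrite (le_lt_trans h4).
by rewrite leNgt lt.
Qed.

(** M is the supremum of the form of A on the unit vectors of the complement W.
    The assumption M > mu0 is shown to be contradictory. *)
Section TopOfSpectrum.
Variable M : R.
Hypothesis mu0M : mu0 < M.
Hypothesis M1 : M <= 1.
Hypothesis QM : forall w, W w -> ip (A w) w <= M * ip w w.
Hypothesis Msup : forall c, 0 < c ->
  exists2 u, W u & M * ip u u - ip (A u) u < c * ip u u.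

Local Notation t := (M%:P - 'X : {poly R}).

Lemma moment_top_ge0 u p : W u -> 0 <= L u (t * (p * p)).
Proof.
move=> Wu; rewrite mulrBl !mE (momentX sip)// (moment_sqr sip)// subr_ge0.
by apply: QM; exact: orth_eigen_opoly.
Qed.

(** If M were not in S, then A - M would be bounded below. Cauchy-Schwarz for
    the form of t = M - A, which is nonnegative on W, gives
    |tu|^4 <= (tu, u) (t^2 u, tu) <= M (tu, u) |tu|^2, and (tu, u) can be made
    arbitrarily small compared with |u|^2. *)
Lemma top_in_S : M \in S.
Proof.
apply: contraPT isT => MS; have [c c0 hc] := bounded_below mu0M MS.
have [u Wu hu] := Msup c0.
have := hc (oA 1 u); rewrite (moment_shift sip)// opoly1.
have -> : ('X - M%:P) * 1 * (('X - M%:P) * 1) = t * t by ring.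
move=> ck.
have k0 := moment_sqr_ge0 u t.
have h := moment_CS sip 1 t (fun p => moment_top_ge0 p Wu).
rewrite mul1r mulr1 mulr1 in h.
have h2 : L u (t * (t * t)) <= M * L u (t * t).
  have : L u (M%:P * (t * t)) - L u (t * (t * t)) = L u ('X * (t * t)).
    by rewrite -!mE; congr moment; ring.
  rewrite !mE; have := moment_op_ge0 u t; lra.
have t0 : L u t = M * ip u u - ip (A u) u by rewrite -[M%:P]mulr1 !mE moment_one moment_op.
rewrite -t0 in hu.
have t_ge0 : 0 <= L u t by rewrite -[t]mulr1 -[1]mulr1; exact: moment_top_ge0.
move: k0 h h2 ck hu t_ge0; set k := L u (t * t); set k3 := L u (t * _).
set k1 := L u t => k0 h h2 ck hu t_ge0.
have : k ^+ 2 <= k1 * k.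
  apply: le_trans h _; apply: ler_wpM2l => //; apply: le_trans h2 _.
  by rewrite ler_piMl.
rewrite expr2 ler_pM2r; last lra.
by move=> ?; lra.
Qed.

(** If the interval of radius d around c0 contains no value of S and lies above
    mu0, then |(A - c0)w| >= d |w| on W. Otherwise let m^2 < d^2 be the infimum
    of |(A - c0)w|^2 / |w|^2 on W. The operator (A - c0)^2 - m^2 is nonnegative
    on W and equals (A - c0 - m) (A - c0 + m), a product of two operators that
    are bounded below; so it cannot have almost null vectors. *)
Lemma gap_bound c0 d u : 0 < d -> 0 <= c0 -> c0 <= 1 ->
  (forall mu, c0 - d < mu -> mu < c0 + d -> mu0 < mu /\ mu \notin S) ->
  W u -> d ^+ 2 * ip u u <= L u (('X - c0%:P) * ('X - c0%:P)).
Proof.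
move=> d0 c00 c01 hgap Wu.
set y := 'X - c0%:P.
have [u0|u0] := eqVneq (ip u u) 0; first by rewrite u0 mulr0 moment_sqr_ge0.
have {}u0 : 0 < ip u u by rewrite lt_neqAle eq_sym u0 (ip_ge0 sip).
pose F w := L w (y * y).
have F0 w : 0 <= F w by exact: moment_sqr_ge0.
have FE p w : F (oA p w) = L w (y * y * (p * p)).
  have := moment_shift sip Asym (oA p w) 1 c0; rewrite opoly1 !mulr1 /F => <-.
  by rewrite (moment_shift sip Asym); congr moment; rewrite /y; ring.
pose B := [set x | forall w, W w -> x * ip w w <= F w]%classic.
have B0 : B 0 by move=> w _; rewrite mul0r.
have hB : has_sup B.
  split; first by exists 0.
  by exists (F u / ip u u) => x /(_ _ Wu); rewrite ler_pdivlMr.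
have mm0 : 0 <= sup B by exact: sup_upper_bound.
have Bm : B (sup B).
  move=> w Ww; have [w0|w0] := eqVneq (ip w w) 0; first by rewrite w0 mulr0.
  have {}w0 : 0 < ip w w by rewrite lt_neqAle eq_sym w0 (ip_ge0 sip).
  rewrite -ler_pdivlMr//; apply: ge_sup; first by exists 0.
  by move=> x /(_ _ Ww); rewrite ler_pdivlMr.
have Binf e : 0 < e -> exists2 w, W w & F w < (sup B + e) * ip w w.
  move=> e0; apply: contrapT => hw.
  have : B (sup B + e).
    move=> w Ww; rewrite leNgt; apply/negP => wF; apply: hw; by exists w.
  by move/(sup_upper_bound hB); lra.
move: (sup B) mm0 Bm Binf => mm mm0 Bm Binf.
have [dm|md] := leP (d ^+ 2) mm.
  by apply: le_trans (Bm _ Wu); rewrite ler_pM2r.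
exfalso.
pose m := Num.sqrt mm.
have m0 : 0 <= m by exact: sqrtr_ge0.
have mmE : mm = m ^+ 2 by rewrite sqr_sqrtr.
have md' : m < d by rewrite -ltr_sqr ?nnegrE// -?mmE// ltW.
have [||p1 s1] := hgap (c0 + m); [lra|lra|].
have [||p2 s2] := hgap (c0 - m); [lra|lra|].
have [e1 e1p h1] := bounded_below p1 s1.
have [e2 e2p h2] := bounded_below p2 s2.
have e12 : 0 < e1 * e2 / 2 by rewrite divr_gt0// mulr_gt0.
have [w Ww Fw] := Binf _ e12.
pose q := y * y - mm%:P.
have qpos p : 0 <= L w (q * (p * p)).
  rewrite mulrBl !mE -FE (moment_sqr sip)// subr_ge0; apply: Bm.
  exact: orth_eigen_opoly.
have lo : e1 * e2 * ip w w <= L w (q * q).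
  have := h2 (oA 1 w); rewrite (moment_shift sip)// opoly1 mulr1 => k2.
  have := h1 (oA ('X - (c0 - m)%:P) w).
  rewrite (moment_shift sip)// -(moment_sqr sip)//.
  have -> : ('X - (c0 + m)%:P) * ('X - (c0 - m)%:P) = q.
    by rewrite /q /y mmE polyCD polyCB polyC_exp; ring.
  by apply: le_trans; rewrite -mulrA ler_pM2l.
have cs := moment_CS sip 1 q qpos; rewrite mul1r !mulr1 in cs.
have q3 : L w (q * (q * q)) <= 2 * L w (q * q).
  have -> : q * (q * q) = 'X * 'X * (q * q) + (- (2 * c0))%:P * ('X * (q * q))
     + (c0 ^+ 2 - mm)%:P * (q * q).
    rewrite {1}/q /y !(polyCN, polyCD, polyCM, polyC_exp).
    by ring.
  rewrite !mE.
  have := moment_op2_le w q; have := moment_op_ge0 w q; have := moment_sqr_ge0 w q.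
  move: (L w ('X * 'X * (q * q))) (L w ('X * (q * q))) (L w (q * q)).
  move=> a3 a2 a1 h_1 h_2 h_3.
  have : 0 <= c0 * a2 by rewrite mulr_ge0.
  have : c0 ^+ 2 * a1 <= a1 by rewrite ler_piMl ?expr_le1.
  have : 0 <= mm * a1 by rewrite mulr_ge0.
  by move=> *; lra.
have w0 : 0 < ip w w.
  have := ip_ge0 sip w; rewrite le_eqVlt => /orP[/eqP w0|//].
  by have := F0 w; rewrite leNgt; move: Fw; rewrite -w0 mulr0 => ->.
have lq : L w q = F w - mm * ip w w by rewrite /q -[mm%:P]mulr1 !mE moment_one.
have lq0 : 0 <= L w q by have := qpos 1; rewrite !mulr1.
have lt1 : L w q < e1 * e2 / 2 * ip w w by lra.
have kp : 0 < L w (q * q) by apply: lt_le_trans lo; rewrite !mulr_gt0.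
have : L w (q * q) ^+ 2 <= L w q * (2 * L w (q * q)).
  by apply: le_trans cs _; apply: ler_wpM2l.
by rewrite mulrA expr2 ler_pM2r// => ?; lra.
Qed.

(** The gap between M and the rest of S, in operator form: t^2 >= e t on W for
    t = M - A. This is [gap_bound] at the centre of the gap. *)
Lemma top_gap : exists2 e, 0 < e & forall u p, W u ->
  e * L u (t * (p * p)) <= L u (t * t * (p * p)).
Proof.
have [e e0 he] := left_gap S mu0M; exists e => // u p Wu.
have c0M : mu0 < M - e / 2 by apply: (proj1 (he _ _ _)); lra.
have gb w (Ww : W w) :
    (e / 2) ^+ 2 * ip w w <= L w (('X - (M - e / 2)%:P) * ('X - (M - e / 2)%:P)).
  apply: gap_bound => //; first lra; first exact: ltW (lt_trans mu0_gt0 c0M).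
    by move: M1 e0 ; lra.
  by move=> mu h1 h2; apply: he; lra.
have := gb _ (orth_eigen_opoly p Wu).
have := moment_shift sip Asym (oA p u) 1 (M - e / 2); rewrite opoly1 !mulr1 => <-.
rewrite (moment_shift sip)// -(moment_sqr sip)// -(momentC sip A).
rewrite -subr_ge0 -!mE => h; rewrite -subr_ge0 -(momentN sip) -(momentD sip).
move: h; congr (_ <= moment ip A u _).
rewrite (_ : e%:P = (e / 2)%:P + (e / 2)%:P); last by rewrite -polyCD -splitr.
by rewrite polyCB polyC_exp; ring.
Qed.

(** The same inequality multiplied by t, by Cauchy-Schwarz for the form of
    t. *)
Lemma top_gap_iter : exists2 e, 0 < e & forall u p, W u ->
  e * L u (t * t * (p * p)) <= L u (t * t * t * (p * p)).
Proof.
have [e e0 he] := top_gap; exists e => // u p Wu.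
have := he u p Wu; have := moment_CS sip p (t * p) (fun q => moment_top_ge0 q Wu).
have := moment_top_ge0 p Wu; have := moment_top_ge0 (t * p) Wu; have := moment_sqr_ge0 u (t * p).
have -> : t * (p * (t * p)) = t * t * (p * p) by ring.
have -> : t * (t * p * (t * p)) = t * t * t * (p * p) by ring.
have -> : t * p * (t * p) = t * t * (p * p) by ring.
move: (L u (t * t * (p * p))) (L u (t * t * t * (p * p))) (L u (t * (p * p))).
move=> y z x; rewrite le_eqVlt.
move=> /orP[/eqP <-|y0] z0 x0 cs xy; first by rewrite mulr0.
rewrite -(ler_pM2r y0) -mulrA -expr2.
apply: (@le_trans _ _ (e * (x * z))); first by rewrite ler_pM2l.
by rewrite mulrA mulrC ler_wpM2l.
Qed.

Local Notation y := (M^-1%:P * 'X : {poly R}).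
Local Notation b u k := (L u (y ^+ k)).

Let M0 : 0 < M. Proof. exact: lt_trans mu0_gt0 mu0M. Qed.

Let onesub : 1 - y = M^-1%:P * t.
Proof. by rewrite mulrBr -polyCM mulVf ?gt_eqF. Qed.

Lemma moment_ratio_ge0 u p : 0 <= L u (y * (p * p)).
Proof. by rewrite -mulrA !mE mulr_ge0 ?invr_ge0 ?moment_op_ge0// ltW. Qed.

Lemma moment_coratio_ge0 u p : W u -> 0 <= L u ((1 - y) * (p * p)).
Proof.
move=> Wu; rewrite onesub -mulrA (momentC sip) mulr_ge0 ?invr_ge0 ?moment_top_ge0//.
exact: ltW.
Qed.

Lemma moment_ratioX_ge0 u k : 0 <= b u k.
Proof.
rewrite -[k]odd_double_half -addnn !exprD; case: odd.
  by rewrite expr1; exact: moment_ratio_ge0.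
by rewrite expr0 mul1r; exact: moment_sqr_ge0.
Qed.

Lemma moment_coratioX_ge0 u k : W u -> 0 <= L u ((1 - y) * y ^+ k).
Proof.
move=> Wu; rewrite -[k]odd_double_half -addnn !exprD; case: odd; last first.
  by rewrite expr0 mul1r; exact: moment_coratio_ge0.
set q := y ^+ k./2; have -> : (1 - y) * (y ^+ true * (q * q)) =
  y * (((1 - y) * q) * ((1 - y) * q)) + (1 - y) * ((y * q) * (y * q)).
  by rewrite expr1; ring.
by rewrite (momentD sip) addr_ge0 ?moment_coratio_ge0 ?moment_ratio_ge0.
Qed.

Lemma moment_ratioX_nincr u m n : W u -> (m <= n)%N -> b u n <= b u m.
Proof.
move=> Wu /subnK <-; elim: (n - m)%N => [//|k IH].
apply: le_trans IH; rewrite -subr_ge0.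
have := moment_coratioX_ge0 (k + m) Wu.
by rewrite mulrBl mul1r -exprS (momentD sip) (momentN sip) -addSn.
Qed.

Lemma nonneg_small (x c : R) : 0 <= x -> (forall e, 0 < e -> x <= c * e) -> x = 0.
Proof.
move=> x0 h; apply/eqP; rewrite eq_le x0 andbT leNgt; apply/negP => xp.
have c1 : 0 < `|c| + 1 by rewrite ltr_wpDl.
have := h (x / 2 / (`|c| + 1)) (divr_gt0 (divr_gt0 xp (ltr0n _ 2)) c1).
apply/negP; rewrite -ltNge.
apply: (@le_lt_trans _ _ ((`|c| + 1) * (x / 2 / (`|c| + 1)))).
  rewrite ler_wpM2r ?divr_ge0 ?ltW//; have := ler_norm c; lra.
by rewrite mulrCA divff ?gt_eqF// mulr1; lra.
Qed.

(** On W the operators (A/M)^k decrease, so the vectors (A/M)^k u form a Cauchy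
    sequence. Its limit lies in W and is an eigenvector for M, which belongs to
    S; hence the limit is orthogonal to itself. *)
Lemma moment_ratioX_cvg0 u : W u -> forall e, 0 < e ->
  exists N, forall k, (N <= k)%N -> b u k <= e.
Proof.
move=> Wu.
pose B := [set b u k | k in setT]%classic.
have hB : has_inf B.
  by split; [exists (b u 0%N); exists 0%N|exists 0 => _ [k _ <-]; exact: moment_ratioX_ge0].
have Blb k : inf B <= b u k by apply: ge_inf; [exact: hB.2|exists k].
have Bsm e : 0 < e -> exists N, forall k, (N <= k)%N -> b u k <= inf B + e.
  move=> e0; have [_ [N _ <-] hN] := inf_adherent e0 hB.
  by exists N => k Nk; apply: le_trans (ltW hN); exact: moment_ratioX_nincr.
have B0 : 0 <= inf B.
  by apply: lb_le_inf => [|_ [k _ <-]]; [exact: hB.1|exact: moment_ratioX_ge0].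
move: (inf B) Blb Bsm B0 => beta Blb Bsm B0.
pose v k := oA (y ^+ k) u.
have vv m n : ip (v m) (v n) = b u (m + n).
  by rewrite /v -(momentM sip)// -exprD.
have [|z hz] := cpl (f := v).
  move=> e e0; have [N hN] := Bsm _ (divr_gt0 e0 (ltr0n _ 2)).
  exists N => m n Nm Nn; rewrite !(ipE sip) !vv (addnC n m).
  have := Blb (m + n)%N; have := hN (m + m)%N; have := hN (n + n)%N.
  rewrite !(leq_trans Nm (leq_addr _ _)) !(leq_trans Nn (leq_addr _ _)).
  by move=> /(_ isT) ? /(_ isT) ? ?; lra.
have weak w e : 0 < e -> exists N, forall n, (N <= n)%N ->
    (ip (v n) w - ip z w) ^+ 2 <= ip w w * e.
  move=> e0; have [N hN] := hz _ e0; exists N => n Nn.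
  rewrite -(ipNl sip) -(ipDl sip); apply: le_trans (cauchy_schwarz sip _ _) _.
  by rewrite mulrC ler_wpM2l ?hN ?(ip_ge0 sip).
have Wz : W z.
  move=> s w sS sw; apply/eqP; rewrite -sqrf_eq0; apply/eqP.
  apply: (@nonneg_small _ (ip w w)) => [|e e0]; first exact: sqr_ge0.
  have [N /(_ N (leqnn _))] := weak w e e0.
  by rewrite (orth_eigen_opoly _ Wu sS sw) sub0r sqrrN.
have eigz w : ip z (A w) = M * ip z w.
  apply/eqP; rewrite -subr_eq0 -sqrf_eq0; apply/eqP.
  apply: (@nonneg_small _ (2 * ip (A w) (A w) + 2 * ip w w)) => [|e e0].
    exact: sqr_ge0.
  have [N1 h1] := weak w e e0; have [N2 h2] := weak (A w) e e0.
  pose n := maxn N1 N2.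
  have {h1} := h1 n.+1 (leqW (leq_maxl _ _)).
  have {h2} := h2 n (leq_maxr _ _).
  have -> : ip (v n) (A w) = M * ip (v n.+1) w.
    rewrite -Asym ip_A_opoly// (_ : 'X * _ = M *: y ^+ n.+1); last first.
      rewrite exprS -mul_polyC !mulrA -polyCM mulfV ?gt_eqF//.
      by rewrite mul1r.
    by rewrite opolyZ (ipE sip).
  move: (ip (v _) w) (ip z _) (ip z w) (ip (A w) _) (ip w w) => x p q a c h2 h1.
  have : M ^+ 2 * (x - q) ^+ 2 <= c * e.
    by apply: le_trans h1; rewrite ler_piMl ?sqr_ge0// expr_le1// ltW.
  rewrite -exprMn; have -> : p - M * q = - (M * x - p) + M * (x - q) by ring.
  move: (M * x - p) (M * (x - q)) h2 => r s; have := sqr_ge0 (r + s); nra.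
have z0 : ip z z = 0.
  apply: (Wz M) => //; first exact: top_in_S.
  by rewrite [LHS]ipDl// Asym ipNl// (ipZl sip) eigz subrr.
have beta0 : beta = 0.
  apply: (@nonneg_small _ 2) => // e e0; have [N /(_ N (leqnn _)) hN] := hz _ e0.
  apply: le_trans (Blb (N + N)%N) _; rewrite -vv.
  have := ip_add_le sip (v N - z) z; rewrite subrK z0; lra.
by move=> e e0; have [N hN] := Bsm e e0; exists N => k /hN; rewrite beta0 add0r.
Qed.

(** Apply t^3 >= e t^2 to r(A)u with 1 - (A/M)^N = t r. As N grows, (A/M)^N u
    tends to 0 and the inequality becomes (tu, u) >= e |u|^2 for all u in W,
    which contradicts the choice of M as a supremum. *)
Lemma top_absurd : False.
Proof.
have [e e0 he] := top_gap_iter.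
have key u : W u -> e * ip u u <= M * ip u u - ip (A u) u.
  move=> Wu; rewrite -moment_one.
  have -> : M * L u 1 - ip (A u) u = L u t by rewrite -[M%:P]mulr1 !mE moment_op.
  rewrite -subr_ge0 -oppr_le0 opprB.
  suff h d : 0 < d -> e * L u 1 - L u t <= (2 * e + M) * d.
    rewrite leNgt; apply/negP => p.
    have c0 : 0 < 2 * e + M by rewrite addr_gt0 ?mulr_gt0.
    have := h _ (divr_gt0 (divr_gt0 p (ltr0n _ 2)) c0).
    by rewrite mulrCA divff ?gt_eqF// mulr1; lra.
  move=> d0; have [N hN] := moment_ratioX_cvg0 Wu d0.
  have [r rE] : exists r, 1 - y ^+ N = t * r.
    exists (M^-1%:P * (\sum_(i < N) y ^+ i)).
    by rewrite mulrA (mulrC t) -onesub -opprB subrX1 -mulNr opprB.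
  have := he u r Wu.
  have -> : t * t * (r * r) = (t * r) * (t * r) by ring.
  have -> : t * t * t * (r * r) = t * ((t * r) * (t * r)) by ring.
  have tE : t = M%:P * (1 - y).
    by rewrite onesub mulrA -polyCM mulfV ?gt_eqF// mul1r.
  rewrite -rE.
  have -> : (1 - y ^+ N) * (1 - y ^+ N) = 1 - 2%:P * y ^+ N + y ^+ (N + N).
    by rewrite exprD; ring.
  rewrite {1}tE.
  have -> : M%:P * (1 - y) * (1 - 2%:P * y ^+ N + y ^+ (N + N)) =
    t - (2 * M)%:P * ((1 - y) * y ^+ N) + M%:P * (y ^+ (N + N) - y ^+ (N + N).+1).
    by rewrite exprS tE polyCM; ring.
  rewrite !mE.
  have := hN N (leqnn _); have := hN (N + N)%N (leq_addr _ _).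
  have := moment_ratioX_ge0 u (N + N); have := moment_ratioX_ge0 u (N + N).+1.
  have := moment_coratioX_ge0 N Wu.
  move: (L u ((1 - y) * y ^+ N)) (L u (y ^+ (N + N))) (L u (y ^+ (N + N).+1)) (L u (y ^+ N)) => x1 x2 x3 x4.
  move: (L u 1) (L u t) => x5 x6 *.
  have : 0 <= M * x1 by rewrite mulr_ge0// ltW.
  have : 0 <= M * x3 by rewrite mulr_ge0// ltW.
  have : 0 <= e * x2 by rewrite mulr_ge0// ltW.
  have : M * x2 <= M * d by rewrite ler_pM2l.
  have : e * x4 <= e * d by rewrite ler_pM2l.
  by move=> *; nra.
have [u Wu] := Msup e0; have := key u Wu; lra.
Qed.

End TopOfSpectrum.

(** Spectral bound without a spectral theorem: above mu0 the spectrum of A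
    consists of finitely many eigenvalues. If the supremum M of the quadratic
    form of A on the orthogonal complement W of their eigenspaces exceeded
    mu0, it would be an approximate eigenvalue, hence one of them and
    isolated; the gap below M forces (M - A)^2 >= e (M - A) on W, while
    (A/M)^k u tends to 0 because W has no eigenvector for M; together these
    give M - A >= e on W, contradicting the choice of M. *)
Theorem spectral_bound u : W u -> ip (A u) u <= mu0 * ip u u.
Proof.
move=> Wu; rewrite leNgt; apply/negP => hu.
have u0 : 0 < ip u u.
  have := ip_ge0 sip u; rewrite le_eqVlt => /orP[/eqP u0|//].
  by move: hu (A_le1 u); rewrite -u0 mulr0 => /lt_le_trans h /h; rewrite ltxx.
pose B := [set x | forall w, W w -> ip (A w) w <= x * ip w w]%classic.
have B1 : B 1 by move=> w _; rewrite mul1r.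
have hB : has_inf B.
  split; first by exists 1.
  by exists (ip (A u) u / ip u u) => x /(_ _ Wu); rewrite ler_pdivrMr.
have Bi : B (inf B).
  move=> w Ww; have := ip_ge0 sip w; rewrite le_eqVlt => /orP[/eqP w0|w0].
    by rewrite -w0 mulr0; apply: le_trans (A_le1 w) _; rewrite -w0.
  rewrite -ler_pdivrMr//; apply: lb_le_inf; first by exists 1.
  by move=> x /(_ _ Ww); rewrite ler_pdivrMr.
apply: (@top_absurd (inf B)).
- have : mu0 * ip u u < inf B * ip u u by exact: lt_le_trans hu (Bi _ Wu).
  by rewrite ltr_pM2r.
- by apply: ge_inf => //; exact: hB.2.
- exact: Bi.
- move=> c c0; apply: contrapT => hc.
  have : B (inf B - c).
    move=> w Ww; rewrite leNgt; apply/negP => h; apply: hc; exists w => //; lra.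
  by move/(ge_inf hB.2); lra.
Qed.

End SpectralBound.

(** * Orthonormalization *)

Section GramSchmidt.
Variables (R : realType) (V : lmodType R) (ip : V -> V -> R).
Hypothesis sip : semi_inner ip.

(** Independence is meant modulo null vectors. The third clause is the form in
    which the equality of the two spans is needed later. *)
Lemma gram_schmidt_nat (e : nat -> V) (m : nat) :
  (forall c : nat -> R, let v := \sum_(i < m) c i *: e i in
     ip v v = 0 -> forall i, (i < m)%N -> c i = 0) ->
  exists f : nat -> V,
    [/\ forall i, (i < m)%N -> exists c : nat -> R, f i = \sum_(j < m) c j *: e j,
        forall i j, (i < m)%N -> (j < m)%N -> ip (f i) (f j) = (i == j)%:R &
        forall w, (forall i, (i < m)%N -> ip (f i) w = 0) ->
          forall i, (i < m)%N -> ip (e i) w = 0].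
Proof.
elim: m => [|m IH] ind; first by exists e; split.
have [|f [fspan fon fker]] := IH.
  move=> c v vv i im.
  pose c' j := if (j < m)%N then c j else 0.
  have E : \sum_(j < m.+1) c' j *: e j = v.
    rewrite big_ord_recr /= /c' ltnn scale0r addr0.
    by apply: eq_bigr => j _; rewrite ltn_ord.
  have := ind c'; rewrite /= E => /(_ vv i (ltnW im)).
  by rewrite /c' im.
pose r := e m - \sum_(k < m) ip (f k) (e m) *: f k.
have rf k : (k < m)%N -> ip (f k) r = 0.
  move=> km; rewrite /r (ipDr sip) (ipNr sip) (ip_sumr sip).
  rewrite (bigD1 (Ordinal km))//= big1 => [|j jk].
    by rewrite (ipZr sip) fon// eqxx mulr1 addr0 subrr.
  rewrite (ipZr sip) fon// (_ : (k == j) = false) ?mulr0//.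
  by apply/negbTE; apply: contra_neq jk => kj; apply: val_inj; rewrite /= kj.
have /choice[a ha] : forall i, exists c : nat -> R, (i < m)%N -> f i = \sum_(j < m) c j *: e j.
  move=> i; have [/fspan[c fE]|mi] := ltnP i m; first by exists c.
  by exists (fun=> 0).
have [cr crm rE] : exists2 c : nat -> R, c m = 1 & r = \sum_(j < m.+1) c j *: e j.
  exists (fun j => if (j < m)%N then - \sum_(k < m) ip (f k) (e m) * a k j else 1).
    by rewrite ltnn.
  rewrite big_ord_recr /= ltnn scale1r addrC /r; congr (_ + _).
  rewrite (eq_bigr (fun k : 'I_m => \sum_(j < m) (ip (f k) (e m) * a k j) *: e j)); last first.
    move=> k _; rewrite {2}(ha k (ltn_ord k)) scaler_sumr.
    by apply: eq_bigr => j _; rewrite scalerA.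
  rewrite exchange_big -sumrN; apply: eq_bigr => j _.
  by rewrite ltn_ord scaleNr scaler_suml.
have r0 : 0 < ip r r.
  rewrite lt_neqAle eq_sym (ip_ge0 sip) andbT; apply/eqP => rr0.
  have := ind cr; rewrite /= -rE => /(_ rr0 m (leqnn _)); rewrite crm => /eqP.
  by rewrite oner_eq0.
pose s := (Num.sqrt (ip r r))^-1.
have s0 : 0 < s by rewrite invr_gt0 sqrtr_gt0.
have ss : s * (s * ip r r) = 1.
  by rewrite mulrA -expr2 exprVn sqr_sqrtr ?ltW// mulVf ?gt_eqF.
pose f' i := if (i < m)%N then f i else s *: r.
have f'm i : (i < m)%N -> f' i = f i by rewrite /f' => ->.
have f'M : f' m = s *: r by rewrite /f' ltnn.
exists f'; split.
- move=> i; rewrite ltnS leq_eqVlt => /orP[/eqP ->|im].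
    exists (fun j => s * cr j); rewrite f'M rE scaler_sumr.
    by apply: eq_bigr => j _; rewrite scalerA.
  have [c fE] := fspan i im; exists (fun j => if (j < m)%N then c j else 0).
  rewrite f'm// big_ord_recr /= ltnn scale0r addr0 fE.
  by apply: eq_bigr => j _; rewrite ltn_ord.
- move=> i j; rewrite ltnS leq_eqVlt => /orP[/eqP ->|im];
    rewrite ltnS leq_eqVlt => /orP[/eqP ->|jm].
  + by rewrite f'M (ipZl sip) (ipZr sip) ss eqxx.
  + by rewrite f'M f'm// (ipZl sip) (ipC sip) rf// mulr0 gtn_eqF.
  + by rewrite f'M f'm// (ipZr sip) rf// mulr0 ltn_eqF.
  + by rewrite !f'm// fon.
- move=> w hw.
  have hm i : (i < m)%N -> ip (f i) w = 0.
    by move=> im; rewrite -f'm//; apply: hw; exact: ltnW.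
  move=> i; rewrite ltnS leq_eqVlt => /orP[/eqP ->|im]; last exact: fker.
  have : ip r w = 0.
    have := hw m (leqnn _); rewrite f'M (ipZl sip) => /eqP.
    by rewrite mulf_eq0 (gt_eqF s0) /= => /eqP.
  rewrite /r (ipDl sip) (ipNl sip) (ip_suml sip) big1 ?subr0// => k _.
  by rewrite (ipZl sip) hm// mulr0.
Qed.

Lemma gram_schmidt m (e : 'I_m -> V) :
  (forall c : 'I_m -> R, let v := \sum_i c i *: e i in
     ip v v = 0 -> forall i, c i = 0) ->
  exists f : nat -> V,
    [/\ forall i, (i < m)%N -> exists c : 'I_m -> R, f i = \sum_j c j *: e j,
        forall i j, (i < m)%N -> (j < m)%N -> ip (f i) (f j) = (i == j)%:R &
        forall w, (forall i, (i < m)%N -> ip (f i) w = 0) ->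
          forall i, ip (e i) w = 0].
Proof.
move=> ind; pose e' i : V := if insub i is Some j then e j else 0.
have e'E (i : 'I_m) : e' i = e i by rewrite /e' valK.
have [|f [f1 f2 f3]] := @gram_schmidt_nat e' m.
  move=> c v vv i im; have := ind (fun j : 'I_m => c j).
  have -> : \sum_(j < m) c j *: e j = v by apply: eq_bigr => j _; rewrite e'E.
  by move=> /(_ vv (Ordinal im)).
exists f; split => // [i /f1[c ->]|w hw i].
  by exists (fun j : 'I_m => c j); apply: eq_bigr => j _; rewrite e'E.
by rewrite -e'E; exact: f3.
Qed.

End GramSchmidt.

(** * Operators defined by quadratic forms *)

(** In the application H1 u G says that u has weak gradient G; it is a relation
    because gradients are only determined almost everywhere. *)
Section FormOperator.
Variables (R : realType) (V : lmodType R) (ip : V -> V -> R) (n : nat).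
Hypothesis sip : semi_inner ip.
Hypothesis cpl : complete_ip ip.
Variable H1 : V -> ('I_n -> V) -> Prop.
Hypothesis H1_lin : forall a u G v H, H1 u G -> H1 v H ->
  H1 (u + a *: v) (fun i => G i + a *: H i).

Definition dform (G H : 'I_n -> V) : R := \sum_i ip (G i) (H i).

Definition form_op u f := exists2 G, H1 u G &
  forall v H, H1 v H -> dform G H = ip f v.

Lemma dformC G H : dform G H = dform H G.
Proof. by apply: eq_bigr => i _; rewrite (ipC sip). Qed.

Lemma dform_ge0 G : 0 <= dform G G.
Proof. by apply: sumr_ge0 => i _; exact: (ip_ge0 sip). Qed.

Lemma dform_lin a G H K :
  dform (fun i => G i + a *: H i) K = dform G K + a * dform H K.
Proof.
by rewrite mulr_sumr -big_split; apply: eq_bigr => i _; rewrite !(ipE sip).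
Qed.

Lemma dform_linr a G H K :
  dform K (fun i => G i + a *: H i) = dform K G + a * dform K H.
Proof. by rewrite !(dformC K) dform_lin. Qed.

(** The operator is symmetric because the form is. *)
Lemma form_op_sym u f v g : form_op u f -> form_op v g -> ip f v = ip u g.
Proof.
move=> [G uG hf] [H vH hg].
by rewrite -(hf _ _ vH) dformC (hg _ _ uG) (ipC sip).
Qed.

Lemma form_op_ge0 u f : form_op u f -> 0 <= ip f u.
Proof. by move=> [G uG hf]; rewrite -(hf _ _ uG) dform_ge0. Qed.

Lemma form_op_null u f g : form_op u f -> ip (f - g) (f - g) = 0 -> form_op u g.
Proof.
move=> [G uG hf] fg; exists G => // v H vH; rewrite (hf _ _ vH).
by apply/eqP; rewrite -subr_eq0 -(ipNl sip) -(ipDl sip) (ip_null sip).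
Qed.

Section Bound.
Variables (gam : R) (S : seq R).
Hypothesis gam0 : 0 < gam.
Hypothesis S0 : forall s, s \in S -> 0 <= s.
Hypothesis surj : forall f, exists u h,
  form_op u h /\ ip (h + u - f) (h + u - f) = 0.
Hypothesis resolvent : forall lambda, lambda < gam -> lambda \notin S ->
  exists C, forall u h, form_op u h ->
    ip u u <= C * ip (h - lambda *: u) (h - lambda *: u).

Definition orth_eigenspaces w := forall s v, s \in S -> form_op v (s *: v) -> ip w v = 0.

(** A choice of a solution u of h + u = f for every f, that is the operator
    (1 + T)^-1, where T is the operator of the form. *)
Lemma form_resolvent : exists A : V -> V, forall f, exists h,
  form_op (A f) h /\ ip (h + A f - f) (h + A f - f) = 0.
Proof. by have /choice[A hA] := surj; exists A. Qed.

Lemma ip_eqr w x y : ip (x - y) (x - y) = 0 -> ip x w = ip y w.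
Proof.
by move=> xy; apply/eqP; rewrite -subr_eq0 -(ipNl sip) -(ipDl sip) (ip_null sip).
Qed.

(** [spectral_bound] for A = (1 + T)^-1 with mu0 = 1 / (1 + gam), where T is the
    operator of the form: values of the spectrum of A above mu0 correspond to
    values lambda < gam of the spectrum of T. The bound passes from A to the
    form by Cauchy-Schwarz for the form plus the scalar product, since
    the value of this larger product at Av and v is the squared norm of v. *)
Lemma form_bound v H : H1 v H -> orth_eigenspaces v -> gam * ip v v <= dform H H.
Proof.
move=> vH Wv.
have [A hA] := form_resolvent.
pose mu0 := (1 + gam)^-1.
have g1 : 0 < 1 + gam by rewrite addr_gt0.
have mu0p : 0 < mu0 by rewrite invr_gt0.
have Asym f g : ip (A f) g = ip f (A g).
  have [h [Nh fh]] := hA f; have [k [Nk gk]] := hA g.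
  rewrite -(ip_eqr _ fh) (ipC sip (A f)) -(ip_eqr _ gk) !(ipDl sip).
  by rewrite (form_op_sym Nh Nk) (ipC sip k) (ipC sip (A g)).
have Aff f : exists h, [/\ form_op (A f) h, ip (h + A f - f) (h + A f - f) = 0,
    ip (A f) f = ip h (A f) + ip (A f) (A f) & ip f f = ip h h + 2 * ip h (A f) + ip (A f) (A f)].
  have [h [Nh fh]] := hA f; exists h; split => //.
    by rewrite (ipC sip) -(ip_eqr _ fh) (ipDl sip).
  rewrite -(ip_eqr _ fh) (ipC sip) -(ip_eqr _ fh) !(ipE sip) (ipC sip (A f) h); ring.
have A_ge0 f : 0 <= ip (A f) f.
  have [h [Nh _ -> _]] := Aff f.
  by rewrite addr_ge0 ?(form_op_ge0 Nh) ?(ip_ge0 sip).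
have A_le1 f : ip (A f) f <= ip f f.
  have [h [Nh _ -> ->]] := Aff f.
  have := form_op_ge0 Nh; have := ip_ge0 sip h; lra.
pose S' := [seq (1 + s)^-1 | s <- S].
(* A - mu is bounded below as soon as lambda = 1/mu - 1 is a regular value of
   the operator of the form. *)
have bb mu : mu0 < mu -> mu \notin S' ->
  exists2 c, 0 < c & forall f, c * ip f f <= ip (A f - mu *: f) (A f - mu *: f).
  move=> mu0mu muS; have mup : 0 < mu := lt_trans mu0p mu0mu.
  pose l := mu^-1 - 1.
  have lg : l < gam.
    rewrite /l ltrBlDl -[ltRHS]invrK ltf_pV2 ?posrE ?invr_gt0//.
  have lS : l \notin S.
    apply: contra muS => lS; apply/mapP; exists l => //.
    by rewrite /l addrC subrK invrK.
  have [C0 hC0] := resolvent lg lS.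
  pose C := `|C0|.
  have C_ge0 : 0 <= C by exact: normr_ge0.
  have hC u h : form_op u h -> ip u u <= C * ip (h - l *: u) (h - l *: u).
    move=> Nu; apply: le_trans (hC0 _ _ Nu) _.
    by apply: ler_wpM2r; [exact: (ip_ge0 sip)|exact: ler_norm].
  pose k := mu ^- 2 * (2 * (C * mu ^- 2) + 2).
  have k0 : 0 < k.
    by rewrite mulr_gt0 ?invr_gt0 ?exprn_gt0// ltr_wpDl// !mulr_ge0// invr_ge0 exprn_ge0// ltW.
  exists k^-1; first by rewrite invr_gt0.
  move=> f; rewrite mulrC ler_pdivrMr//.
  have [h [Nh fh _ _]] := Aff f.
  pose X := A f - mu *: f; pose Y := h - l *: A f.
  have XY : ip X X = mu ^+ 2 * ip Y Y.
    have E w : ip X w = - mu * ip Y w.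
      rewrite /X /Y !(ipE sip) -(ip_eqr _ fh) !(ipE sip) /l mulrBl mul1r; field.
      by rewrite gt_eqF.
    by rewrite E (ipC sip Y) E; ring.
  have fX : f = mu^-1 *: (A f - X).
    by rewrite /X opprB addrC subrK scalerA mulVf ?gt_eqF// scale1r.
  have m2 : 0 < mu ^- 2 by rewrite invr_gt0 exprn_gt0.
  have YX : ip Y Y = mu ^- 2 * ip X X.
    by rewrite XY mulrA mulVf ?mul1r// expf_neq0// gt_eqF.
  have -> : ip f f = mu ^- 2 * ip (A f - X) (A f - X).
    have -> : ip f f = ip (mu^-1 *: (A f - X)) (mu^-1 *: (A f - X)) by rewrite -fX.
    by rewrite (ipZl sip) (ipZr sip) mulrA -expr2 exprVn.
  rewrite -/X /k [leRHS]mulrC -mulrA ler_pM2l//.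
  apply: le_trans (ip_add_le sip _ _) _.
  rewrite (ipNl sip) (ipNr sip) opprK.
  have := hC _ _ Nh; rewrite -/Y YX => ?; lra.
(* Eigenvectors of A are, up to null vectors, eigenvectors of the operator. *)
have WW : orth_eigen ip A S' v.
  move=> _ w /mapP[s sS ->] ws.
  have [h [Nh wh _ _]] := Aff w.
  have s1 : 0 < 1 + s by rewrite ltr_pwDl// S0.
  have Ew x : ip w x = (1 + s) * ip (A w) x.
    by rewrite (ip_eqr x ws) (ipZl sip) mulrA mulfV ?gt_eqF// mul1r.
  have Nw : form_op (A w) (s *: A w).
    apply: form_op_null Nh _; set z := _ - _.
    have : forall x, ip z x = 0; last by apply.
    move=> x; have := ip_eqr x wh; rewrite (ipDl sip) Ew /z !(ipE sip); lra.
  by rewrite (ipC sip) Ew (ipC sip) (Wv _ _ sS Nw) mulr0.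
have key := spectral_bound sip cpl Asym A_ge0 A_le1 mu0p bb WW.
have [h [[G uG hG] vh E1 _]] := Aff v.
(* Cauchy-Schwarz for the form plus the scalar product, at A v and v. *)
have : (ip (A v) v + dform G H) ^+ 2 <=
    (ip (A v) (A v) + dform G G) * (ip v v + dform H H).
  apply: discriminant_le0 => [|x].
    by rewrite addr_ge0 ?(ip_ge0 sip) ?dform_ge0.
  have -> : ip (A v) (A v) + dform G G + x * (2 * (ip (A v) v + dform G H)) +
      x ^+ 2 * (ip v v + dform H H) =
    ip (A v + x *: v) (A v + x *: v) +
    dform (fun i => G i + x *: H i) (fun i => G i + x *: H i).
    rewrite dform_lin !dform_linr.
    by rewrite !(ipE sip) (ipC sip v (A v)) (dformC H G); ring.
  by rewrite addr_ge0 ?(ip_ge0 sip) ?dform_ge0.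
rewrite (hG _ _ uG) (hG _ _ vH) [ip (A v) (A v) + _]addrC -E1.
have -> : ip (A v) v + ip h v = ip v v by rewrite addrC -(ipDl sip) (ip_eqr _ vh).
have := ip_ge0 sip v; rewrite le_eqVlt => /orP[/eqP <- _|v0]; first by rewrite mulr0 dform_ge0.
move=> h1; have : ip v v ^+ 2 <= mu0 * ip v v * (ip v v + dform H H).
  by apply: le_trans h1 _; rewrite ler_wpM2r// addr_ge0 ?(ip_ge0 sip) ?dform_ge0.
rewrite expr2 -mulrA [_ * (ip v v * _)]mulrCA ler_pM2l// /mu0 mulrC ler_pdivlMr//; lra.
Qed.

End Bound.

(** Averaged variational principle: if the form is at least gam on the
    orthogonal complement of finitely many orthonormal eigenvectors, expanding
    v on them gives a lower bound of a Riesz mean. *)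
Lemma riesz_mean_ge (gam : R) (K : nat) (e : nat -> V) (l : nat -> R) :
  (forall i j, (i < K)%N -> (j < K)%N -> ip (e i) (e j) = (i == j)%:R) ->
  (forall k, (k < K)%N -> form_op (e k) (l k *: e k)) ->
  (forall w H, H1 w H -> (forall k, (k < K)%N -> ip (e k) w = 0) ->
    gam * ip w w <= dform H H) ->
  forall v H, H1 v H ->
  gam * ip v v - dform H H <= \sum_(k < K) (gam - l k) * ip (e k) v ^+ 2.
Proof.
move=> on Ne bnd v H vH; pose c k := ip (e k) v.
have step : forall m, (m <= K)%N -> exists w H', [/\ H1 w H',
    dform H' H' = dform H H - \sum_(k < m) l k * c k ^+ 2,
    ip w w = ip v v - \sum_(k < m) c k ^+ 2 &
    forall k, (k < K)%N -> ip (e k) w = if (k < m)%N then 0 else c k].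
  elim=> [_|m IH mK].
    by exists v, H; rewrite !big_ord0 !subr0; split.
  have [w [H' [wH' HH' ww cw]]] := IH (ltnW mK).
  have [E eE hE] := Ne m mK.
  exists (w + (- c m) *: e m), (fun i => H' i + (- c m) *: E i); split.
  - exact: H1_lin.
  - rewrite dform_lin !dform_linr (dformC H' E) (hE _ _ eE) (hE _ _ wH') !(ipZl sip).
    rewrite on// eqxx (cw m mK) ltnn HH' big_ord_recr /=; ring.
  - rewrite (ipDl sip) !(ipDr sip) !(ipZl sip) !(ipZr sip) on// eqxx (ipC sip w).
    rewrite (cw m mK) ltnn ww big_ord_recr /=; ring.
  - move=> k kK; rewrite (ipDr sip) (ipZr sip) on// cw// [in RHS]ltnS [in RHS]leq_eqVlt.
    have [->|km] := eqVneq k m; first by rewrite mulr1 ltnn addrN.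
    by rewrite mulr0 addr0.
have [w [H' [wH' HH' ww cw]]] := step K (leqnn K).
have := bnd _ _ wH'; rewrite HH' ww => bw.
have : gam * (ip v v - \sum_(k < K) c k ^+ 2) <=
    dform H H - \sum_(k < K) l k * c k ^+ 2.
  by apply: bw => k kK; rewrite cw// kK.
have -> : \sum_(k < K) (gam - l k) * ip (e k) v ^+ 2 =
    gam * (\sum_(k < K) c k ^+ 2) - \sum_(k < K) l k * c k ^+ 2.
  by rewrite mulr_sumr -sumrB; apply: eq_bigr => k _; rewrite mulrBl.
rewrite mulrBr; lra.
Qed.

Lemma form_op_lin a u f v g : form_op u f -> form_op v g ->
  form_op (u + a *: v) (f + a *: g).
Proof.
move=> [G uG hf] [H vH hg]; exists (fun i => G i + a *: H i); first exact: H1_lin.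
by move=> w K wK; rewrite dform_lin (hf _ _ wK) (hg _ _ wK) !(ipE sip).
Qed.

Lemma form_op_sum m (c : 'I_m -> R) (b h : 'I_m -> V) u f : form_op u f ->
  (forall i, form_op (b i) (h i)) -> form_op (\sum_i c i *: b i) (\sum_i c i *: h i).
Proof.
move=> uf bh.
have form_op0 : form_op 0 0.
  by have := form_op_lin (-1) uf uf; rewrite !scaleN1r !subrr.
apply: (big_ind2 form_op) => // [v k v' k' vk vk'|i _].
- by have := form_op_lin 1 vk vk'; rewrite !scale1r.
- by have := form_op_lin (c i) form_op0 (bh i); rewrite !add0r.
Qed.

(** An enumeration of eigenvalues repeated according to the dimension of the
    eigenspaces can be matched with orthonormal eigenvectors: Gram-Schmidt
    inside every eigenspace, and distinct eigenspaces are orthogonal. *)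
Lemma eigenbasis (gamma : nat -> R) :
  (forall lambda, exists m, ([set k | gamma k = lambda] #= `I_m)%card /\
    exists b : 'I_m -> V,
    [/\ forall i, form_op (b i) (lambda *: b i),
        forall c : 'I_m -> R, let v := \sum_i c i *: b i in
          ip v v = 0 -> forall i, c i = 0 &
        forall u, form_op u (lambda *: u) -> exists c : 'I_m -> R,
          ip (u - \sum_i c i *: b i) (u - \sum_i c i *: b i) = 0]) ->
  exists e : nat -> V,
    [/\ forall i j, ip (e i) (e j) = (i == j)%:R,
        forall k, form_op (e k) (gamma k *: e k) &
        forall lambda w, (forall k, gamma k = lambda -> ip (e k) w = 0) ->
          forall v, form_op v (lambda *: v) -> ip w v = 0].
Proof.
move=> hb.
have {hb} : forall lambda, exists fi : (nat -> V) * (nat -> nat),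
    [/\ forall k, gamma k = lambda -> form_op (fi.1 (fi.2 k)) (lambda *: fi.1 (fi.2 k)),
        forall i j, gamma i = lambda -> gamma j = lambda ->
          ip (fi.1 (fi.2 i)) (fi.1 (fi.2 j)) = (i == j)%:R &
        forall w, (forall k, gamma k = lambda -> ip (fi.1 (fi.2 k)) w = 0) ->
          forall v, form_op v (lambda *: v) -> ip w v = 0].
  move=> lambda; have [m [cm [b [bN bI bS]]]] := hb lambda.
  have [f [f1 f2 f3]] := gram_schmidt sip bI.
  have /card_set_bijP[idx [idxf idxi idxs]] := cm.
  exists (f, idx); split=> /=.
  - move=> k kl; have im : (idx k < m)%N by exact: idxf kl.
    have [c ->] := f1 _ im.
    have := form_op_sum c (bN (Ordinal im)) bN; congr form_op.
    by rewrite scaler_sumr; apply: eq_bigr => j _; rewrite !scalerA mulrC.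
  - move=> i j il jl.
    have im : (idx i < m)%N by exact: idxf il.
    have jm : (idx j < m)%N by exact: idxf jl.
    rewrite f2//; congr (_%:R); congr nat_of_bool; apply/eqP/eqP => [|->//].
    by apply: idxi; apply/mem_set.
  - move=> w hw v vN; have [c hc] := bS _ vN.
    rewrite (ipC sip) (ip_eqr _ hc) (ip_suml sip) big1// => i _.
    rewrite (ipZl sip) f3 ?mulr0// => j jm.
    have [k kl <-] := idxs j jm.
    exact: hw.
move=> /choice[F hF]; exists (fun k => (F (gamma k)).1 ((F (gamma k)).2 k)); split.
- move=> i j; have [ij|ij] := eqVneq (gamma i) (gamma j).
    by have [_ h _] := hF (gamma i); rewrite -ij h.
  have [hi _ _] := hF (gamma i); have [hj _ _] := hF (gamma j).
  have [E|_] := eqVneq i j; first by rewrite E eqxx in ij.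
  have := form_op_sym (hi i erefl) (hj j erefl).
  rewrite (ipZl sip) (ipZr sip) => /eqP.
  by rewrite -subr_eq0 -mulrBl mulf_eq0 subr_eq0 (negbTE ij) => /eqP.
- by move=> k; have [h _ _] := hF (gamma k); exact: h.
- move=> lambda w hw v vN; have [_ _ h] := hF lambda.
  by apply: h vN => k kl; have := hw k kl; rewrite kl.
Qed.

End FormOperator.

(** * Completeness of square-integrable functions *)

Section Lfun2.
Context d (T : measurableType d) (R : realType).
Variable mu : {measure set T -> \bar R}.
Variable D : set T.
Hypothesis mD : measurable D.

Lemma le1_2 : (1 <= 2%:E :> \bar R)%E.
Proof. by rewrite lee_fin ler1n. Qed.

Local Notation L := (LfunType mu le1_2).

Lemma Lfun2P (f : T -> R) : measurable_fun setT f ->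
  (\int[mu]_x (f x ^+ 2)%:E < +oo)%E -> f \in Lfun mu 2%:E.
Proof.
move=> mf fi; rewrite inE; apply/andP; split; rewrite inE//=.
rewrite /finite_norm unlock poweR_lty//.
by under eq_integral do rewrite /= powR_mulrn// real_normK ?num_real//.
Qed.

Definition ip2 (f g : L) : R := \int[mu]_(x in D) (f x * g x).

Lemma measurable_Lfun2 (f : L) : measurable_fun setT f.
Proof. exact: measurable_funPT. Qed.

Lemma measurable_mulL (f g : L) : measurable_fun D (fun x => (f x * g x)%:E).
Proof.
apply/measurable_EFinP; apply: measurable_funTS.
by apply: measurable_funM; exact: measurable_Lfun2.
Qed.

Lemma integrable_mulL (f g : L) : mu.-integrable D (EFin \o (fun x => f x * g x)).
Proof.
apply: (@integrableS _ _ _ _ setT) => //.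
have /Lfun1_integrable := Lfun2_mul_Lfun1 (LfunP f) (LfunP g).
by [].
Qed.

Lemma semi_inner_ip2 : semi_inner ip2.
Proof.
split.
- by move=> u v; apply: eq_Rintegral => x _; rewrite mulrC.
- move=> u v w; rewrite /ip2 -RintegralD//; try exact: integrable_mulL.
  by apply: eq_Rintegral => x _; rewrite -mulrDl.
- move=> a u w; rewrite /ip2 -RintegralZl//; try exact: integrable_mulL.
  by apply: eq_Rintegral => x _; rewrite mulrA.
- by move=> u; apply: Rintegral_ge0 => x _; rewrite -expr2 sqr_ge0.
Qed.

Lemma ip2E (f g : L) : (ip2 f g)%:E = (\int[mu]_(x in D) (f x * g x)%:E)%E.
Proof. by rewrite fineK//; apply: integrable_fin_num => //; exact: integrable_mulL. Qed.

Lemma ip2_null (f : L) : ip2 f f = 0 <-> (f : T -> R) = (fun=> 0) %[ae mu in D].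
Proof.
have mff : measurable_fun D (fun x => (f x * f x)%:E).
  apply/measurable_EFinP; apply: measurable_funTS.
  by apply: measurable_funM; exact: measurable_Lfun2.
split.
  move=> f0; have [+ _] := ae_eq_integral_abs mu mD mff.
  have -> : (\int[mu]_(x in D) `|(f x * f x)%:E| = 0)%E.
    rewrite -[RHS]/(0%:E) -f0 ip2E; apply: eq_integral => x _.
    by rewrite gee0_abs// lee_fin -expr2 sqr_ge0.
  move=> /(_ erefl); apply: filterS => x /= + Dx => /(_ Dx) [] /eqP.
  by rewrite mulf_eq0 orbb => /eqP.
move=> f0; apply: EFin_inj; rewrite ip2E.
rewrite (ae_eq_integral (cst 0%E))//=; first by rewrite integral0.
by apply: filterS f0 => x /= h Dx; rewrite h// mul0r.
Qed.

Lemma ip2_le_ereal (f : L) e : (\int[mu]_(x in D) (f x ^+ 2)%:E <= e%:E)%E -> ip2 f f <= e.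
Proof. by rewrite -lee_fin ip2E. Qed.

(** With weights depending on k, so that a sequence of squared norms of size
    4^-k gives a summable sequence of integrals of absolute values. *)
Lemma le_norm_sqr (k : nat) (y : R) : `|y| <= 2^-1 ^+ k + 2 ^+ k * y ^+ 2.
Proof.
have p0 : 0 < 2 ^+ k :> R by rewrite exprn_gt0.
rewrite exprVn -(ler_pM2l p0) mulrDr mulfV ?gt_eqF// mulrA -expr2 -exprMn.
rewrite -(real_normK (num_real (2 ^+ k * y))) normrM (gtr0_norm p0).
have := sqr_ge0 (2 ^+ k * `|y| - 1 / 2); nra.
Qed.

Lemma fast_subsequence (f : nat -> L) :
  (forall e, 0 < e -> exists N, forall m n, (N <= m)%N -> (N <= n)%N ->
       ip2 (f m - f n) (f m - f n) <= e) ->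
  exists n_ : nat -> nat, (forall k, (k <= n_ k)%N) /\
    forall k, ip2 (f (n_ k.+1) - f (n_ k)) (f (n_ k.+1) - f (n_ k)) <= 2^-1 ^+ (k + k).
Proof.
move=> cf.
have /choice[N hN] : forall k : nat, exists N, forall m n, (N <= m)%N -> (N <= n)%N ->
       ip2 (f m - f n) (f m - f n) <= 2^-1 ^+ (k + k).
  by move=> k; apply: cf; rewrite exprn_gt0// invr_gt0.
pose n_ k := (k + \sum_(i < k.+1) N i)%N.
have Nn k : (N k <= n_ k)%N by rewrite /n_ big_ord_recr /= addnA leq_addl.
have Nn' k : (N k <= n_ k.+1)%N.
  rewrite /n_ big_ord_recr /= big_ord_recr /=.
  by rewrite addnA (addnC _ (N k.+1)) !addnA leq_addl.
by exists n_; split => [k|k]; [exact: leq_addr|exact: hN].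
Qed.

(** Riesz-Fischer. A subsequence with summable increments converges pointwise
    outside a null set, and Fatou's lemma shows that the pointwise limit is also
    the limit in the mean. *)
Lemma complete_ip2 : (mu D < +oo)%E -> complete_ip ip2.
Proof.
move=> muD f cf.
have [n_ [n_ge n_fast]] := fast_subsequence cf.
pose h (k : nat) (x : T) : R := `|f (n_ k.+1) x - f (n_ k) x|.
have mh k : measurable_fun setT (h k).
  by apply: measurableT_comp => //; apply: measurable_funB; exact: measurable_Lfun2.
have h0 k x : (0 <= (h k x)%:E)%E by rewrite lee_fin; exact: normr_ge0.
have muDfin : mu D \is a fin_num by rewrite ge0_fin_numE.
set c := fine (mu D).
have c0 : 0 <= c by exact: fine_ge0.
have ih k : (\int[mu]_(x in D) (h k x)%:E <= ((c + 1) * 2^-1 ^+ k)%:E)%E.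
  pose g := f (n_ k.+1) - f (n_ k).
  apply: (@le_trans _ _ (\int[mu]_(x in D) ((2^-1 ^+ k)%:E + (2 ^+ k)%:E * (g x * g x)%:E))%E).
    apply: ge0_le_integral => //.
    - by apply/measurable_EFinP; exact: measurable_funTS.
    - apply: emeasurable_funD => //; apply: emeasurable_funM => //.
      exact: measurable_mulL.
    - move=> x _; rewrite -EFinM -EFinD lee_fin -expr2; exact: le_norm_sqr.
  rewrite ge0_integralD//; last 2 first.
  - by move=> x _; rewrite mule_ge0 ?lee_fin// -expr2 sqr_ge0.
  - by apply: emeasurable_funM => //; exact: measurable_mulL.
  rewrite integral_cst// ge0_integralZl_EFin//; last 2 first.
  - by move=> x _; rewrite lee_fin -expr2 sqr_ge0.
  - exact: measurable_mulL.
  rewrite -ip2E -(fineK muDfin) -!EFinM -EFinD lee_fin mulrDl mul1r mulrC lerD2l.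
  apply: (@le_trans _ _ (2 ^+ k * 2^-1 ^+ (k + k))).
    by rewrite ler_pM2l ?exprn_gt0//; exact: n_fast.
  by rewrite exprD mulrA -exprMn mulfV// expr1n mul1r.
pose G x := (\sum_(k <oo) (h k x)%:E)%E.
have mG : measurable_fun setT G.
  apply: ge0_emeasurable_sum => // k _; exact/measurable_EFinP.
have iG : (\int[mu]_(x in D) G x < +oo)%E.
  rewrite integral_nneseries//; last first.
    by move=> k; apply/measurable_EFinP; exact: measurable_funTS.
  apply: (@le_lt_trans _ _ ((c + 1) * 2)%:E); last by rewrite ltry.
  apply: lime_le.
    by apply: is_cvg_nneseries => k _ _; apply: integral_ge0 => x _; exact: h0.
  apply: nearW => n /=.
  apply: (@le_trans _ _ (\sum_(0 <= k < n) ((c + 1) * 2^-1 ^+ k)%:E)%E).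
    by apply: lee_sum => k _; exact: ih.
  rewrite sumEFin lee_fin -mulr_sumr ler_wpM2l ?addr_ge0//.
  suff -> : \sum_(0 <= k < n) 2^-1 ^+ k = 2 - 2 * 2^-1 ^+ n :> R.
    by rewrite lerBlDr lerDl mulr_ge0// exprn_ge0// invr_ge0.
  elim: n => [|n IHn]; first by rewrite big_geq// expr0 mulr1 subrr.
  by rewrite big_nat_recr//= IHn exprS; field.
(* The increments are summable at the points of C, and D minus C is null. *)
pose C := D `&` [set x | (G x < +oo)%E].
have G0 x : (0 <= G x)%E by apply: nneseries_ge0 => k _ _; exact: h0.
have mC : measurable C.
  rewrite /C -[X in X `&` _]setTI -setIA setTI.
  have := @emeasurable_fun_infty_o _ _ _ D (fun x => G x) mD (measurable_funTS mG) +oo%E.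
  by [].
have CD : C `<=` D by move=> x [].
have nullC : mu (D `\` C) = 0%E.
  have intG : mu.-integrable D G.
    apply/integrableP; split; first exact: measurable_funTS.
    by under eq_integral do rewrite gee0_abs//.
  have /integrable_ae := intG; move=> /(_ mD) [N [mN N0 hN]].
  apply: (subset_measure0 _ mN) => //; first exact: measurableD.
  move=> x [Dx nCx]; apply: hN => /= hx; apply: nCx; split => //=.
  by have := hx Dx; rewrite ge0_fin_numE.
pose s k x := f (n_ k) x * \1_C x.
pose z x := limn (s ^~ x).
have scvg x : s ^~ x @ \oo --> z x.
  have [Cx|nCx] := boolP (x \in C); last first.
    rewrite /z (_ : s ^~ x = cst 0); first by rewrite lim_cst//; exact: cvg_cst.
    by apply/funext => k; rewrite /s indicE (negbTE nCx) mulr0.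
  have [Dx Gx] : C x by exact: set_mem.
  suff : cvgn (fun k => f (n_ k) x).
    rewrite /z (_ : s ^~ x = fun k => f (n_ k) x)//.
    by apply/funext => k; rewrite /s indicE Cx mulr1.
  pose u k := f (n_ k) x.
  have uE : u = (fun k => u 0%N + series (telescope u) k).
    by apply/funext => k; exact: eq_sum_telescope.
  rewrite -/u uE; apply: is_cvgD; first exact: is_cvg_cst.
  apply: (@normed_cvg R R^o).
  suff : cvgn (series (h ^~ x)) by [].
  apply: nondecreasing_is_cvgn.
    by apply: nondecreasing_series => k _ _; exact: normr_ge0.
  exists (fine (G x)) => _ [k _ <-].
  rewrite -lee_fin fineK ?ge0_fin_numE//.
  apply: le_trans (@nneseries_lim_ge _ _ xpredT 0%N k _); last first.
    by move=> ? _ _; exact: h0.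
  by rewrite /series /= -sumEFin.
have ms k : measurable_fun setT (s k).
  by apply: measurable_funM; [exact: measurable_Lfun2|exact: measurable_indic].
have mz : measurable_fun setT z.
  by apply: (@measurable_fun_cvg _ _ _ setT s) => // x _; exact: scvg.
have key e : 0 < e -> exists N, forall n, (N <= n)%N ->
   (\int[mu]_x ((f n x * \1_C x - z x) ^+ 2)%:E <= e%:E)%E.
  move=> e0; have [N hN] := cf e e0; exists N => n Nn.
  pose F j x := ((f n x * \1_C x - s j x) ^+ 2)%:E.
  have cF x : F ^~ x @ \oo --> ((f n x * \1_C x - z x) ^+ 2)%:E.
    apply: cvg_EFin; first exact: nearW.
    rewrite /F; under eq_fun do rewrite /= expr2.
    by rewrite expr2; apply: cvgM; (apply: cvgB; [exact: cvg_cst|exact: scvg]).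
  have -> : (\int[mu]_x ((f n x * \1_C x - z x) ^+ 2)%:E =
      \int[mu]_x limn_einf (F ^~ x))%E.
    apply: eq_integral => x _; rewrite is_cvg_limn_einfE.
      by apply/esym/cvg_lim => //; exact: cF.
    by apply: cvgP; exact: cF.
  apply: le_trans (fatou _ _ _ _) _ => //.
  - move=> j; apply/measurable_EFinP; apply: measurable_funX.
    by apply: measurable_funB => //; apply: measurable_funM; [exact: measurable_Lfun2|exact: measurable_indic].
  - by move=> j x _; rewrite lee_fin sqr_ge0.
  rewrite limn_einf_lim; apply: lime_le; first exact: is_cvg_einfs.
  near=> j; apply: (@le_trans _ _ (\int[mu]_x F j x)%E).
    by apply: ereal_inf_lbound; exists j => /=.
  have Nj : (N <= n_ j)%N.
    by apply: leq_trans (n_ge j); near: j; exact: nbhs_infty_ge.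
  apply: le_trans (_ : ((ip2 (f n - f (n_ j)) (f n - f (n_ j)))%:E <= _)%E); last first.
    by rewrite lee_fin; exact: hN.
  rewrite ip2E [leRHS]integral_mkcond; apply: ge0_le_integral => //.
  - by move=> x _; rewrite lee_fin sqr_ge0.
  - apply/measurable_EFinP; apply: measurable_funX.
    by apply: measurable_funB => //; apply: measurable_funM; [exact: measurable_Lfun2|exact: measurable_indic].
  - apply/(measurable_restrictT _ _).1 => //; exact: measurable_mulL.
  - move=> x _; rewrite /F /s patchE -mulrBl exprMn indicE.
    have [Cx|nCx] := boolP (x \in C).
      by rewrite ifT ?expr1n ?mulr1 ?expr2//; exact/mem_set/CD/set_mem.
    by rewrite expr0n mulr0; case: ifP => // _; rewrite lee_fin -expr2 sqr_ge0.
have [N1 hN1] := key 1 ltr01.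
have zL : z \in Lfun mu 2%:E.
  pose f1 x := f N1 x * \1_C x.
  have mf1 : measurable_fun setT f1.
    by apply: measurable_funM; [exact: measurable_Lfun2|exact: measurable_indic].
  have f1L : f1 \in Lfun mu 2%:E.
    apply: Lfun2P => //.
    have /integrableP[_] := Lfun2_integrable_sqr (LfunP (f N1)).
    apply: le_lt_trans; apply: ge0_le_integral => //.
    - by move=> x _; rewrite lee_fin sqr_ge0.
    - by apply/measurable_EFinP; exact: measurable_funX.
    - apply: measurableT_comp => //; apply/measurable_EFinP; apply: measurable_funX.
      exact: measurable_Lfun2.
    - move=> x _; rewrite gee0_abs ?lee_fin ?sqr_ge0// /f1 exprMn indicE.
      by case: (x \in C); rewrite ?expr1n ?mulr1// expr0n mulr0 sqr_ge0.
  have -> : z = f1 - (f1 - z) by rewrite subKr.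
  suff f1z : f1 - z \in Lfun mu 2%:E by exact: (LfunP (Lfun_Sub le1_2 f1L - Lfun_Sub le1_2 f1z)).
  apply: Lfun2P; first exact: measurable_funB.
  by apply: le_lt_trans (hN1 N1 (leqnn _)) _; rewrite ltry.
exists (Lfun_Sub le1_2 zL) => e e0; have [N hN] := key e e0; exists N => n Nn.
apply: ip2_le_ereal; apply: le_trans (hN n Nn).
rewrite (ge0_negligible_integral _ _ _ _ nullC)//; last 3 first.
- exact: measurableD.
- by apply/measurable_EFinP; apply: measurable_funX; apply: measurable_funTS; exact: measurable_Lfun2.
- by move=> x _; rewrite lee_fin sqr_ge0.
rewrite setDD (setIidr CD).
rewrite [leLHS](_ : _ = \int[mu]_(x in C) ((f n x * \1_C x - z x) ^+ 2)%:E)%E.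
  apply: ge0_subset_integral => //.
  - apply/measurable_EFinP; apply: measurable_funX; apply: measurable_funB => //.
    by apply: measurable_funM; [exact: measurable_Lfun2|exact: measurable_indic].
  - by move=> x _; rewrite lee_fin sqr_ge0.
by apply: eq_integral => x Cx; rewrite indicE Cx mulr1.
Unshelve. all: by end_near. Qed.

End Lfun2.

(** * Measure and integration on row vectors *)

Section BorelRowVectors.
Variables (R : realType) (n : nat).
Implicit Types (U : set 'rV[R]_n).

Lemma measurable_coord (i : 'I_n) : measurable_fun setT (fun x : 'rV[R]_n => x ord0 i).
Proof. exact: measurable_coord_rV. Qed.

Lemma measurable_box (A : 'I_n -> set R) : (forall i, measurable (A i)) ->
  measurable ([set x | forall i, A i (x ord0 i)] : set 'rV[R]_n).
Proof.
move=> mA; rewrite [X in measurable X](_ : _ =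
    \bigcap_(i in [set: 'I_n]) ((fun x : 'rV[R]_n => x ord0 i) @^-1` A i)); last first.
  by apply/seteqP; split=> x /= h i; [move=> _|]; apply: h.
apply: fin_bigcap_measurable => // i _.
by rewrite -[X in measurable X]setTI; exact: measurable_coord.
Qed.

(** Open sets are countable unions of cubes with rational centres. *)
Lemma open_measurable_rV U : open U -> measurable U.
Proof.
move=> oU.
pose B (p : 'rV[rat]_n * nat) : set 'rV[R]_n :=
  [set x | forall i, `|x ord0 i - ratr (p.1 ord0 i)| < p.2.+1%:R^-1].
have mB p : measurable (B p).
  apply: (@measurable_box (fun i => [set y : R | `|y - ratr (p.1 ord0 i)| < p.2.+1%:R^-1])) => i.
  rewrite [X in measurable X](_ : _ = ball (ratr (p.1 ord0 i) : R) p.2.+1%:R^-1).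
    exact: measurable_ball.
  by apply/seteqP; split => y; rewrite -ball_normE /= distrC.
have -> : U = \bigcup_(p in [set p | B p `<=` U]) B p.
  apply/seteqP; split=> x; last by move=> [p /= pU]; exact: pU.
  move=> Ux; have /nbhs_ballP[e /= e0 eU] := open_nbhs_nbhs (conj oU Ux).
  have [k hk] : exists k : nat, k.+1%:R^-1 < e / 2.
    have := near_infty_natSinv_lt (PosNum (divr_gt0 e0 (ltr0n R 2))).
    by case=> N _ /(_ N (leqnn N)); exists N.
  have /choice[q hq] : forall i, exists q : rat, `|x ord0 i - ratr q| < k.+1%:R^-1 :> R.
    move=> i; have [|q] := @rat_in_itvoo R (x ord0 i - k.+1%:R^-1) (x ord0 i).
      by rewrite ltrBlDr ltrDl invr_gt0.
    rewrite in_itv /= => /andP[h1 h2]; exists q.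
    by rewrite ger0_norm ?subr_ge0 ?ltW// ltrBlDr addrC -ltrBlDr.
  exists (\row_i q i, k).
    move=> y hy; apply: eU; split => // i j; rewrite -ball_normE /= (ord1 i).
    have := hy j; have := hq j; rewrite /= mxE.
    move: (ratr _) (x _ _) (y _ _) => r a b h1 h2.
    have -> : a - b = (a - r) - (b - r) by ring.
    apply: le_lt_trans (ler_normB _ _) _; apply: lt_trans (ltrD h1 h2) _.
    by rewrite (splitr e) ltrD.
  by move=> i; rewrite /= mxE.
rewrite [X in measurable X](_ : _ =
    \bigcup_(p in setT) (if `[< B p `<=` U >] then B p else set0)).
  apply: countable_bigcupT_measurable => [|p].
    by apply/countableP; apply: (countable_type).
  by case: ifP.
apply/seteqP; split => x.
  by move=> [p /= pU Bx]; exists p => //; rewrite asboolT.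
by move=> [p _]; case: ifPn => // /asboolP pU; exists p.
Qed.

Lemma continuous_measurable_rV (f : 'rV[R]_n -> R) :
  continuous f -> measurable_fun setT f.
Proof.
move=> cf; apply: (measurability _ (RGenOpens.measurableE R)).
move=> _ [_ [a [b ->] <-]]; rewrite setTI; apply: open_measurable_rV.
by move/continuousP : cf; apply; exact: interval_open.
Qed.

End BorelRowVectors.

Section Tonelli.
Variables (R : realType) (n : nat).
Local Notation leb := (lebesgue_rV R).

Lemma tonelli_rV (f : 'rV[R]_n.+1 -> \bar R) : measurable_fun setT f ->
  (forall x, 0 <= f x)%E ->
  (\int[leb n.+1]_x f x =
   \int[@lebesgue_measure R]_a \int[leb n]_x f (cons_rV (a, x)))%E.
Proof.
move=> mf f0; rewrite /= /lebesgue_rV_step ge0_integral_pushforward//; last first.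
  exact: measurable_cons_rV.
rewrite preimage_setT fubini_tonelli1//.
  by apply: measurableT_comp => //; exact: measurable_cons_rV.
by move=> x; exact: f0.
Qed.

Lemma integrable_cons (f : 'rV[R]_n.+1 -> \bar R) :
  (leb n.+1).-integrable setT f ->
  ((@lebesgue_measure R) \x (leb n))%E.-integrable setT (f \o @cons_rV R n).
Proof.
move=> /integrableP[mf fi].
have mfc : measurable_fun setT (f \o @cons_rV R n).
  by apply: measurableT_comp => //; exact: measurable_cons_rV.
apply/integrableP; split => //.
move: fi; rewrite /= /lebesgue_rV_step ge0_integral_pushforward//; last 2 first.
- exact: measurable_cons_rV.
- exact: measurableT_comp.
Qed.

Lemma fubini_rV (f : 'rV[R]_n.+1 -> \bar R) : (leb n.+1).-integrable setT f ->
  (\int[leb n.+1]_x f x =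
   \int[@lebesgue_measure R]_a \int[leb n]_x f (cons_rV (a, x)))%E.
Proof.
move=> fi; have fci := integrable_cons fi.
have mf := measurable_int _ fi.
rewrite /= /lebesgue_rV_step integral_pushforward//; last exact: measurable_cons_rV.
by rewrite preimage_setT -integral12_prod_meas1.
Qed.

Lemma fubini_rV_swap (f : 'rV[R]_n.+1 -> \bar R) : (leb n.+1).-integrable setT f ->
  (\int[leb n.+1]_x f x =
   \int[leb n]_x \int[@lebesgue_measure R]_a f (cons_rV (a, x)))%E.
Proof.
move=> fi; have fci := integrable_cons fi.
have mf := measurable_int _ fi.
rewrite /= /lebesgue_rV_step integral_pushforward//; last exact: measurable_cons_rV.
by rewrite preimage_setT -integral21_prod_meas1.
Qed.

End Tonelli.

(** * Scaling and polar coordinates *)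

Section Scaling.
Variable R : realType.
Local Notation leb := (lebesgue_rV R).
Local Notation mu := (@lebesgue_measure R).

(** The pushforward packaged as a measure, for use in terms where the
    measurability proof cannot be inferred. *)
Lemma pushforward_measureE d1 d2 (T1 : measurableType d1) (T2 : measurableType d2)
    (m : {measure set T1 -> \bar R}) (f : T1 -> T2) (mf : measurable_fun setT f) :
  exists pf : {measure set T2 -> \bar R}, forall A, pf A = m (f @^-1` A).
Proof. by unshelve eexists (pushforward m f). Qed.

(** The image of Lebesgue measure under a homothety agrees, up to the factor,
    with Lebesgue measure on intervals, hence everywhere by uniqueness. *)
Lemma lebesgue_measure_scale (r : R) (r0 : 0 < r) (A : set R) : measurable A ->
  mu A = (r%:E * mu ((fun x : R => r * x)%R @^-1` A))%E.
Proof.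
move=> mA.
have mr : measurable_fun setT ((fun x => r * x) : measurableTypeR R -> measurableTypeR R).
  by apply: measurable_funM.
have [pf pfE] := pushforward_measureE mu mr.
pose phi := mscale (NngNum (ltW r0)) pf.
have /(_ A mA) -> // : forall A, measurable A -> mu A = phi A.
  apply: lebesgue_measure_unique => //= _ [[a b]] _ <-.
  have H : mu ((fun x : R => r * x) @^-1` `]a, b]) = (if (a < b)%R then (b / r - a / r)%:E else 0)%E.
    transitivity (mu (`]a / r, b / r]%classic : set R)).
      congr (mu _); apply/seteqP; split => x; rewrite /= !in_itv /=.
        by rewrite ltr_pdivrMr// ler_pdivlMr// (mulrC x).
      by rewrite ltr_pdivrMr// ler_pdivlMr// (mulrC x).
    by rewrite lebesgue_measure_itv/= lte_fin ltr_pM2r ?invr_gt0.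
  rewrite /phi /mscale /= pfE; apply: (etrans _ (congr1 _ (esym H))).
  rewrite lebesgue_measure_itv/= lte_fin; case: ifP => _; last by rewrite mule0.
  by rewrite -EFinB -EFinM -mulrBl mulrC divfK ?gt_eqF.
by rewrite /phi /mscale /= pfE.
Qed.

Lemma integral_scale (r : R) (r0 : 0 < r) (f : R -> \bar R) :
  measurable_fun setT f -> (forall x, 0 <= f x)%E ->
  (\int[mu]_x f x = r%:E * \int[mu]_x f (r * x)%R)%E.
Proof.
move=> mf f0.
have mr : measurable_fun setT ((fun x => r * x) : measurableTypeR R -> measurableTypeR R).
  by apply: measurable_funM.
have [pf pfE] := pushforward_measureE mu mr.
transitivity (\int[mscale (NngNum (ltW r0)) pf]_x f x)%E.
  apply: eq_measure_integral => A mA _.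
  by apply: (etrans (lebesgue_measure_scale r0 mA)); rewrite -pfE.
rewrite ge0_integral_mscale//=; congr (_ * _)%E.
rewrite -[RHS](@ge0_integral_pushforward _ _ _ _ _ _ mr mu setT f)//.
by apply: eq_measure_integral => A mA _; rewrite pfE.
Qed.

Lemma measurable_scale_rV n (r : R) :
  measurable_fun setT (fun x : 'rV[R]_n => r *: x).
Proof.
apply: measurable_fun_rVP => i.
rewrite [X in measurable_fun _ X](_ : _ = fun x : 'rV[R]_n => r * x ord0 i).
  by apply: measurable_funM => //; exact: measurable_coord.
by apply/funext => x; rewrite /= /coord_rV mxE.
Qed.

Lemma cons_rVZ n (r a : R) (x : 'rV[R]_n) :
  cons_rV (r * a, r *: x) = r *: cons_rV (a, x).
Proof.
apply/rowP => i; case: (unliftP ord0 i) => [j ->|->].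
  by rewrite [RHS]mxE !cons_rV_lift mxE.
by rewrite [RHS]mxE !cons_rV0.
Qed.

Lemma integral_scale_rV n (r : R) (r0 : 0 < r) (f : 'rV[R]_n -> \bar R) :
  measurable_fun setT f -> (forall x, 0 <= f x)%E ->
  (\int[leb n]_x f x = (r ^+ n)%:E * \int[leb n]_x f (r *: x)%R)%E.
Proof.
elim: n f => [|n IH] f mf f0.
  rewrite expr0 mul1e; apply: eq_integral => x _; congr f.
  by apply/rowP => -[].
have mfs : measurable_fun setT (fun x : 'rV[R]_n.+1 => f (r *: x)).
  by apply: measurableT_comp => //; exact: measurable_scale_rV.
rewrite !tonelli_rV//.
pose g a := (\int[leb n]_x f (cons_rV (a, x)))%E.
have mg : measurable_fun setT g.
  apply: (measurable_fun_fubini_tonelli_F (fun p => f (@cons_rV R n p))) => //.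
  by apply: measurableT_comp => //; exact: measurable_cons_rV.
have mfa a : measurable_fun setT (fun x => f (cons_rV (a, x))).
  apply: (measurableT_comp mf); apply: (measurableT_comp (@measurable_cons_rV R n)).
  exact: pair1_measurable.
have g0 a : (0 <= g a)%E by apply: integral_ge0.
rewrite -/(g _) (integral_scale r0 mg g0) exprS EFinM -muleA; congr (_ * _)%E.
rewrite -ge0_integralZl_EFin//; last 3 first.
- by move=> a _; apply: integral_ge0.
- apply: (measurable_fun_fubini_tonelli_F (fun p => f (r *: @cons_rV R n p))) => //.
  by apply: (measurableT_comp mfs); exact: measurable_cons_rV.
- by rewrite exprn_ge0// ltW.
apply: eq_integral => a _; rewrite /g IH//.
by congr (_ * _)%E; apply: eq_integral => x _; rewrite cons_rVZ.
Qed.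

Lemma measurable_sqnorm n : measurable_fun setT (@sqnorm R n).
Proof.
apply: measurable_sum => i; apply: measurable_funX; exact: measurable_coord.
Qed.

Lemma sqnormZ n r (x : 'rV[R]_n) : sqnorm (r *: x) = r ^+ 2 * sqnorm x.
Proof.
by rewrite /sqnorm mulr_sumr; apply: eq_bigr => i _; rewrite mxE exprMn.
Qed.

Lemma sqnorm_ge0 n (x : 'rV[R]_n) : 0 <= sqnorm x.
Proof. by apply: sumr_ge0 => i _; exact: sqr_ge0. Qed.

Lemma measurable_sqnorm_lt n c : measurable [set x : 'rV[R]_n | sqnorm x < c].
Proof.
rewrite [X in measurable X](_ : _ = setT `&` @sqnorm R n @^-1` `]-oo, c[).
  by apply: measurable_sqnorm => //; exact: measurable_itv.
by rewrite setTI; apply/seteqP; split => x; rewrite /= in_itv.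
Qed.

Lemma coord_le_norm n (x : 'rV[R]_n) i : `|x ord0 i| <= `|x|.
Proof.
rewrite [leRHS]mx_normrE.
apply: (le_bigmax _ (fun ij : 'I_1 * 'I_n => `|x ij.1 ij.2|) (ord0, i)).
Qed.

Lemma bounded_lebesgue_rV n (A : set 'rV[R]_n) (M : R) : measurable A ->
  (forall x, A x -> forall i, `|x ord0 i| <= M) -> (leb n A < +oo)%E.
Proof.
move=> mA hA.
apply: (@le_lt_trans _ _ (leb n [set x | forall i, `[- M, M]%classic (x ord0 i)])).
  apply: le_measure; rewrite ?inE//; first exact: (@measurable_box R n (fun=> `[- M, M]%classic)).
  by move=> x /hA h i /=; rewrite in_itv /= -ler_norml.
rewrite (@lebesgue_rV_box R n (fun=> `[- M, M]%classic))//.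
have [K ->] : exists K : R, lebesgue_measure `[- M, M]%classic = K%:E.
  by rewrite lebesgue_measure_itv/=; case: ifP => _; [exists (M - - M)|exists 0].
by rewrite prodEFin ltry.
Qed.

Lemma bounded_set_lebesgue_rV n (A : set 'rV[R]_n) : measurable A ->
  bounded_set A -> (leb n A < +oo)%E.
Proof.
move=> mA [M [_ hM]]; apply: (@bounded_lebesgue_rV _ _ (M + 1)) => // x Ax i.
by apply: le_trans (coord_le_norm _ _) _; apply: (hM (M + 1)) => //; rewrite ltrDl.
Qed.

Lemma coord_sqnorm n (x : 'rV[R]_n) i : x ord0 i ^+ 2 <= sqnorm x.
Proof.
by rewrite /sqnorm (bigD1 i)//= lerDl sumr_ge0// => j _; exact: sqr_ge0.
Qed.

Lemma ball_volumeE n (s : R) : 0 < s ->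
  leb n [set x | sqnorm x < s ^+ 2] = (s ^+ n * ball_volume R n)%:E.
Proof.
move=> s0.
have B1 : leb n [set x | sqnorm x < 1] = (ball_volume R n)%:E.
  rewrite /ball_volume /volume fineK// ge0_fin_numE//.
  apply: (@bounded_lebesgue_rV _ _ 1); first exact: measurable_sqnorm_lt.
  move=> x /= x1 i; rewrite -(@ler_sqr R) ?nnegrE// real_normK ?num_real//.
  by rewrite expr1n; apply: le_trans (coord_sqnorm _ _) (ltW x1).
have mc c := @measurable_sqnorm_lt n c.
have I c : leb n [set x | sqnorm x < c] =
    (\int[leb n]_x (\1_[set x | sqnorm x < c] x)%:E)%E by rewrite integral_indic// setIT.
rewrite EFinM -B1 !I (integral_scale_rV s0)//; last first.
  by apply/measurable_EFinP; exact: measurable_indic.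
congr (_ * _)%E; apply: eq_integral => x _.
rewrite !indicE; congr ((nat_of_bool _)%:R%:E); apply/idP/idP; rewrite !inE /= sqnormZ.
  by rewrite -[X in _ < X]mulr1 ltr_pM2l// exprn_gt0.
by rewrite -[X in _ -> _ < X]mulr1 ltr_pM2l// exprn_gt0.
Qed.

Lemma ball_volume_ge0 n : 0 <= ball_volume R n.
Proof. exact: fine_ge0. Qed.

(** The radius 0 is allowed because n > 0: the open ball of radius 0 is empty and
    0 ^ n = 0. *)
Lemma ball_volumeE0 n (s : R) : (0 < n)%N -> 0 <= s ->
  leb n [set x | sqnorm x < s ^+ 2] = (s ^+ n * ball_volume R n)%:E.
Proof.
move=> n0; rewrite le_eqVlt => /orP[/eqP <-|]; last exact: ball_volumeE.
rewrite expr0n /= expr0n gtn_eqF// mul0r (_ : [set _ | _] = set0) ?measure0//.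
by apply/seteqP; split => x //=; rewrite ltNge sqnorm_ge0.
Qed.

Lemma shellE n (q s : R) :
  [set x : 'rV[R]_n | q ^+ 2 <= sqnorm x < s ^+ 2] =
  [set x | sqnorm x < s ^+ 2] `\` [set x | sqnorm x < q ^+ 2].
Proof.
apply/seteqP; split => x /=.
  by move=> /andP[h ->]; split=> //; apply/negP; rewrite -leNgt.
by move=> [-> /negP]; rewrite -leNgt => ->.
Qed.

Lemma measurable_shell n (q s : R) :
  measurable [set x : 'rV[R]_n | q ^+ 2 <= sqnorm x < s ^+ 2].
Proof. by rewrite shellE; apply: measurableD; exact: measurable_sqnorm_lt. Qed.

Lemma shell_volume n (q s : R) : (0 < n)%N -> 0 <= q -> q <= s ->
  leb n [set x | q ^+ 2 <= sqnorm x < s ^+ 2] =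
  ((s ^+ n - q ^+ n) * ball_volume R n)%:E.
Proof.
move=> n0 q0 qs; have s0 := le_trans q0 qs.
rewrite shellE.
rewrite measureD; [|exact: measurable_sqnorm_lt..|].
  rewrite setIidr; first by rewrite mulrBl EFinB -(ball_volumeE0 n0 s0) -(ball_volumeE0 n0 q0).
  by move=> x /= /lt_le_trans; apply; rewrite ler_sqr ?nnegrE.
have H : (leb n [set x | (sqnorm x < s ^+ 2)%R] < +oo)%E.
  by rewrite ball_volumeE0 ?ltry.
exact: H.
Qed.

(** A radial function is a superposition of indicators of shells; this is
    integration in polar coordinates without a measure on the sphere. *)
Lemma radial_integral n (g G : R -> R) (q b : R) : (0 < n)%N -> 0 <= q -> q <= b ->
  continuous g -> (forall s : R, is_derive s 1 G (g s)) ->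
  (forall s, q <= s <= b -> 0 <= g s) ->
  (\int[leb n]_x (if q ^+ 2 <= sqnorm x < b ^+ 2
                  then G b - G (Num.sqrt (sqnorm x)) else 0)%:E =
   \int[mu]_(s in `[q, b])
      (g s * ((s ^+ n - q ^+ n) * ball_volume R n))%:E)%E.
Proof.
move=> n0 q0 qb cg dG g0; have b0 := le_trans q0 qb.
pose E := [set p : 'rV[R]_n * R | q <= p.2 <= b /\ q ^+ 2 <= sqnorm p.1 < p.2 ^+ 2].
pose F (p : 'rV[R]_n * R) := (g p.2 * \1_E p)%:E.
have msq : measurable_fun setT (fun p : 'rV[R]_n * measurableTypeR R => sqnorm p.1).
  by apply: measurableT_comp => //; exact: measurable_sqnorm.
have ms : measurable_fun setT (fun p : 'rV[R]_n * measurableTypeR R => p.2 : R)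
  by exact: measurable_snd.
have md : measurable_fun setT
    (fun p : 'rV[R]_n * measurableTypeR R => p.2 ^+ 2 - sqnorm p.1).
  by apply: measurable_funB => //; exact: measurable_funX.
have mE : measurable (E : set ('rV[R]_n * measurableTypeR R)).
  have -> : E = ((fun p : 'rV[R]_n * measurableTypeR R => p.2 : R) @^-1` `[q, b]) `&`
      ((fun p : 'rV[R]_n * measurableTypeR R => sqnorm p.1) @^-1` `[q ^+ 2, +oo[) `&`
      ((fun p : 'rV[R]_n * measurableTypeR R => p.2 ^+ 2 - sqnorm p.1) @^-1` `]0, +oo[).
    apply/seteqP; split => p; rewrite /E /= !in_itv /= !andbT subr_gt0.
      by move=> [-> /andP[-> ->]].
    by move=> [[-> ->] ->].
  apply: measurableI; first apply: measurableI.
  - by rewrite -[X in measurable X]setTI; apply: ms => //; exact: measurable_itv.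
  - by rewrite -[X in measurable X]setTI; apply: msq => //; exact: measurable_itv.
  - by rewrite -[X in measurable X]setTI; apply: md => //; exact: measurable_itv.
have mg : measurable_fun setT g by exact: continuous_measurable_fun.
have mF : measurable_fun setT (F : 'rV[R]_n * measurableTypeR R -> \bar R).
  apply/measurable_EFinP; apply: measurable_funM; last exact: measurable_indic.
  exact: measurableT_comp mg ms.
have F0 p : (0 <= F p)%E.
  rewrite lee_fin indicE; case: (boolP (p \in E)); last by rewrite mulr0.
  by rewrite inE mulr1 => -[/g0].
have := @fubini_tonelli _ _ _ _ _ (leb n) mu F mF F0.
rewrite [X in X = _ -> _](_ : _ = \int[leb n]_x (if q ^+ 2 <= sqnorm x < b ^+ 2
                  then G b - G (Num.sqrt (sqnorm x)) else 0)%:E)%E; last first.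
  apply: eq_integral => x _.
  set rho := Num.sqrt (sqnorm x).
  have rho0 : 0 <= rho by exact: sqrtr_ge0.
  have rhoE : sqnorm x = rho ^+ 2 by rewrite sqr_sqrtr// sqnorm_ge0.
  case: ifPn => [|hx]; last first.
    rewrite integral0_eq// => s _; rewrite /F indicE memNset ?mulr0//= => -[/andP[h1 h2] /andP[h3 h4]].
    move: hx; rewrite h3 /= => /negP; apply; apply: lt_le_trans h4 _.
    by rewrite ler_sqr ?nnegrE// (le_trans q0)// (le_trans h1).
  rewrite rhoE ltr_sqr ?ler_sqr ?nnegrE// => /andP[qr rb].
  transitivity (\int[mu]_(s in `]rho, b]) (g s)%:E)%E.
    rewrite [RHS]integral_mkcond; apply: eq_integral => s _.
    rewrite /F indicE patchE.
    have [/set_mem|/negP hs] := boolP (s \in `]rho, b]%classic).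
      rewrite /= in_itv /= => /andP[rs sb]; rewrite mem_set ?mulr1// /E /=; split.
        by rewrite sb andbT (le_trans qr) ?ltW.
      rewrite rhoE ler_sqr ?ltr_sqr ?nnegrE//; first by rewrite qr.
      exact: le_trans (ltW rs).
    rewrite memNset ?mulr0// /E /= => -[/andP[h1 h2]]; rewrite rhoE => /andP[h3 h4]; apply: hs.
    apply/mem_set; rewrite /= in_itv /= h2 andbT.
    by rewrite -ltr_sqr ?nnegrE// (le_trans q0).
  rewrite integral_itv_obnd_cbnd; last by apply/measurable_EFinP; exact: measurable_funTS.
  have cG : continuous G.
    move=> y; apply: differentiable_continuous; apply/derivable1_diffP.
    by apply: ex_derive.
  rewrite (@continuous_FTC2 _ g G)//.
  - by apply: continuous_subspaceT.
  - split.
    + by move=> y _; apply: ex_derive.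
    + by apply: cvg_at_right_filter; exact: cG.
    + by apply: cvg_at_left_filter; exact: cG.
  - by move=> s _; rewrite derive1E; apply: derive_val.
move=> ->; rewrite [in RHS]integral_mkcond; apply: eq_integral => s _.
rewrite patchE; case: ifPn => hs.
  have {}hs : q <= s <= b by move: hs; rewrite inE /= in_itv.
  under eq_integral do rewrite /F EFinM /=.
  have m1 : measurable_fun setT (fun x : 'rV[R]_n => (\1_E (x, s) : R)%:E).
    apply/measurable_EFinP; apply: (measurableT_comp (measurable_indic mE)).
    exact: pair2_measurable.
  rewrite ge0_integralZl_EFin; [|by []|by move=> x _; rewrite lee_fin|exact: m1|exact: g0].
  rewrite [RHS]EFinM -shell_volume//; last by case/andP: hs.
  congr (_ * _)%E.
  transitivity (\int[leb n]_x (\1_[set y : 'rV[R]_n | q ^+ 2 <= sqnorm y < s ^+ 2] x)%:E)%E.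
    apply: eq_integral => x _; congr (_%:E); rewrite !indicE.
    by congr ((nat_of_bool _)%:R); apply/idP/idP; rewrite !inE/=; [case|split].
  by rewrite integral_indic ?setIT//; exact: measurable_shell.
rewrite integral0_eq// => x _; rewrite /F indicE memNset ?mulr0//= => -[h _].
by move: hs; rewrite notin_setE /= in_itv /= h.
Qed.

End Scaling.

(** * Abel means and the Poisson kernel on the line *)

Section OneDim.
Variable R : realType.
Local Notation mu := (@lebesgue_measure R).

Lemma is_derive_continuous (f f' : R -> R) :
  (forall t : R, is_derive t 1 f (f' t)) -> continuous f.
Proof.
move=> h y; apply: differentiable_continuous; apply/derivable1_diffP.
by apply: ex_derive.
Qed.

Lemma integral_half_line (f F : R -> R) (l : R) :
  continuous f -> (forall t, 0 <= f t) -> (forall t : R, is_derive t 1 F (f t)) ->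
  F t @[t --> +oo] --> l ->
  (\int[mu]_(t in `[0%R, +oo[) (f t)%:E = (l - F 0)%:E)%E.
Proof.
move=> cf f0 dF Fl; rewrite (@ge0_continuous_FTC2y _ f F 0 l)//.
- exact: continuous_subspaceT.
- by apply: cvg_at_right_filter; exact: is_derive_continuous dF _.
- by move=> x _; rewrite derive1E; apply: derive_val.
Qed.

Lemma integral_two_half_lines (f : R -> R) :
  measurable_fun setT f -> (forall t, 0 <= f t) ->
  (\int[mu]_t (f t)%:E = \int[mu]_(t in `[0%R, +oo[) (f t)%:E +
     \int[mu]_(t in `[0%R, +oo[) (f (- t))%:E)%E.
Proof.
move=> mf f0.
have mfN : measurable_fun setT (fun t : R => f (- t)).
  by apply: measurableT_comp mf _; exact: oppr_measurable.
have -> : (\int[mu]_(t in `[0%R, +oo[) (f (- t))%:E = \int[mu]_(t in `]-oo, 0%R]) (f t)%:E)%E.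
  rewrite (@ge0_integration_by_substitution0 _ (fun t => (f (- t))%:E)).
  - by apply: eq_integral => t _; rewrite opprK.
  - exact/measurable_EFinP.
  - by move=> r; rewrite lee_fin.
rewrite -integral_itv_bndo_bndc; last by apply/measurable_EFinP; exact: measurable_funTS.
rewrite -ge0_integral_setU//=.
- congr integral; apply/esym/seteqP; split => // x _; rewrite /= !in_itv /= andbT.
  by have [|] := ltP x 0; [right|left].
- by apply/measurable_EFinP; exact: measurable_funTS.
- by move=> x _; rewrite lee_fin.
- rewrite disj_set2E; apply/eqP/seteqP; split => // x; rewrite /= !in_itv /= andbT.
  by move=> [h1 h2]; have := le_lt_trans h1 h2; rewrite ltxx.
Qed.

Variables (a : R) (a0 : 0 < a).

Lemma cvg_exp_bounded (h : R -> R) (C : R) : (forall t, `|h t| <= C) ->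
  (expR (- (a * t)) * h t) @[t --> +oo] --> (0 : R).
Proof.
move=> hC; apply/cvgr0Pnorm_le => e e0.
near=> t.
rewrite normrM ger0_norm ?expR_ge0// expRN.
have C0 : 0 <= C by apply: le_trans (hC 0).
have t0 : 0 < t by near: t; exact: nbhs_pinfty_gt.
have at0 : 0 < a * t by rewrite mulr_gt0.
apply: (@le_trans _ _ ((a * t)^-1 * C)).
  rewrite ler_pM// ?invr_ge0 ?expR_ge0//.
  rewrite lef_pV2 ?posrE ?expR_gt0//.
  by apply: le_trans (expR_ge1Dx _); rewrite lerDr.
rewrite mulrC ler_pdivrMr// mulrA -ler_pdivrMl ?mulr_gt0//.
Unshelve. all: by end_near. Qed.

(** The summand 1 makes the integrand nonnegative, so that the fundamental
    theorem of calculus on a half-line applies without integrability. *)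
Lemma abel_half_line (z th : R) :
  (\int[mu]_(t in `[0%R, +oo[) (expR (- (a * t)) * (1 + cos (t * z + th)))%:E =
   (a^-1 + (a * cos th - z * sin th) / (a ^+ 2 + z ^+ 2))%:E)%E.
Proof.
have Dp : 0 < a ^+ 2 + z ^+ 2 by rewrite ltr_pwDl ?sqr_ge0// exprn_gt0.
have D0 : a ^+ 2 + z ^+ 2 != 0 by rewrite gt_eqF.
have an0 : a != 0 by rewrite gt_eqF.
pose h t := - a^-1 + (z * sin (t * z + th) - a * cos (t * z + th)) / (a ^+ 2 + z ^+ 2).
pose F t := expR (- (a * t)) * h t.
have dF (t : R) : is_derive t 1 F (expR (- (a * t)) * (1 + cos (t * z + th))).
  by apply: is_derive_eq; rewrite /h /GRing.scale /= !(mulr0, add0r, addr0, mulr1, mul1r); field; apply/andP.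
rewrite (integral_half_line (F := F) (l := 0)).
- by rewrite /F /h !mulr0 oppr0 expR0 mul0r !add0r mul1r; congr EFin; field; apply/andP.
- move=> t; apply: differentiable_continuous; apply/derivable1_diffP.
  by apply: ex_derive.
- by move=> t; rewrite mulr_ge0 ?expR_ge0//; have := cos_geN1 (t * z + th); lra.
- apply: (@cvg_exp_bounded _ (a^-1 + (`|z| + a) / (a ^+ 2 + z ^+ 2))) => t.
  rewrite /h (le_trans (ler_normD _ _))// normrN gtr0_norm ?invr_gt0// lerD2l.
  rewrite normrM [X in _ * X]gtr0_norm ?invr_gt0// ler_pM2r ?invr_gt0//.
  have sn y : `|sin y| <= 1 :> R.
    by rewrite ler_norml; apply/andP; split; [exact: sin_geN1|exact: sin_le1].
  have cn y : `|cos y| <= 1 :> R.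
    by rewrite ler_norml; apply/andP; split; [exact: cos_geN1|exact: cos_le1].
  apply: (le_trans (ler_normB _ _)); rewrite !normrM (gtr0_norm a0).
  by apply: lerD; apply: ler_piMr => //; exact: ltW.
Qed.

Lemma abel_line1 (z th : R) :
  (\int[mu]_t (expR (- (a * `|t|)) * (1 + cos (t * z + th)))%:E =
   (2 * a^-1 + 2 * a * cos th / (a ^+ 2 + z ^+ 2))%:E)%E.
Proof.
have mf : measurable_fun setT (fun t : R => expR (- (a * `|t|)) * (1 + cos (t * z + th))).
  apply: measurable_funM.
    apply: measurableT_comp; first by apply: continuous_measurable_fun; exact: continuous_expR.
    by apply: measurableT_comp => //; apply: measurable_funM.
  apply: measurable_funD => //; apply: measurableT_comp.
    by apply: continuous_measurable_fun; exact: continuous_cos.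
  by apply: measurable_funD => //; apply: measurable_funM.
have f0 (t : R) : 0 <= expR (- (a * `|t|)) * (1 + cos (t * z + th)).
  by rewrite mulr_ge0 ?expR_ge0//; have := cos_geN1 (t * z + th); lra.
rewrite (integral_two_half_lines mf f0).
rewrite [X in (X + _)%E](_ : _ =
  \int[mu]_(t in `[0%R, +oo[) (expR (- (a * t)) * (1 + cos (t * z + th)))%:E)%E; last first.
  by apply: eq_integral => t; rewrite inE /= in_itv /= andbT => t0; rewrite ger0_norm.
rewrite [X in (_ + X)%E](_ : _ =
  \int[mu]_(t in `[0%R, +oo[) (expR (- (a * t)) * (1 + cos (t * z + (- th))))%:E)%E; last first.
  apply: eq_integral => t; rewrite inE /= in_itv /= andbT => t0.
  by rewrite normrN ger0_norm// -[in RHS]cosN opprD opprK mulNr.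
rewrite !abel_half_line -EFinD cosN sinN; congr EFin.
have Dp : 0 < a ^+ 2 + z ^+ 2 by rewrite ltr_pwDl ?sqr_ge0// exprn_gt0.
by field; rewrite gt_eqF// gt_eqF.
Qed.

Lemma measurable_expNabs : measurable_fun setT (fun t : R => expR (- (a * `|t|))).
Proof.
apply: measurableT_comp; first by apply: continuous_measurable_fun; exact: continuous_expR.
by apply: measurableT_comp => //; apply: measurable_funM.
Qed.

Lemma measurable_cos_affine (z th : R) : measurable_fun setT (fun t : R => cos (t * z + th)).
Proof.
apply: measurableT_comp; first by apply: continuous_measurable_fun; exact: continuous_cos.
by apply: measurable_funD => //; apply: measurable_funM.
Qed.

Lemma integral_expNabs : (\int[mu]_t (expR (- (a * `|t|)))%:E = (2 / a)%:E)%E.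
Proof.
have := abel_line1 0 0.
under eq_integral do rewrite mulr0 addr0 cos0 mulrC EFinM.
rewrite ge0_integralZl_EFin; [|by []|by move=> x _; rewrite lee_fin expR_ge0| |by rewrite addr_ge0].
  2: by apply/measurable_EFinP; exact: measurable_expNabs.
rewrite cos0 expr0n addr0 mulr1 => /(congr1 (fun x => (2^-1)%:E * x)%E).
rewrite muleA -EFinM mulVf ?pnatr_eq0// mul1e => ->.
by rewrite -EFinM; congr EFin; field; rewrite gt_eqF.
Qed.

Lemma integrable_expNabs_cos (z th : R) :
  mu.-integrable setT (fun t => (expR (- (a * `|t|)) * cos (t * z + th))%:E).
Proof.
have int_exp : mu.-integrable setT (fun t => (expR (- (a * `|t|)))%:E).
  apply/integrableP; split; first by apply/measurable_EFinP; exact: measurable_expNabs.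
  under eq_integral do rewrite gee0_abs ?lee_fin ?expR_ge0//.
  by rewrite integral_expNabs ltry.
apply: le_integrable int_exp => //.
  apply/measurable_EFinP; apply: measurable_funM; first exact: measurable_expNabs.
  exact: measurable_cos_affine.
move=> t _; rewrite /= lee_fin normrM ler_piMr// ler_norml.
by apply/andP; split; [exact: cos_geN1|exact: cos_le1].
Qed.

(** Abel means of the cosine: the weight exp(-a|t|) has an explicit and
    nonnegative Fourier transform, which is the Poisson kernel. *)
Lemma integral_expNabs_cos (z th : R) :
  (\int[mu]_t (expR (- (a * `|t|)) * cos (t * z + th))%:E =
   (2 * a / (a ^+ 2 + z ^+ 2) * cos th)%:E)%E.
Proof.
have int_exp : mu.-integrable setT (fun t => (expR (- (a * `|t|)))%:E).
  have := integrable_expNabs_cos 0 0; apply: eq_integrable => // t _.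
  by rewrite mulr0 addr0 cos0 mulr1.
have := abel_line1 z th.
under eq_integral do rewrite mulrDr mulr1 EFinD.
rewrite integralD//=; last exact: integrable_expNabs_cos.
rewrite integral_expNabs EFinD.
have /fineK <- := integrable_fin_num measurableT (integrable_expNabs_cos z th).
rewrite -!EFinD => h; have := EFin_inj h; move/addrI => ->.
by congr EFin; ring.
Qed.

Lemma integral_poisson (x : R) :
  (\int[mu]_t (2 * a / (a ^+ 2 + (x - t) ^+ 2))%:E = (2 * pi)%:E)%E.
Proof.
have Dp y : 0 < a ^+ 2 + y ^+ 2 by rewrite ltr_pwDl ?sqr_ge0// exprn_gt0.
have cont (l : R -> R) : continuous l ->
    continuous (fun t : R => 2 * a / (a ^+ 2 + l t ^+ 2)).
  move=> cl t; apply: cvgM; first exact: cvg_cst.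
  apply: cvgV; first by rewrite gt_eqF.
  apply: cvgD; first exact: cvg_cst.
  by rewrite expr2; under eq_fun do rewrite expr2; apply: cvgM; exact: cl.
have half y : (\int[mu]_(t in `[0%R, +oo[) (2 * a / (a ^+ 2 + (y + t) ^+ 2))%:E =
    (pi - 2 * atan (y / a))%:E)%E.
  have dF (t : R) : is_derive t 1 (fun t => 2 * atan ((y + t) / a))
      (2 * a / (a ^+ 2 + (y + t) ^+ 2)).
    apply: is_derive_eq; rewrite /GRing.scale /=.
    by have := Dp (y + t) => Dt; field; rewrite !gt_eqF.
  rewrite (integral_half_line (F := fun t => 2 * atan ((y + t) / a)) (l := pi)).
  - by rewrite addr0.
  - by apply: cont => t; apply: cvgD; [exact: cvg_cst|exact: cvg_id].
  - by move=> t; rewrite divr_ge0 ?mulr_ge0 ?ltW.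
  - rewrite [X in _ --> X](_ : pi = 2 * (pi / 2)); last by field.
    apply: cvgM; first exact: cvg_cst.
    apply: (@cvg_comp _ _ _ (fun t : R => (y + t) / a) (@atan R) _ (pinfty_nbhs R));
      last exact: cvgy_atan.
    apply/cvgryPge => M; near=> t.
    rewrite ler_pdivlMr// -lerBlDl; near: t; apply: nbhs_pinfty_ge.
    exact: num_real.
rewrite integral_two_half_lines.
- rewrite [X in (X + _)%E](_ : _ = \int[mu]_(t in `[0%R, +oo[) (2 * a / (a ^+ 2 + (- x + t) ^+ 2))%:E)%E.
    rewrite [X in (_ + X)%E](_ : _ = \int[mu]_(t in `[0%R, +oo[) (2 * a / (a ^+ 2 + (x + t) ^+ 2))%:E)%E.
      by rewrite !half -EFinD mulNr atanN; congr EFin; ring.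
    by apply: eq_integral => t _; rewrite opprK.
  by apply: eq_integral => t _; rewrite (_ : x - t = - (- x + t)) ?sqrrN//; ring.
- apply: continuous_measurable_fun; apply: cont => t.
  by apply: cvgB; [exact: cvg_cst|exact: cvg_id].
- by move=> t; rewrite divr_ge0 ?mulr_ge0 ?ltW.
Unshelve. all: by end_near. Qed.

End OneDim.

(** * The Poisson kernel in several dimensions *)

Section Kernel.
Variable R : realType.
Local Notation mu := (@lebesgue_measure R).
Local Notation leb := (lebesgue_rV R).

Definition dot n (x y : 'rV[R]_n) : R := \sum_i x ord0 i * y ord0 i.

(** The Abel weight exp(- a sum_i |xi_i|), written as a product in order to
    integrate one variable at a time. *)
Definition weight (a : R) n (xi : 'rV[R]_n) : R := \prod_i expR (- (a * `|xi ord0 i|)).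

(** The Fourier transform of the weight, a product of Poisson kernels. *)
Definition poisson (a : R) n (z : 'rV[R]_n) : R :=
  \prod_i (2 * a / (a ^+ 2 + z ord0 i ^+ 2)).

Definition tail_rV n (z : 'rV[R]_n.+1) : 'rV[R]_n := \row_i z ord0 (lift ord0 i).

Lemma dot_cons n s (x : 'rV[R]_n) z :
  dot (cons_rV (s, x)) z = s * z ord0 ord0 + dot x (tail_rV z).
Proof.
rewrite /dot big_ord_recl cons_rV0; congr (_ + _); apply: eq_bigr => i _.
by rewrite cons_rV_lift mxE.
Qed.

Lemma dotC n (x y : 'rV[R]_n) : dot x y = dot y x.
Proof. by apply: eq_bigr => i _; rewrite mulrC. Qed.

Lemma dotBr n (x y z : 'rV[R]_n) : dot x (y - z) = dot x y - dot x z.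
Proof. by rewrite /dot -sumrB; apply: eq_bigr => i _; rewrite !mxE mulrBr. Qed.

Lemma weight_cons a n s (x : 'rV[R]_n) :
  weight a (cons_rV (s, x)) = expR (- (a * `|s|)) * weight a x.
Proof.
rewrite /weight big_ord_recl cons_rV0; congr (_ * _); apply: eq_bigr => i _.
by rewrite cons_rV_lift.
Qed.

Lemma poisson_recl a n (z : 'rV[R]_n.+1) :
  poisson a z = 2 * a / (a ^+ 2 + z ord0 ord0 ^+ 2) * poisson a (tail_rV z).
Proof.
by rewrite /poisson big_ord_recl; congr (_ * _); apply: eq_bigr => i _; rewrite mxE.
Qed.

Lemma weight_ge0 a n (x : 'rV[R]_n) : 0 <= weight a x.
Proof. by apply: prodr_ge0 => i _; exact: expR_ge0. Qed.

Lemma measurable_weight a n : measurable_fun setT (@weight a n).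
Proof.
apply: measurable_prod => i _; apply: measurableT_comp.
  by apply: continuous_measurable_fun; exact: continuous_expR.
apply: measurableT_comp => //; apply: measurable_funM => //.
by apply: measurableT_comp => //; exact: measurable_coord.
Qed.

Lemma measurable_dot n (z : 'rV[R]_n) : measurable_fun setT (fun x : 'rV[R]_n => dot x z).
Proof.
by apply: measurable_sum => i; apply: measurable_funM => //; exact: measurable_coord.
Qed.

Lemma measurable_dotl n (z : 'rV[R]_n) : measurable_fun setT (fun x : 'rV[R]_n => dot z x).
Proof.
rewrite (_ : (fun x => _) = fun x => dot x z); first exact: measurable_dot.
by apply/funext => x; rewrite dotC.
Qed.

Lemma measurable_cos_dot n (z : 'rV[R]_n) th :
  measurable_fun setT (fun x : 'rV[R]_n => cos (dot x z + th)).
Proof.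
apply: measurableT_comp; first by apply: continuous_measurable_fun; exact: continuous_cos.
by apply: measurable_funD => //; exact: measurable_dot.
Qed.

Variable a : R.
Hypothesis a0 : 0 < a.

Lemma integral_weight n : (\int[leb n]_x (weight a x)%:E = ((2 / a) ^+ n)%:E)%E.
Proof.
have mw m := @measurable_weight a m.
elim: n => [|n IH].
  rewrite expr0; under eq_integral do rewrite /weight big_ord0.
  by rewrite integral_dirac//= diracT mul1e.
rewrite tonelli_rV; [|by apply/measurable_EFinP; exact: mw|by move=> x; rewrite lee_fin weight_ge0].
transitivity (\int[mu]_s (((2 / a) ^+ n)%:E * (expR (- (a * `|s|)))%:E))%E.
  apply: eq_integral => s _.
  under eq_integral do rewrite weight_cons EFinM.
  rewrite ge0_integralZl_EFin; [|by []|by move=> x _; rewrite lee_fin weight_ge0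
    |by apply/measurable_EFinP; exact: mw|exact: expR_ge0].
  by rewrite IH muleC.
rewrite ge0_integralZl_EFin; [|by []|by move=> x _; rewrite lee_fin expR_ge0| |].
- by rewrite integral_expNabs// -EFinM -exprSr.
- by apply/measurable_EFinP; exact: measurable_expNabs.
- by rewrite exprn_ge0// divr_ge0// ltW.
Qed.

Lemma integrable_weight n : (leb n).-integrable setT (fun x => (weight a x)%:E).
Proof.
apply/integrableP; split; first by apply/measurable_EFinP; exact: measurable_weight.
under eq_integral do rewrite gee0_abs ?lee_fin ?weight_ge0//.
by rewrite integral_weight ltry.
Qed.

Lemma integrable_weight_cos n z th :
  (leb n).-integrable setT (fun x => (weight a x * cos (dot x z + th))%:E).
Proof.
apply: le_integrable (integrable_weight n) => //.
  apply/measurable_EFinP; apply: measurable_funM; first exact: measurable_weight.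
  exact: measurable_cos_dot.
move=> t _; rewrite /= lee_fin normrM ler_piMr// ler_norml.
by apply/andP; split; [exact: cos_geN1|exact: cos_le1].
Qed.

Lemma integral_weight_cos n z th :
  (\int[leb n]_x (weight a x * cos (dot x z + th))%:E =
   (poisson a z * cos th)%:E)%E.
Proof.
elim: n z th => [|n IH] z th.
  under eq_integral do rewrite /weight /dot !big_ord0 mul1r add0r.
  by rewrite integral_dirac//= diracT mul1e /poisson big_ord0 mul1r.
rewrite fubini_rV; last exact: integrable_weight_cos.
transitivity (\int[mu]_s ((poisson a (tail_rV z))%:E *
    (expR (- (a * `|s|)) * cos (s * z ord0 ord0 + th))%:E))%E.
  apply: eq_integral => s _.
  transitivity (\int[leb n]_x ((expR (- (a * `|s|)))%:E *
     (weight a x * cos (dot x (tail_rV z) + (s * z ord0 ord0 + th)))%:E))%E.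
    apply: eq_integral => x _; rewrite weight_cons dot_cons -EFinM mulrA; congr ((_ * cos _)%:E).
    by ring.
  rewrite integralZl//; last exact: integrable_weight_cos.
  by rewrite IH -!EFinM; congr EFin; ring.
rewrite integralZl//; last exact: integrable_expNabs_cos.
by rewrite integral_expNabs_cos// -EFinM poisson_recl; congr EFin; ring.
Qed.

Lemma poisson_ge0 n (z : 'rV[R]_n) : 0 <= poisson a z.
Proof.
apply: prodr_ge0 => i _; apply: divr_ge0; first by rewrite mulr_ge0// ltW.
by rewrite addr_ge0// sqr_ge0.
Qed.

Lemma poisson_sym n (x y : 'rV[R]_n) : poisson a (x - y) = poisson a (y - x).
Proof.
by apply: eq_bigr => i _; rewrite !mxE -[in RHS]opprB sqrrN.
Qed.

Lemma continuous_poisson1 : continuous (fun t : R => 2 * a / (a ^+ 2 + t ^+ 2)).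
Proof.
move=> t.
have Dp : 0 < a ^+ 2 + t ^+ 2 by rewrite ltr_pwDl ?sqr_ge0// exprn_gt0.
apply: cvgM; first exact: cvg_cst.
apply: cvgV; first by rewrite gt_eqF.
apply: cvgD; first exact: cvg_cst.
by rewrite expr2; under eq_fun do rewrite expr2; apply: cvgM; exact: cvg_id.
Qed.

Lemma measurable_poisson1 x :
  measurable_fun setT (fun s : R => 2 * a / (a ^+ 2 + (x - s) ^+ 2)).
Proof.
apply: (@measurableT_comp _ _ _ _ _ _ (fun t : R => 2 * a / (a ^+ 2 + t ^+ 2))).
  by apply: continuous_measurable_fun; exact: continuous_poisson1.
exact: measurable_funB.
Qed.

Lemma measurable_poisson n : measurable_fun setT (@poisson a n).
Proof.
apply: measurable_prod => i _.
apply: (@measurableT_comp _ _ _ _ _ _ (fun t : R => 2 * a / (a ^+ 2 + t ^+ 2))).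
  by apply: continuous_measurable_fun; exact: continuous_poisson1.
exact: measurable_coord.
Qed.

Lemma measurable_poisson_sub n (x : 'rV[R]_n) :
  measurable_fun setT (fun y : 'rV[R]_n => poisson a (x - y)).
Proof.
have mB : measurable_fun setT (fun y : 'rV[R]_n => x - y).
  apply: measurable_fun_rVP => i.
  rewrite [X in measurable_fun _ X](_ : _ = fun y : 'rV[R]_n => x ord0 i - y ord0 i).
    by apply: measurable_funB => //; exact: measurable_coord.
  by apply/funext => y; rewrite /= /coord_rV !mxE.
exact: (measurableT_comp (@measurable_poisson n) mB).
Qed.

Lemma integral_poisson_rV n (x : 'rV[R]_n) :
  (\int[leb n]_y (poisson a (x - y))%:E = ((2 * pi) ^+ n)%:E)%E.
Proof.
elim: n x => [|n IH] x.
  rewrite expr0; under eq_integral do rewrite /poisson big_ord0.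
  by rewrite integral_dirac//= diracT mul1e.
rewrite tonelli_rV; [|apply/measurable_EFinP; exact: measurable_poisson_sub
   |by move=> y; rewrite lee_fin poisson_ge0].
transitivity (\int[mu]_s (((2 * pi) ^+ n)%:E *
    (2 * a / (a ^+ 2 + (x ord0 ord0 - s) ^+ 2))%:E))%E.
  apply: eq_integral => s _.
  transitivity (\int[leb n]_y ((2 * a / (a ^+ 2 + (x ord0 ord0 - s) ^+ 2))%:E *
      (poisson a (tail_rV x - y))%:E))%E.
    apply: eq_integral => y _; rewrite poisson_recl -EFinM.
    move: (cons_rV (s, y)) (cons_rV0 s y) (cons_rV_lift s y) => c c0 cl.
    rewrite !mxE c0; congr ((_ * poisson _ _)%:E).
    by apply/rowP => i; rewrite !mxE cl.
  rewrite ge0_integralZl_EFin; [|by []|by move=> y _; rewrite lee_fin poisson_ge0| |].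
  - by rewrite IH muleC.
  - by apply/measurable_EFinP; exact: measurable_poisson_sub.
  - by apply: divr_ge0; [rewrite mulr_ge0// ltW|rewrite addr_ge0// sqr_ge0].
rewrite ge0_integralZl_EFin; [|by []| | |].
- by rewrite integral_poisson// -EFinM -exprSr.
- move=> s _; rewrite lee_fin.
  by apply: divr_ge0; [rewrite mulr_ge0// ltW|rewrite addr_ge0// sqr_ge0].
- by apply/measurable_EFinP; exact: measurable_poisson1.
- by rewrite exprn_ge0// mulr_ge0// pi_ge0.
Qed.

End Kernel.

(** * Integrals of tensor products *)

Section ProductSigmaFinite.
Local Open Scope ereal_scope.
Context d1 d2 (T1 : measurableType d1) (T2 : measurableType d2) (R : realType).
Variable m1 : {sigma_finite_measure set T1 -> \bar R}.
Variable m2 : {sigma_finite_measure set T2 -> \bar R}.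

Lemma product_sigma_finite : sigma_finite setT (m1 \x m2).
Proof.
have /sigma_finiteP[F [FT ndF Foo]] := sigma_finiteT m1.
have /sigma_finiteP[G [GT ndG Goo]] := sigma_finiteT m2.
exists (fun k => F k `*` G k).
  apply/esym/seteqP; split=> // -[a x] _.
  have [k _ Fa] : (\bigcup_k F k) a by rewrite -FT.
  have [l _ Gx] : (\bigcup_k G k) x by rewrite -GT.
  exists (maxn k l) => //; split=> /=.
    by move: a Fa; exact/subsetPset/ndF/leq_maxl.
  by move: x Gx; exact/subsetPset/ndG/leq_maxr.
move=> k; have [mF Fk] := Foo k; have [mG Gk] := Goo k.
split; first exact: measurableX.
by rewrite product_measure1E// lte_mul_pinfty// ge0_fin_numE.
Qed.

(** An alias of the product measure that carries its sigma-finiteness, needed to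
    iterate products. *)
Definition sigma_finite_product : set (T1 * T2) -> \bar R := m1 \x m2.
HB.instance Definition _ := Measure.on sigma_finite_product.
HB.instance Definition _ := Measure_isSigmaFinite.Build _ _ _ sigma_finite_product product_sigma_finite.
End ProductSigmaFinite.

Section TensorProduct.
Context d1 d2 (T1 : measurableType d1) (T2 : measurableType d2) (R : realType).
Variables (m1 : {sigma_finite_measure set T1 -> \bar R})
  (m2 : {sigma_finite_measure set T2 -> \bar R}).
Variables (f : T1 -> R) (g : T2 -> R).
Hypothesis fi : m1.-integrable setT (EFin \o f).
Hypothesis gi : m2.-integrable setT (EFin \o g).

Lemma integrable_tensor :
  (m1 \x m2)%E.-integrable setT (fun p => (f p.1 * g p.2)%:E).
Proof.
have /measurable_EFinP mf := measurable_int _ fi.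
have /measurable_EFinP mg := measurable_int _ gi.
apply/integrable12ltyP.
  apply/measurable_EFinP; apply: measurable_funM.
    exact: measurableT_comp mf measurable_fst.
  exact: measurableT_comp mg measurable_snd.
have /integrableP[_] := gi; have /integrableP[_] := fi.
have g0 : (0 <= \int[m2]_y `|(g y)%:E|)%E by apply: integral_ge0.
rewrite /= => fy gy.
rewrite (_ : (\int[m1]_x _)%E = (\int[m1]_x (`|(f x)%:E| * \int[m2]_y `|(g y)%:E|))%E).
  rewrite ge0_integralZr//.
    by rewrite lte_mul_pinfty// ?ge0_fin_numE// integral_ge0.
  by apply: measurableT_comp => //; exact/measurable_EFinP.
apply: eq_integral => x _; rewrite -ge0_integralZl//.
  by apply: eq_integral => y _; rewrite -abseM.
by apply: measurableT_comp => //; exact/measurable_EFinP.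
Qed.

Lemma integral_tensor :
  (\int[m1 \x m2]_p (f p.1 * g p.2)%:E =
   ((\int[m1]_x f x) * (\int[m2]_y g y))%:E)%E.
Proof.
rewrite -integral12_prod_meas1; last exact: integrable_tensor.
have If : (\int[m1]_x (f x)%:E = (\int[m1]_x f x)%R%:E)%E.
  by rewrite /Rintegral fineK//; apply: integrable_fin_num.
have Ig : (\int[m2]_x (g x)%:E = (\int[m2]_x g x)%R%:E)%E.
  by rewrite /Rintegral fineK//; apply: integrable_fin_num.
transitivity (\int[m1]_x ((f x)%:E * (\int[m2]_y g y)%R%:E))%E.
  apply: eq_integral => x _; rewrite -Ig -integralZl//.
by rewrite integralZr// EFinM If.
Qed.

End TensorProduct.

(** * Plancherel's inequality *)

Section PlancherelInequality.
Variables (R : realType) (n : nat).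
Local Notation leb := (lebesgue_rV R n).
Local Notation lebb := (sigma_finite_product leb leb).
Variable u : 'rV[R]_n -> R.
Hypothesis iu : leb.-integrable setT (EFin \o u).

Let mu_ : measurable_fun setT u.
Proof. by apply/measurable_EFinP; exact: measurable_int iu. Qed.

(** Squared modulus of the Fourier transform of u. *)
Definition fourier_sqr (xi : 'rV[R]_n) : R :=
  (\int[leb]_x (u x * cos (dot xi x))) ^+ 2 +
  (\int[leb]_x (u x * sin (dot xi x))) ^+ 2.

Lemma measurable_dot_pair :
  measurable_fun setT (fun q : 'rV[R]_n * ('rV[R]_n * 'rV[R]_n) =>
    dot q.1 (q.2.1 - q.2.2)).
Proof.
apply: measurable_sum => i; apply: measurable_funM.
  exact: measurableT_comp (@measurable_coord R n i) measurable_fst.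
rewrite [X in measurable_fun _ X](_ : _ =
  fun q : 'rV[R]_n * ('rV[R]_n * 'rV[R]_n) => q.2.1 ord0 i - q.2.2 ord0 i); last first.
  by apply/funext => q; rewrite !mxE.
apply: measurable_funB.
  apply: (measurableT_comp (@measurable_coord R n i)).
  exact: measurableT_comp measurable_fst measurable_snd.
apply: (measurableT_comp (@measurable_coord R n i)).
exact: measurableT_comp measurable_snd measurable_snd.
Qed.

Lemma integrable_trig (h : R -> R) (xi : 'rV[R]_n) : measurable_fun setT h ->
  (forall t, `|h t| <= 1) -> leb.-integrable setT (EFin \o (fun x => u x * h (dot xi x))).
Proof.
move=> mh h1; apply: le_integrable iu => //.
  apply/measurable_EFinP; apply: measurable_funM => //.
  by apply: (measurableT_comp mh); exact: measurable_dotl.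
by move=> x _; rewrite /= lee_fin normrM ler_piMr.
Qed.

Lemma normr_cos_le1 (t : R) : `|cos t| <= 1.
Proof. by rewrite ler_norml; apply/andP; split; [exact: cos_geN1|exact: cos_le1]. Qed.

Lemma normr_sin_le1 (t : R) : `|sin t| <= 1.
Proof. by rewrite ler_norml; apply/andP; split; [exact: sin_geN1|exact: sin_le1]. Qed.

Lemma measurable_cos : measurable_fun setT (@cos R).
Proof. by apply: continuous_measurable_fun; exact: continuous_cos. Qed.

Lemma measurable_sin : measurable_fun setT (@sin R).
Proof. by apply: continuous_measurable_fun; exact: continuous_sin. Qed.

(** |F u(xi)|^2 as a double integral; real and imaginary parts combine through
    the addition formula for the cosine. *)
Lemma fourier_sqrE (xi : 'rV[R]_n) :
  ((fourier_sqr xi)%:E =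
   \int[leb \x leb]_p (u p.1 * u p.2 * cos (dot xi (p.1 - p.2)))%:E)%E.
Proof.
have ic := integrable_trig xi measurable_cos normr_cos_le1.
have isn := integrable_trig xi measurable_sin normr_sin_le1.
rewrite /fourier_sqr !expr2 EFinD -!integral_tensor// -integralD//=; last 2 first.
- exact: (integrable_tensor ic ic).
- exact: (integrable_tensor isn isn).
apply: eq_integral => p _; rewrite -EFinD; congr EFin.
by rewrite dotBr cosB; ring.
Qed.

Let F (a : R) (q : 'rV[R]_n * ('rV[R]_n * 'rV[R]_n)) : \bar R :=
  (weight a q.1 * (u q.2.1 * u q.2.2 * cos (dot q.1 (q.2.1 - q.2.2))))%:E.

Lemma integrable_weighted a : 0 < a -> (leb \x lebb)%E.-integrable setT (F a).
Proof.
move=> a0.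
have iw := integrable_weight a0 n; have iuu := integrable_tensor iu iu.
have := @integrable_tensor _ _ 'rV[R]_n ('rV[R]_n * 'rV[R]_n)%type R leb lebb (@weight R a n)
  (fun p => u p.1 * u p.2) iw iuu.
apply: le_integrable => //.
  apply/measurable_EFinP; apply: measurable_funM.
    exact: measurableT_comp (@measurable_weight R a n) measurable_fst.
  apply: measurable_funM; last first.
    by apply: (measurableT_comp measurable_cos); exact: measurable_dot_pair.
  apply: measurable_funM; apply: (measurableT_comp mu_).
    exact: measurableT_comp measurable_fst measurable_snd.
  exact: measurableT_comp measurable_snd measurable_snd.
by move=> q _; rewrite /= lee_fin mulrA normrM ler_piMr// normr_cos_le1.
Qed.

Lemma integrable_uu_cos xi : (leb \x leb)%E.-integrable setT
  (fun p => (u p.1 * u p.2 * cos (dot xi (p.1 - p.2)))%:E).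
Proof.
apply: le_integrable (integrable_tensor iu iu) => //.
  apply/measurable_EFinP; apply: measurable_funM.
    apply: measurable_funM; first exact: measurableT_comp mu_ measurable_fst.
    exact: measurableT_comp mu_ measurable_snd.
  apply: (measurableT_comp measurable_cos).
  exact: (measurableT_comp measurable_dot_pair (pair1_measurable xi)).
by move=> p _; rewrite /= lee_fin normrM ler_piMr// normr_cos_le1.
Qed.

Lemma weighted_fourier_sqr a xi :
  ((weight a xi * fourier_sqr xi)%:E = \int[leb \x leb]_p F a (xi, p))%E.
Proof.
rewrite EFinM fourier_sqrE -integralZl//; exact: integrable_uu_cos.
Qed.

Lemma weightE (a : R) (xi : 'rV[R]_n) : weight a xi = expR (- (a * \sum_i `|xi ord0 i|)).
Proof.
rewrite /weight mulr_sumr -sumrN.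
by apply: (big_ind2 (fun x y => x = expR y)) => [|x1 x2 y1 y2 -> ->|//]; rewrite ?expR0 ?expRD.
Qed.

(** Measurability comes for free from Fubini's theorem once a weight makes the
    triple integral converge. *)
Lemma measurable_fourier_sqr : measurable_fun setT fourier_sqr.
Proof.
have := @measurable_fubini_F _ _ 'rV[R]_n ('rV[R]_n * 'rV[R]_n)%type R leb lebb _ (integrable_weighted ltr01).
rewrite (_ : fubini_F _ _ = fun xi => (weight 1 xi * fourier_sqr xi)%:E); last first.
  by apply/funext => xi; rewrite weighted_fourier_sqr.
move/measurable_EFinP => m1.
rewrite (_ : fourier_sqr = fun xi => (weight 1 xi)^-1 * (weight 1 xi * fourier_sqr xi)).
  apply: measurable_funM => //.
  rewrite [X in measurable_fun _ X](_ : _ = fun x : 'rV[R]_n => expR (\sum_i `|x ord0 i|)).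
    apply: measurableT_comp; first by apply: continuous_measurable_fun; exact: continuous_expR.
    by apply: measurable_sum => i; apply: measurableT_comp => //; exact: measurable_coord.
  by apply/funext => x; rewrite weightE mul1r expRN invrK.
by apply/funext => x; rewrite mulKf// gt_eqF// weightE expR_gt0.
Qed.

Lemma fourier_sqr_ge0 xi : 0 <= fourier_sqr xi.
Proof. by rewrite addr_ge0// sqr_ge0. Qed.

Hypothesis iu2 : (\int[leb]_x (u x ^+ 2)%:E < +oo)%E.

Lemma measurable_poisson_pair a : 0 < a ->
  measurable_fun setT (fun p : 'rV[R]_n * 'rV[R]_n => poisson a (p.1 - p.2)).
Proof.
move=> a0.
have mB : measurable_fun setT (fun p : 'rV[R]_n * 'rV[R]_n => p.1 - p.2).
  apply: measurable_fun_rVP => i.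
  rewrite [X in measurable_fun _ X](_ : _ = fun p : 'rV[R]_n * 'rV[R]_n => p.1 ord0 i - p.2 ord0 i).
    apply: measurable_funB.
      exact: measurableT_comp (@measurable_coord R n i) measurable_fst.
    exact: measurableT_comp (@measurable_coord R n i) measurable_snd.
  by apply/funext => y; rewrite /= /coord_rV !mxE.
exact: (measurableT_comp (@measurable_poisson R a a0 n) mB).
Qed.

(** The right-hand side of Schur's test: all the translates of the Poisson
    kernel have the same integral, in either variable. *)
Lemma schur_poisson a : 0 < a ->
  (\int[leb \x leb]_p ((u p.1 ^+ 2 + u p.2 ^+ 2) / 2 * poisson a (p.1 - p.2))%:E =
   ((2 * pi) ^+ n)%:E * \int[leb]_x (u x ^+ 2)%:E)%E.
Proof.
move=> a0.
have mP := measurable_poisson_pair a0.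
have mu1 : measurable_fun setT (fun p : 'rV[R]_n * 'rV[R]_n => u p.1 ^+ 2).
  by apply: measurable_funX; exact: measurableT_comp mu_ measurable_fst.
have mu2 : measurable_fun setT (fun p : 'rV[R]_n * 'rV[R]_n => u p.2 ^+ 2).
  by apply: measurable_funX; exact: measurableT_comp mu_ measurable_snd.
have pos x p : 0 <= u x ^+ 2 / 2 * poisson a p.
  by rewrite mulr_ge0 ?poisson_ge0// divr_ge0 ?sqr_ge0.
have inner x : (\int[leb]_y (u x ^+ 2 / 2 * poisson a (x - y))%:E =
    ((2 * pi) ^+ n / 2)%:E * (u x ^+ 2)%:E)%E.
  under eq_integral do rewrite EFinM.
  rewrite ge0_integralZl_EFin; [|by []|by move=> y _; rewrite lee_fin poisson_ge0| |].
  - by rewrite integral_poisson_rV// -!EFinM; congr EFin; ring.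
  - by apply/measurable_EFinP; exact: measurable_poisson_sub.
  - by rewrite divr_ge0 ?sqr_ge0.
have pin : 0 <= (2 * pi) ^+ n / 2 :> R.
  by rewrite divr_ge0// exprn_ge0// mulr_ge0// pi_ge0.
have outer : (\int[leb]_x (((2 * pi) ^+ n / 2)%:E * (u x ^+ 2)%:E) =
   ((2 * pi) ^+ n / 2)%:E * \int[leb]_x (u x ^+ 2)%:E)%E.
  rewrite ge0_integralZl_EFin//; first by move=> y _; rewrite lee_fin sqr_ge0.
  by apply/measurable_EFinP; exact: measurable_funX.
pose f1 p := (u p.1 ^+ 2 / 2 * poisson a (p.1 - p.2))%:E.
pose f2 p := (u p.2 ^+ 2 / 2 * poisson a (p.1 - p.2))%:E.
have mf1 : measurable_fun setT f1.
  by apply/measurable_EFinP; apply: measurable_funM => //; apply: measurable_funM.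
have mf2 : measurable_fun setT f2.
  by apply/measurable_EFinP; apply: measurable_funM => //; apply: measurable_funM.
have f10 p : (0 <= f1 p)%E by rewrite lee_fin; exact: pos.
have f20 p : (0 <= f2 p)%E by rewrite lee_fin; exact: pos.
transitivity (\int[leb \x leb]_p f1 p + \int[leb \x leb]_p f2 p)%E.
  rewrite -ge0_integralD//.
  by apply: eq_integral => p _; rewrite -EFinD; congr EFin; ring.
rewrite (fubini_tonelli1 f1)// (fubini_tonelli2 f2)//.
rewrite /fubini_F /fubini_G /f1 /f2 /=.
under eq_integral do rewrite inner.
under [X in (_ + X)%E]eq_integral => y _.
  under eq_integral do rewrite poisson_sym.
  rewrite inner.
  over.
rewrite outer -ge0_muleDl ?lee_fin// -EFinD; congr (_%:E * _)%E.
by field.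
Qed.

(** Integrating in xi first replaces the weight by the Poisson kernel, which is
    nonnegative; then u(x) u(y) <= (u(x)^2 + u(y)^2) / 2. *)
Lemma weighted_plancherel a : 0 < a ->
  (\int[leb]_xi (weight a xi * fourier_sqr xi)%:E <=
   ((2 * pi) ^+ n)%:E * \int[leb]_x (u x ^+ 2)%:E)%E.
Proof.
move=> a0; have iF := integrable_weighted a0.
under eq_integral do rewrite weighted_fourier_sqr.
rewrite (Fubini iF) -(schur_poisson a0).
apply: (@le_trans _ _ (\int[leb \x leb]_p (u p.1 * u p.2 * poisson a (p.1 - p.2))%:E)%E).
  rewrite le_eqVlt; apply/orP; left; apply/eqP; apply: eq_integral => p _.
  transitivity ((\int[leb]_xi ((u p.1 * u p.2)%:E * (weight a xi * cos (dot xi (p.1 - p.2) + 0))%:E))%E).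
    by apply: eq_integral => xi _; rewrite /F -EFinM addr0; congr EFin; rewrite /=; ring.
  rewrite integralZl//; last exact: integrable_weight_cos.
  by rewrite integral_weight_cos// cos0 mulr1 -EFinM.
have mP := measurable_poisson_pair a0.
have m1 : measurable_fun setT (fun p : 'rV[R]_n * 'rV[R]_n => u p.1).
  exact: measurableT_comp mu_ measurable_fst.
have m2 : measurable_fun setT (fun p : 'rV[R]_n * 'rV[R]_n => u p.2).
  exact: measurableT_comp mu_ measurable_snd.
have mr : measurable_fun setT (fun p : 'rV[R]_n * 'rV[R]_n =>
    ((u p.1 ^+ 2 + u p.2 ^+ 2) / 2 * poisson a (p.1 - p.2))%:E).
  apply/measurable_EFinP; apply: measurable_funM => //; apply: measurable_funM => //.
  by apply: measurable_funD; apply: measurable_funX.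
have ml : measurable_fun setT (fun p : 'rV[R]_n * 'rV[R]_n =>
    (u p.1 * u p.2 * poisson a (p.1 - p.2))%:E).
  by apply/measurable_EFinP; apply: measurable_funM => //; apply: measurable_funM.
have r0 (p : 'rV[R]_n * 'rV[R]_n) :
    0 <= (u p.1 ^+ 2 + u p.2 ^+ 2) / 2 * poisson a (p.1 - p.2).
  by rewrite mulr_ge0 ?poisson_ge0// divr_ge0// addr_ge0 ?sqr_ge0.
have uuP (s t : R) : `|s * t| <= (s ^+ 2 + t ^+ 2) / 2.
  have := sqr_ge0 (s - t); have := sqr_ge0 (s + t).
  by rewrite ler_norml !expr2 => ? ?; apply/andP; split; lra.
have ir : (leb \x leb)%E.-integrable setT (fun p : 'rV[R]_n * 'rV[R]_n =>
    ((u p.1 ^+ 2 + u p.2 ^+ 2) / 2 * poisson a (p.1 - p.2))%:E).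
  apply/integrableP; split => //.
  under eq_integral do rewrite gee0_abs ?lee_fin//.
  by rewrite schur_poisson// lte_mul_pinfty// lee_fin exprn_ge0// mulr_ge0// pi_ge0.
apply: le_integral => //.
  apply: le_integrable ir => // p _.
  rewrite /= lee_fin normrM [leRHS]ger0_norm// [X in _ * X]ger0_norm ?poisson_ge0//.
  by rewrite ler_wpM2r ?poisson_ge0.
move=> p _; rewrite lee_fin ler_wpM2r ?poisson_ge0//.
by apply: le_trans (uuP _ _); exact: ler_norm.
Qed.

(** The weights of parameter 1/(k+1) tend to 1, and Fatou's lemma removes them. *)
Theorem plancherel_le :
  (\int[leb]_xi (fourier_sqr xi)%:E <=
   ((2 * pi) ^+ n)%:E * \int[leb]_x (u x ^+ 2)%:E)%E.
Proof.
pose f (k : nat) xi := (weight k.+1%:R^-1 xi * fourier_sqr xi)%:E.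
have cf xi : f ^~ xi @ \oo --> (fourier_sqr xi)%:E.
  apply: cvg_EFin; first exact: nearW.
  suff h : weight k.+1%:R^-1 xi @[k --> \oo] --> (1 : R).
    by rewrite /f /= -[in X in _ --> X](mul1r (fourier_sqr xi)); apply: cvgM => //; exact: cvg_cst.
  have h0 : - (k.+1%:R^-1 * \sum_i `|xi ord0 i|) @[k --> \oo] --> (0 : R).
    rewrite -[in X in _ --> X](oppr0 R); apply: cvgN.
    rewrite -[in X in _ --> X](mul0r (\sum_i `|xi ord0 i|)).
    by apply: cvgM; [exact: (@cvg_harmonic R)|exact: cvg_cst].
  under eq_fun do rewrite weightE.
  have := continuous_cvg _ (@continuous_expR R 0) h0.
  by rewrite expR0; apply.
have mf k : measurable_fun setT (f k).
  apply/measurable_EFinP; apply: measurable_funM; last exact: measurable_fourier_sqr.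
  exact: measurable_weight.
have f0 k xi : (0 <= f k xi)%E.
  by rewrite lee_fin mulr_ge0 ?weight_ge0 ?fourier_sqr_ge0.
rewrite (_ : (\int[leb]_xi (fourier_sqr xi)%:E)%E = (\int[leb]_xi limn_einf (f ^~ xi))%E).
  apply: le_trans (fatou _ _ _ _) _ => //.
  rewrite limn_einf_lim; apply: lime_le; first exact: is_cvg_einfs.
  apply: nearW => k; apply: (@le_trans _ _ (\int[leb]_xi f k xi)%E).
    by apply: ereal_inf_lbound; exists k => /=.
  by apply: weighted_plancherel; rewrite invr_gt0.
apply: eq_integral => xi _; rewrite is_cvg_limn_einfE.
  by apply/esym/cvg_lim => //; exact: cf.
by apply: cvgP; exact: cf.
Qed.

End PlancherelInequality.

(** * Integration by parts against test functions *)

Section IntegrationByParts.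
Variable R : realType.
Local Notation mu := (@lebesgue_measure R).
Local Notation leb := (lebesgue_rV R).

Lemma integral_deriv_compact_support (f g : R -> R) (M : R) :
  continuous g -> (forall t : R, is_derive t 1 f (g t)) ->
  (forall t, M < `|t| -> f t = 0 /\ g t = 0) ->
  (\int[mu]_t (g t)%:E = 0)%E.
Proof.
move=> cg df sup; pose b : R := `|M| + 1.
have b0 : 0 < b by rewrite ltr_wpDl.
have Mb : M < b by apply: le_lt_trans (ler_norm M) _; rewrite ltrDl.
have -> : (\int[mu]_t (g t)%:E = \int[mu]_(t in `[(- b)%R, b]) (g t)%:E)%E.
  rewrite [RHS]integral_mkcond; apply: eq_integral => t _; rewrite patchE.
  case: ifPn => // /negP; rewrite inE /= in_itv /= -ler_norml => /negP.
  by rewrite -ltNge => /(lt_trans Mb)/sup[_ ->].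
have cf := is_derive_continuous df.
rewrite (@continuous_FTC2 _ g f).
- have [-> _] : f b = 0 /\ g b = 0 by apply: sup; rewrite gtr0_norm.
  have [-> _] : f (- b) = 0 /\ g (- b) = 0 by apply: sup; rewrite normrN gtr0_norm.
  by rewrite subee.
- by rewrite ltrNl; lra.
- exact: continuous_subspaceT.
- split.
  + by move=> y _; apply: ex_derive.
  + by apply: cvg_at_right_filter; exact: cf.
  + by apply: cvg_at_left_filter; exact: cf.
- by move=> s _; rewrite derive1E; apply: derive_val.
Qed.

Lemma integrable_bounded_support n (G : 'rV[R]_n -> R) (M C : R) :
  measurable_fun setT G -> (forall x, `|G x| <= C) ->
  (forall (x : 'rV[R]_n) i, M < `|x ord0 i| -> G x = 0) ->
  (leb n).-integrable setT (EFin \o G).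
Proof.
move=> mG GC sup.
pose B := [set x : 'rV[R]_n | forall i, `[(- M)%R, M]%classic (x ord0 i)].
have mB : measurable B by exact: (@measurable_box R n (fun=> `[- M, M]%classic)).
have Boo : (leb n B < +oo)%E.
  by apply: (@bounded_lebesgue_rV _ _ _ M) => // x Bx i; have := Bx i; rewrite /= in_itv /= -ler_norml.
have C0 : 0 <= C by apply: le_trans (GC 0).
apply/integrableP; split; first exact/measurable_EFinP.
apply: (@le_lt_trans _ _ (\int[leb n]_(x in B) (C%:E))%E).
  rewrite [leRHS]integral_mkcond; apply: ge0_le_integral => //.
  - by apply: measurableT_comp => //; exact/measurable_EFinP.
  - by apply/(measurable_restrictT _ _).1.
  - move=> x _; rewrite patchE /=; case: ifPn => [_|/negP xB]; first by rewrite lee_fin.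
    have [i Mi] : exists i, M < `|x ord0 i|.
      apply: contrapT => h; apply: xB; apply/mem_set => i.
      by rewrite /= in_itv /= -ler_norml leNgt; apply/negP => Mi; apply: h; exists i.
    by rewrite (sup x i Mi) normr0.
by rewrite integral_cst// lte_mul_pinfty.
Qed.

Lemma lineE n (y : 'rV[R]_n) (i k : 'I_n) (t : R) :
  (y + t *: delta_mx ord0 i) ord0 k = y ord0 k + t * (k == i)%:R.
Proof. by rewrite !mxE eqxx. Qed.

Lemma cons_rV_line0 n (a t : R) (x : 'rV[R]_n) :
  cons_rV (a + t, x) = cons_rV (a, x) + t *: delta_mx ord0 ord0.
Proof.
apply/rowP => i; rewrite lineE; case: (unliftP ord0 i) => [j ->|->].
  by rewrite !cons_rV_lift /= mulr0 addr0.
by rewrite !cons_rV0 eqxx mulr1.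
Qed.

Lemma cons_rV_line n (a t : R) (x : 'rV[R]_n) (j : 'I_n) :
  cons_rV (a, x + t *: delta_mx ord0 j) =
  cons_rV (a, x) + t *: delta_mx ord0 (lift ord0 j).
Proof.
apply/rowP => i; rewrite lineE; case: (unliftP ord0 i) => [k ->|->].
  by rewrite !cons_rV_lift lineE (inj_eq lift_inj).
by rewrite !cons_rV0 /= mulr0 addr0.
Qed.

(** The integral of a partial derivative of a compactly supported function
    vanishes; everything is expressed along lines parallel to the axis, so that
    the induction on the dimension only needs sections. *)
Lemma integral_partial_eq0 n (i : 'I_n) (F G : 'rV[R]_n -> R) (M C : R) :
  measurable_fun setT G -> (forall x, `|G x| <= C) ->
  (forall (x : 'rV[R]_n) j, M < `|x ord0 j| -> F x = 0 /\ G x = 0) ->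
  (forall x, continuous (fun t : R => G (x + t *: delta_mx ord0 i))) ->
  (forall x (t : R), is_derive t 1 (fun t : R => F (x + t *: delta_mx ord0 i))
                                   (G (x + t *: delta_mx ord0 i))) ->
  (\int[leb n]_x (G x)%:E = 0)%E.
Proof.
elim: n i F G => [|n IH] i F G mG GC sup cG dG; first by case: (i).
have iG : (leb n.+1).-integrable setT (EFin \o G).
  apply: (integrable_bounded_support (M := M) (C := C)) => // x j /(sup x j).
  by case.
case: (unliftP ord0 i) => [j ij|i0].
  rewrite fubini_rV// integral0_eq// => a _.
  have E' (x : 'rV[R]_n) t : cons_rV (a, x + t *: delta_mx ord0 j) =
      cons_rV (a, x) + t *: delta_mx ord0 i by rewrite cons_rV_line ij.
  apply: (IH j (fun x => F (cons_rV (a, x))) (fun x => G (cons_rV (a, x)))) => //.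
  - apply: (measurableT_comp mG); apply: (measurableT_comp (@measurable_cons_rV R n)).
    exact: pair1_measurable.
  - by move=> x k xk; apply: (sup _ (lift ord0 k)); rewrite cons_rV_lift.
  - by move=> x; under eq_fun do rewrite E'; exact: cG.
  - by move=> x t; rewrite E'; under eq_fun do rewrite E'; exact: dG.
rewrite fubini_rV_swap// integral0_eq// => x _.
have E' t : cons_rV (t, x) = cons_rV (0, x) + t *: delta_mx ord0 i.
  by rewrite i0 -cons_rV_line0 add0r.
apply: (@integral_deriv_compact_support (fun t => F (cons_rV (t, x))) _ M).
- by under eq_fun do rewrite E'; exact: cG.
- by move=> t; rewrite E'; under eq_fun do rewrite E'; exact: dG.
- by move=> t Mt; apply: (sup _ ord0); rewrite cons_rV0.
Qed.

(** Directional derivatives are derivatives of restrictions to lines. *)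
Lemma is_derive_line n (F : 'rV[R]_n -> R) (v x : 'rV[R]_n) (t : R) :
  derivable F (x + t *: v) v ->
  is_derive t 1 (fun t : R => F (x + t *: v)) ('D_v F (x + t *: v)).
Proof.
move=> dF.
have E : (fun h : R => h^-1 *: (((fun t : R => F (x + t *: v)) \o shift t) (h *: 1) -
     F (x + t *: v))) =
   (fun h : R => h^-1 *: ((F \o shift (x + t *: v)) (h *: v) - F (x + t *: v))).
  apply/funext => h; congr (_ *: (F _ - _)) => /=.
  by rewrite [h *: 1]mulr1 scalerDl addrC -addrA [t *: v + _]addrC addrCA addrC.
by split; rewrite /derivable /derive E.
Qed.

Section TestFunctions.
Variables (n : nat) (Omega : set 'rV[R]_n) (phi : 'rV[R]_n -> R).
Hypothesis tphi : test_function Omega phi.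
Variable i : 'I_n.

Lemma test_function_support : exists K : set 'rV[R]_n,
  [/\ compact K, K `<=` Omega & forall x, ~ K x -> phi x = 0 /\ partial_deriv i phi x = 0].
Proof.
have [_ [K [cK KO supK]]] := tphi; exists K; split => // x nKx; split; first exact: supK.
have cl : closed K by apply: compact_closed => //; exact: norm_hausdorff.
rewrite /partial_deriv (near_eq_derive (g := cst 0)) ?derive_cst//.
have : \forall y \near x, (~` K) y.
  by apply: open_nbhs_nbhs; split => //; exact: closed_openC.
by apply: filterS => y /supK.
Qed.

Lemma bounded_continuous_compact (f : 'rV[R]_n -> R) (K : set 'rV[R]_n) :
  continuous f -> compact K -> (forall x, ~ K x -> f x = 0) ->
  exists C, forall x, `|f x| <= C.
Proof.
move=> cf cK supK.
have : compact (f @` K).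
  by apply: continuous_compact => //; exact: continuous_subspaceT.
move/compact_bounded => [M [_ hM]]; exists (`|M| + 1) => x.
have [Kx|nKx] := pselect (K x); last by rewrite supK// normr0 addr_ge0.
by apply: hM; [rewrite (le_lt_trans (ler_norm M))// ltrDl|exists x].
Qed.

Lemma test_functionP : exists M C : R,
  [/\ continuous phi, continuous (partial_deriv i phi),
      forall x, derivable phi x (delta_mx ord0 i),
      forall x, `|phi x| <= C /\ `|partial_deriv i phi x| <= C &
      (forall (x : 'rV[R]_n) j, M < `|x ord0 j| -> phi x = 0 /\ partial_deriv i phi x = 0) /\
      (forall x, ~ Omega x -> phi x = 0 /\ partial_deriv i phi x = 0)].
Proof.
have [K [cK KO supK]] := test_function_support.
have [/(_ 1%N) /= [c0 dphi c1] _] := tphi.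
have [C0 h0] := bounded_continuous_compact c0 cK (fun x h => (supK x h).1).
have [C1 h1] := bounded_continuous_compact (c1 i) cK (fun x h => (supK x h).2).
have [M [_ hM]] := compact_bounded cK.
exists (M + 1), (Num.max C0 C1); split => //.
- by move=> x; rewrite !le_max h0 h1 orbT.
- split => [x j Mx|x nO]; apply: supK; last by move/KO.
  move=> /(hM (M + 1)); rewrite ltrDl => /(_ ltr01) xM.
  by have := le_lt_trans (coord_le_norm x j) (le_lt_trans xM Mx); rewrite ltxx.
Qed.

(** The product u phi vanishes outside a compact subset of Omega, so the integral
    of its partial derivative over the whole space is 0, whatever the boundary
    of Omega. *)
Lemma weak_partial_line (u g : 'rV[R]_n -> R) (B : R) : measurable Omega ->
  measurable_fun setT u -> measurable_fun setT g ->
  (forall x, `|u x| <= B) -> (forall x, `|g x| <= B) ->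
  (forall x, continuous (fun t : R => g (x + t *: delta_mx ord0 i))) ->
  (forall x (t : R), is_derive t 1 (fun t : R => u (x + t *: delta_mx ord0 i))
                                   (g (x + t *: delta_mx ord0 i))) ->
  \int[leb n]_(x in Omega) (u x * partial_deriv i phi x) =
  - \int[leb n]_(x in Omega) (g x * phi x).
Proof.
move=> mO mu_ mg uB gB cg du.
have [M [C [cphi cdphi dphi bphi [supM supO]]]] := test_functionP.
have mphi := continuous_measurable_rV cphi.
have mdphi := continuous_measurable_rV cdphi.
have B0 : 0 <= B by apply: le_trans (uB 0).
have C0 : 0 <= C by apply: le_trans (bphi 0).1.
have i1 : (leb n).-integrable setT (EFin \o (fun x => g x * phi x)).
  apply: (integrable_bounded_support (M := M) (C := B * C)).
  - exact: measurable_funM.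
  - by move=> x; rewrite normrM ler_pM//; exact: (bphi x).1.
  - by move=> x j /(supM x j)[-> _]; rewrite mulr0.
have i2 : (leb n).-integrable setT (EFin \o (fun x => u x * partial_deriv i phi x)).
  apply: (integrable_bounded_support (M := M) (C := B * C)).
  - exact: measurable_funM.
  - by move=> x; rewrite normrM ler_pM//; exact: (bphi x).2.
  - by move=> x j /(supM x j)[_ ->]; rewrite mulr0.
rewrite Rintegral_mkcond [in RHS]Rintegral_mkcond.
rewrite [X in Rintegral _ _ X = _](_ : _ = fun x => u x * partial_deriv i phi x); last first.
  apply/funext => x; rewrite patchE; case: ifPn => // /negP xO.
  by have [|_ ->] := supO x; [by move=> /mem_set|rewrite mulr0].
rewrite [X in - Rintegral _ _ X](_ : _ = fun x => g x * phi x); last first.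
  apply/funext => x; rewrite patchE; case: ifPn => // /negP xO.
  by have [|-> _] := supO x; [by move=> /mem_set|rewrite mulr0].
apply/eqP; rewrite -addr_eq0 -RintegralD//; apply/eqP.
rewrite /Rintegral -[RHS]/(fine 0%E); congr fine.
apply: (@integral_partial_eq0 _ i (fun x => u x * phi x) _ M (B * C + B * C)).
- by apply: measurable_funD; apply: measurable_funM.
- move=> x; apply: le_trans (ler_normD _ _) _; rewrite !normrM.
  by apply: lerD; apply: ler_pM => //; [exact: (bphi x).2|exact: (bphi x).1].
- by move=> x j /(supM x j)[-> ->]; rewrite !mulr0 addr0.
- move=> x t.
  have cline (f : 'rV[R]_n -> R) : continuous f -> {for t, continuous (fun t : R => f (x + t *: delta_mx ord0 i))}.
    move=> cf; apply: (@continuous_comp _ _ _ (fun t : R => x + t *: delta_mx ord0 i) f); last exact: cf.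
    by apply: cvgD; [exact: cvg_cst|apply: cvgZr_tmp; exact: cvg_id].
  have cu := is_derive_continuous (du x).
  by apply: cvgD; apply: cvgM; [exact: cu|exact: cline|exact: cg|exact: cline].
- move=> x t.
  have dl := is_derive_line (dphi (x + t *: delta_mx ord0 i)).
  have H := is_deriveM (du x t) dl.
  by apply: (is_derive_eq H); congr (_ + _); exact: mulrC.
Qed.

End TestFunctions.

End IntegrationByParts.

(** * The Neumann Laplacian on square-integrable functions *)

Section Neumann.
Variables (R : realType) (n : nat) (Omega : set 'rV[R]_n).
Hypothesis mO : measurable Omega.
Local Notation leb := (lebesgue_rV R n).
Local Notation V := (LfunType leb (le1_2 R)).
Local Notation ip := (@ip2 _ _ _ leb Omega).

Let sip : semi_inner ip := semi_inner_ip2 leb mO.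

Lemma ip2_sqr_restrict (u : V) :
  (\int[leb]_x ((u \_ Omega) x ^+ 2)%:E = (ip u u)%:E)%E.
Proof.
rewrite ip2E// [RHS]integral_mkcond; apply: eq_integral => x _.
by rewrite /patch; case: ifP; rewrite // expr0n.
Qed.

Lemma L2_Lfun (u : V) : L2 Omega u.
Proof.
apply: Lfun2P; last by rewrite ip2_sqr_restrict ltry.
by apply/(measurable_restrictT _ _).1 => //; apply: measurable_funTS; exact: measurable_Lfun2.
Qed.

(** Functions that are square-integrable on Omega are represented by elements of
    the vector space of square-integrable functions on the whole space, with
    the same values on Omega; nothing that follows depends on the values
    outside Omega. *)
Lemma L2_lift u : L2 Omega u -> exists u' : V, {in Omega, u' =1 u}.
Proof.
move=> Lu; exists (Lfun_Sub (le1_2 R) Lu) => x xO.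
by rewrite /= /patch xO.
Qed.

Lemma L2_congr u v : {in Omega, u =1 v} -> L2 Omega u -> L2 Omega v.
Proof.
rewrite /L2 => uv; rewrite (_ : u \_ Omega = v \_ Omega)//.
by apply/funext => x; rewrite /patch; case: ifP => // /uv.
Qed.

Lemma H1_grad_congr u u' G G' : {in Omega, u =1 u'} ->
  (forall i, {in Omega, G i =1 G' i}) -> H1_grad Omega u G -> H1_grad Omega u' G'.
Proof.
move=> uu GG [Lu LG]; split; first exact: L2_congr Lu.
move=> i; have [LGi wG] := LG i; split; first exact: L2_congr LGi.
move=> phi tphi; rewrite -(eq_Rintegral leb (f := fun x => u x * partial_deriv i phi x)).
  rewrite (wG _ tphi); congr (- _).
  by apply: eq_Rintegral => x xO; rewrite GG.
by move=> x xO; rewrite uu.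
Qed.

Definition H1V (u : V) (G : 'I_n -> V) : Prop := H1_grad Omega u (fun i => G i).

Lemma H1_grad_lift u G : H1_grad Omega u G -> exists (u' : V) (G' : 'I_n -> V),
  [/\ {in Omega, u' =1 u}, (forall i, {in Omega, G' i =1 G i}) & H1V u' G'].
Proof.
move=> [Lu LG]; have [u' uu] := L2_lift Lu.
have /choice[G' GG] : forall i, exists G' : V, {in Omega, G' =1 G i}.
  by move=> i; exact: L2_lift (LG i).1.
exists u', G'; split => //; apply: (@H1_grad_congr u _ G) => //.
- by move=> x xO; rewrite uu.
- by move=> i x xO; rewrite GG.
Qed.

Lemma neumann_congr u u' h h' : {in Omega, u =1 u'} -> {in Omega, h =1 h'} ->
  neumann Omega u h -> neumann Omega u' h'.
Proof.
move=> uu hh [Lh [G uG hG]]; split; first exact: L2_congr Lh.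
exists G; first exact: (@H1_grad_congr u _ G).
move=> v H vH; rewrite (hG _ _ vH); apply: eq_Rintegral => x xO.
by rewrite hh.
Qed.

(** The Neumann Laplacian is the operator of the Dirichlet form in the sense of
    [form_op]. *)
Lemma neumann_form_op (u h : V) : neumann Omega u h <-> form_op ip H1V u h.
Proof.
split.
  move=> [Lh [G uG hG]].
  have [u' [G' [uu GG uG']]] := H1_grad_lift uG.
  exists G'.
    by apply: H1_grad_congr uG' => // x xO; exact: uu.
  move=> v H vH; have := hG _ _ vH; rewrite -[X in _ = X]/(ip h v) => <-; apply: eq_bigr => i _.
  by apply: eq_Rintegral => x xO; rewrite GG.
move=> [G uG hG]; split; first exact: L2_Lfun.
exists (fun i => (G i : V)) => // v H vH.
have [v' [H' [vv HH vH']]] := H1_grad_lift vH.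
rewrite -[RHS](@eq_Rintegral _ _ _ _ _ _ (fun x => h x * v' x)); last first.
  by move=> x xO; rewrite vv.
rewrite -[RHS]/(ip h v') -(hG _ _ vH'); apply: eq_bigr => i _.
by apply: eq_Rintegral => x xO; rewrite HH.
Qed.

Lemma L2normE (u : V) : L2norm Omega u = (Num.sqrt (ip u u))%:E.
Proof.
rewrite /L2norm unlock /= -powR12_sqrt ?(ip_ge0 sip)// -poweR_EFin.
congr (_ `^ _)%E; rewrite -ip2_sqr_restrict; apply: eq_integral => x _ /=.
by rewrite powR_mulrn// real_normK ?num_real.
Qed.

Lemma ip2_null_on (u : V) (f : 'rV[R]_n -> R) : {in Omega, u =1 f} ->
  f = (fun=> 0) %[ae leb in Omega] -> ip u u = 0.
Proof.
move=> uf f0; apply/(ip2_null mO); apply: filterS f0 => x /= h Ox.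
by rewrite uf ?h//; apply/mem_set.
Qed.

Lemma resolvent_bound lambda : resolvent_set Omega lambda ->
  exists C, forall u h, form_op ip H1V u h ->
    ip u u <= C * ip (h - lambda *: u) (h - lambda *: u).
Proof.
move=> [_ _ [C hC]]; exists (C ^+ 2) => u h /neumann_form_op Nu.
have := hC _ _ Nu; have -> : L2norm Omega (fun x => h x - lambda * u x) =
    L2norm Omega ((h - lambda *: u) : V) by [].
rewrite !L2normE -EFinM lee_fin => le.
rewrite -[leLHS]sqr_sqrtr ?(ip_ge0 sip)// -[X in _ * X]sqr_sqrtr ?(ip_ge0 sip)//.
rewrite -exprMn; apply: lerXn2r => //; rewrite nnegrE ?sqrtr_ge0//.
by apply: le_trans le; exact: sqrtr_ge0.
Qed.

Lemma resolvent_surj lambda : resolvent_set Omega lambda ->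
  forall f : V, exists u h : V, form_op ip H1V u h /\
    ip (h - lambda *: u - f) (h - lambda *: u - f) = 0.
Proof.
move=> [surj _ _] f; have [u [h [Nu uh]]] := surj _ (L2_Lfun f).
have [Lh [G [Lu _] _]] := Nu.
have [u' uu] := L2_lift Lu; have [h' hh] := L2_lift Lh.
exists u', h'; split.
  by apply/neumann_form_op; apply: neumann_congr Nu => x xO; rewrite ?uu ?hh.
apply: (@ip2_null_on _ (fun x => (h x - lambda * u x) - f x)).
  by move=> x xO /=; rewrite -uu// -hh.
by apply: filterS uh => x /= E /E ->; rewrite subrr.
Qed.

Hypothesis fO : (leb Omega < +oo)%E.

Lemma bounded_L2 (f : 'rV[R]_n -> R) (B : R) : measurable_fun setT f ->
  (forall x, `|f x| <= B) -> L2 Omega f.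
Proof.
move=> mf fB.
have mfO : measurable_fun setT (f \_ Omega).
  by apply/(measurable_restrictT _ _).1 => //; exact: measurable_funTS.
apply: Lfun2P => //.
apply: (@le_lt_trans _ _ (\int[leb]_(x in Omega) (B ^+ 2)%:E)%E).
  rewrite [leRHS]integral_mkcond; apply: ge0_le_integral; [by []|..].
  - by move=> x _; rewrite lee_fin sqr_ge0.
  - by apply/measurable_EFinP; exact: measurable_funX.
  - by apply/(measurable_restrictT _ _).1 => //; exact: measurable_cst.
  - move=> x _; rewrite /patch; case: ifP => _; rewrite lee_fin ?expr0n//.
    rewrite -(real_normK (num_real (f x))) lerXn2r ?nnegrE//.
    by rewrite (le_trans _ (fB x)).
by rewrite integral_cst//= lte_mul_pinfty// lee_fin sqr_ge0.
Qed.

Lemma bounded_lift (f : 'rV[R]_n -> R) (B : R) : measurable_fun setT f ->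
  (forall x, `|f x| <= B) -> exists u : V, {in Omega, u =1 f}.
Proof. by move=> mf fB; apply: L2_lift; exact: bounded_L2 fB. Qed.

Lemma H1V_lin a u G v H : H1V u G -> H1V v H ->
  H1V (u + a *: v) (fun i => G i + a *: H i).
Proof.
move=> [Lu LG] [Lv LH]; split; first exact: L2_Lfun.
move=> i; split; first exact: L2_Lfun.
have [_ wG] := LG i; have [_ wH] := LH i.
move=> phi tphi; have := wG _ tphi; have := wH _ tphi.
have [M [C [cphi cdphi _ bphi _]]] := test_functionP tphi i.
have [p pE] := bounded_lift (continuous_measurable_rV cphi) (fun x => (bphi x).1).
have [dp dpE] := bounded_lift (continuous_measurable_rV cdphi) (fun x => (bphi x).2).
have ipp (w : V) : \int[leb]_(x in Omega) (w x * phi x) = ip w p.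
  by apply: eq_Rintegral => x xO; rewrite pE.
have ipdp (w : V) : \int[leb]_(x in Omega) (w x * partial_deriv i phi x) = ip w dp.
  by apply: eq_Rintegral => x xO; rewrite dpE.
rewrite (ipp (H i)) (ipp (G i)) (ipdp u) (ipdp v).
rewrite (ipdp (u + a *: v)) (ipp (G i + a *: H i)) !(ipE sip) => -> ->.
by rewrite mulrN -opprD.
Qed.

Lemma sum_LfunE m (c : 'I_m -> R) (b : 'I_m -> V) x :
  ((\sum_i c i *: b i : V) : 'rV[R]_n -> R) x = \sum_i c i * b i x.
Proof. exact: (big_morph (fun f : V => (f : 'rV[R]_n -> R) x)). Qed.

Lemma has_dim_ip2 lambda m : has_dim Omega (neumann_eigenspace Omega lambda) m ->
  exists b : 'I_m -> V,
    [/\ forall i, form_op ip H1V (b i) (lambda *: b i),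
        forall c : 'I_m -> R, let v := \sum_i c i *: b i in
          ip v v = 0 -> forall i, c i = 0 &
        forall u, form_op ip H1V u (lambda *: u) -> exists c : 'I_m -> R,
          ip (u - \sum_i c i *: b i) (u - \sum_i c i *: b i) = 0].
Proof.
move=> [e [eN eI eS]].
have /choice[b be] : forall i, exists b : V, {in Omega, b =1 e i}.
  by move=> i; have [_ [G [Le _] _]] := eN i; exact: L2_lift.
have sumE c x : x \in Omega ->
    ((\sum_i c i *: b i : V) : 'rV[R]_n -> R) x = \sum_i c i * e i x.
  by move=> xO; rewrite sum_LfunE; apply: eq_bigr => i _; rewrite be.
exists b; split.
- move=> i; apply/neumann_form_op; apply: neumann_congr (eN i) => x xO /=.
    by rewrite be.
  by rewrite -be.
- move=> c v v0; apply: eI; have /(ip2_null mO) := v0.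
  by apply: filterS => x /= h Ox; rewrite -sumE ?h//; exact/mem_set.
- move=> u /neumann_form_op uN; have [c hc] := eS u uN; exists c.
  apply/(ip2_null mO); apply: filterS hc => x /= h Ox.
  by rewrite -[LHS]/(u x - _) sumE ?h ?subrr//; exact/mem_set.
Qed.

(** The description of the spectrum provides the hypotheses of
    [riesz_mean_ge]: the eigenvalues below g are finitely many because gamma
    tends to infinity, and all other numbers below g are regular values, in
    particular -1. *)
Lemma neumann_riesz_mean (gamma : nat -> R) (g : R) :
  discrete_spectrum Omega gamma -> gamma 0%N = 0 -> 0 < g ->
  exists (K : nat) (e : nat -> V),
    [/\ [set k | gamma k < g] = `I_K,
        forall i j, ip (e i) (e j) = (i == j)%:R &
        forall v H, H1V v H ->
          g * ip v v - dform ip H H <= \sum_(k < K) (g - gamma k) * ip (e k) v ^+ 2].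
Proof.
move=> [ndg gcvg spE dimE] g0E g0.
have [e [eon eN eorth]] := @eigenbasis _ _ _ _ sip _ H1V_lin gamma (fun lambda =>
  let: ex_intro m (conj cm dm) := dimE lambda in ex_intro _ m (conj cm (has_dim_ip2 dm))).
have [K KE] : exists K, forall k, (gamma k < g) = (k < K)%N.
  have [N _ hN] : \forall k \near \oo, g <= gamma k.
    by move/cvgryPge : gcvg; exact.
  have exN : exists k, g <= gamma k by exists N; exact: (hN N (leqnn N)).
  exists (ex_minn exN); case: ex_minnP => K gK Kmin k.
  apply/idP/idP => [kg|kK].
    by rewrite ltnNge; apply: contraTN kg => /ndg; rewrite -leNgt; exact: le_trans.
  by rewrite ltNge; apply/negP => /Kmin; rewrite leqNgt kK.
have gamma_ge0 k : 0 <= gamma k by rewrite -g0E; exact: ndg.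
have res lambda : (forall k, gamma k != lambda) -> resolvent_set Omega lambda.
  move=> h; apply: contrapT => nr; have : spectrum Omega lambda := nr.
  by rewrite spE => -[k _ /eqP]; exact/negP.
exists K, e; split => //.
  by apply/seteqP; split=> k /=; rewrite KE.
(* The gap inequality on the complement of the e k is form_bound: surjectivity
   at -1 and the resolvent bounds come from the description of the spectrum. *)
apply: (riesz_mean_ge sip H1V_lin) => //.
move=> w H wH worth.
apply: (form_bound sip (complete_ip2 mO fO) (S := [seq gamma k | k <- iota 0 K])
  g0 _ _ _ wH).
- by move=> _ /mapP[k _ ->].
- move=> f; have [|u [h [Nu uh]]] := @resolvent_surj (-1) _ f.
    by apply: res => k; rewrite gt_eqF// (lt_le_trans _ (gamma_ge0 k))// ltrN10.
  by exists u, h; rewrite scaleN1r opprK in uh.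
- move=> lambda lg lS; apply: resolvent_bound; apply: res => k.
  apply: contra lS => /eqP kl; apply/mapP; exists k => //.
  by rewrite mem_iota add0n leq0n -KE kl.
- move=> _ v /mapP[j jK ->]; apply: eorth => k kj; apply: worth.
  by rewrite -KE kj KE; move: jK; rewrite mem_iota add0n.
Qed.

End Neumann.

(** * Finite orthonormal expansions *)

Section FiniteExpansions.
Variables (R : realType) (V : lmodType R) (ip : V -> V -> R).
Hypothesis sip : semi_inner ip.

Lemma bessel (K : nat) (e : nat -> V) v :
  (forall i j, (i < K)%N -> (j < K)%N -> ip (e i) (e j) = (i == j)%:R) ->
  \sum_(k < K) ip (e k) v ^+ 2 <= ip v v.
Proof.
move=> on; set s := \sum_(k < K) _.
pose r := v - \sum_(k < K) ip (e k) v *: e k.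
have rv : ip r r = ip v v - s.
  have er (k : 'I_K) : ip (e k) r = 0.
    rewrite /r (ipDr sip) (ipNr sip) (ip_sumr sip) (bigD1 k)//= big1 => [|j jk].
      by rewrite (ipZr sip) on// eqxx mulr1 addr0 subrr.
    by rewrite (ipZr sip) on// (_ : (k == j :> nat) = false) ?mulr0//; apply/negbTE; rewrite eq_sym.
  rewrite {2}/r (ipDr sip) (ipNr sip) (ip_sumr sip) [X in _ - X]big1 => [|k _]; last first.
    by rewrite (ipZr sip) (ipC sip r) er mulr0.
  rewrite subr0 /r (ipDl sip) (ipNl sip) (ip_suml sip); congr (_ - _).
  by apply: eq_bigr => k _; rewrite (ipZl sip) expr2.
by have := ip_ge0 sip r; rewrite rv subr_ge0.
Qed.

(* The reverse triangle inequality. *)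
Lemma sqrt_ip_lipschitz u v :
  (Num.sqrt (ip u u) - Num.sqrt (ip v v)) ^+ 2 <= ip (u - v) (u - v).
Proof.
have u0 := ip_ge0 sip u; have v0 := ip_ge0 sip v.
have : ip u v <= Num.sqrt (ip u u) * Num.sqrt (ip v v).
  apply: le_trans (ler_norm _) _; rewrite -sqrtrM// -sqrtr_sqr ler_wsqrtr//.
  exact: cauchy_schwarz.
rewrite sqrrB !sqr_sqrtr// !(ipE sip) (ipC sip v u); lra.
Qed.

(** Weighted sums of squared coefficients form a semi-inner product, and so do
    sums over the real and imaginary parts; hence square roots of such sums obey
    the triangle inequality. *)
Lemma semi_inner_expansion (K : nat) (e : nat -> V) (c : nat -> R) :
  (forall k, (k < K)%N -> 0 <= c k) ->
  semi_inner (fun u v => \sum_(k < K) c k * (ip (e k) u * ip (e k) v)).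
Proof.
move=> c0; split.
- by move=> u v; apply: eq_bigr => k _; rewrite [ip _ u * _]mulrC.
- move=> u v w; rewrite -big_split; apply: eq_bigr => k _.
  by rewrite (ipDr sip) mulrDl mulrDr.
- by move=> a u w; rewrite mulr_sumr; apply: eq_bigr => k _; rewrite (ipZr sip); ring.
- by move=> u; apply: sumr_ge0 => k _; rewrite mulr_ge0 ?c0// -expr2 sqr_ge0.
Qed.

Lemma semi_inner_pair : semi_inner (fun p q : V * V => ip p.1 q.1 + ip p.2 q.2).
Proof.
split.
- by move=> u v; rewrite !(ipC sip u.1) !(ipC sip u.2).
- by move=> u v w; rewrite /= !(ipDl sip); ring.
- by move=> a u w; rewrite /= !(ipZl sip); ring.
- by move=> u; rewrite addr_ge0 ?(ip_ge0 sip).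
Qed.

End FiniteExpansions.

(** * Plane waves and the energy in Fourier space *)

Section PlaneWaves.
Variables (R : realType) (n : nat) (Omega : set 'rV[R]_n).
Hypothesis mO : measurable Omega.
Local Notation leb := (lebesgue_rV R n).
Local Notation V := (LfunType leb (le1_2 R)).
Local Notation ip := (@ip2 _ _ _ leb Omega).
Hypothesis fO : (leb Omega < +oo)%E.

Let sip : semi_inner ip := semi_inner_ip2 leb mO.

Lemma dot_line (xi x : 'rV[R]_n) t i :
  dot xi (x + t *: delta_mx ord0 i) = dot xi x + t * xi ord0 i.
Proof.
rewrite /dot [X in _ = _ + X](_ : _ = \sum_j xi ord0 j * (t *: delta_mx ord0 i : 'rV[R]_n) ord0 j).
  by rewrite -big_split; apply: eq_bigr => j _; rewrite !mxE mulrDr.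
rewrite (bigD1 i)//= big1 => [|j ji]; first by rewrite !mxE !eqxx addr0 mulr1 mulrC.
by rewrite !mxE (negbTE ji) andbF !mulr0.
Qed.

Lemma plane_wave_H1 (f f' : R -> R) (xi : 'rV[R]_n) :
  (forall t : R, is_derive t 1 f (f' t)) -> continuous f' ->
  (forall t, `|f t| <= 1) -> (forall t, `|f' t| <= 1) ->
  H1_grad Omega (fun x => f (dot xi x)) (fun i x => xi ord0 i * f' (dot xi x)).
Proof.
move=> df cf' f1 f'1.
have cf := is_derive_continuous df.
have mf : measurable_fun setT (fun x : 'rV[R]_n => f (dot xi x)).
  apply: (measurableT_comp (continuous_measurable_fun cf)); exact: measurable_dotl.
have mf' i : measurable_fun setT (fun x : 'rV[R]_n => xi ord0 i * f' (dot xi x)).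
  apply: measurable_funM => //.
  apply: (measurableT_comp (continuous_measurable_fun cf')); exact: measurable_dotl.
have bf' i x : `|xi ord0 i * f' (dot xi x)| <= `|xi ord0 i|.
  by rewrite normrM ler_piMr.
split; first exact: (bounded_L2 mO fO mf (B := 1)).
move=> i; split; first exact: (bounded_L2 mO fO (mf' i) (bf' i)).
move=> phi tphi; apply: (weak_partial_line tphi (B := 1 + `|xi ord0 i|)) => //.
- by move=> x; rewrite (le_trans (f1 _))// lerDl.
- by move=> x; rewrite (le_trans (bf' _ _))// lerDr.
- move=> x; rewrite (_ : (fun t => _) = fun t => xi ord0 i * f' (dot xi x + t * xi ord0 i)).
    have cl : continuous (fun t : R => dot xi x + t * xi ord0 i).
      move=> t; apply: (@cvgD _ R^o); first exact: cvg_cst.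
      by apply: cvgM; [exact: cvg_id|exact: cvg_cst].
    move=> t; apply: cvgM; first exact: cvg_cst.
    exact: (continuous_comp (cl t) (cf' _)).
  by apply/funext => t; rewrite dot_line.
- move=> x t; rewrite (_ : (fun t => _) = fun t => f (dot xi x + t * xi ord0 i)).
    rewrite dot_line.
    have h1 : is_derive t 1 (fun t => dot xi x + t * xi ord0 i) (xi ord0 i).
      by apply: is_derive_eq; rewrite scaler0 !add0r mul1r; exact: mulr1.
    by rewrite mulrC; exact: (is_derive1_comp (df _) h1).
  by apply/funext => s; rewrite dot_line.
Qed.

Lemma wave_lift (h : R -> R) (xi : 'rV[R]_n) th : continuous h ->
  (forall t, `|h t| <= 1) ->
  exists v : V, {in Omega, v =1 fun x => h (dot xi x + th)}.
Proof.
move=> ch h1; apply: (bounded_lift mO fO (B := 1)) => //.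
apply: (measurableT_comp (continuous_measurable_fun ch)).
by apply: measurable_funD => //; exact: measurable_dotl.
Qed.

(** A phase th rotates the pair of coefficients of cosine and sine, so the sum of
    their squares does not depend on it. *)
Lemma fourier_sqr_ip (e C S : V) xi th :
  {in Omega, C =1 fun x => cos (dot xi x + th)} ->
  {in Omega, S =1 fun x => sin (dot xi x + th)} ->
  fourier_sqr (e \_ Omega) xi = ip e C ^+ 2 + ip e S ^+ 2.
Proof.
move=> CE SE.
have restrictE (h : R -> R) :
    \int[leb]_x ((e \_ Omega) x * h (dot xi x)) = \int[leb]_(x in Omega) (e x * h (dot xi x)).
  rewrite [RHS]Rintegral_mkcond; apply: eq_Rintegral => x _.
  by rewrite /patch; case: ifP => _; rewrite ?mul0r.
rewrite /fourier_sqr !restrictE.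
have [C0 C0E] := wave_lift xi 0 (@continuous_cos R) (@normr_cos_le1 R).
have [S0 S0E] := wave_lift xi 0 (@continuous_sin R) (@normr_sin_le1 R).
have -> : \int[leb]_(x in Omega) (e x * cos (dot xi x)) = ip e C0.
  by apply: eq_Rintegral => x xO; rewrite C0E// addr0.
have -> : \int[leb]_(x in Omega) (e x * sin (dot xi x)) = ip e S0.
  by apply: eq_Rintegral => x xO; rewrite S0E// addr0.
have -> : ip e C = cos th * ip e C0 - sin th * ip e S0.
  rewrite -mulNr -!(ipZr sip) -(ipDr sip); apply: eq_Rintegral => x xO.
  congr (_ * _); rewrite -[RHS]/(cos th * C0 x + - sin th * S0 x).
  by rewrite CE// C0E// S0E// addr0 cosD; ring.
have -> : ip e S = cos th * ip e S0 + sin th * ip e C0.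
  rewrite -!(ipZr sip) -(ipDr sip); apply: eq_Rintegral => x xO.
  congr (_ * _); rewrite -[RHS]/(cos th * S0 x + sin th * C0 x).
  by rewrite SE// C0E// S0E// addr0 sinD; ring.
have := cos2Dsin2 th; set c := cos th; set s := sin th => cs.
move: (ip e C0) (ip e S0) => a b.
have -> : (c * a - s * b) ^+ 2 + (c * b + s * a) ^+ 2 = (c ^+ 2 + s ^+ 2) * (a ^+ 2 + b ^+ 2) by ring.
by rewrite cs mul1r.
Qed.

Lemma ip_wave (C S : V) xi th :
  {in Omega, C =1 fun x => cos (dot xi x + th)} ->
  {in Omega, S =1 fun x => sin (dot xi x + th)} ->
  ip C C + ip S S = volume Omega.
Proof.
move=> CE SE; rewrite -RintegralD//; try exact: integrable_mulL.
rewrite -[RHS]mul1r -(Rintegral_cst leb mO 1).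
by apply: eq_Rintegral => x xO; rewrite CE// SE// -!expr2 cos2Dsin2.
Qed.

Section Expansion.
Variables (K : nat) (e : nat -> V) (c : nat -> R) (g : R).
Hypothesis on : forall i j, ip (e i) (e j) = (i == j)%:R.
Hypothesis c0 : forall k, (k < K)%N -> 0 <= c k.
Hypothesis cg : forall k, (k < K)%N -> c k <= g.
Hypothesis g0 : 0 <= g.
Hypothesis riesz : forall v H, H1V Omega v H ->
  g * ip v v - dform ip H H <= \sum_(k < K) c k * ip (e k) v ^+ 2.

(** In the application c k = g - gamma k; the integral of this function is
    compared with the sum of the c k. *)
Definition energy xi := \sum_(k < K) c k * fourier_sqr (e k \_ Omega) xi.

Lemma energy_ge0 xi : 0 <= energy xi.
Proof. by apply: sumr_ge0 => k _; rewrite mulr_ge0 ?c0 ?fourier_sqr_ge0. Qed.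

(** Testing the averaged variational principle with the cosine and the sine: the
    squared norms add up to |Omega| and the Dirichlet integrals to
    |xi|^2 |Omega|. *)
Lemma energy_ge xi : volume Omega * (g - sqnorm xi) <= energy xi.
Proof.
have HC : H1_grad Omega (fun x => cos (dot xi x))
    (fun i x => xi ord0 i * - sin (dot xi x)).
  apply: (plane_wave_H1 xi (f' := fun t => - sin t)) => [t||t].
  - by apply: cvgN; exact: continuous_sin.
  - exact: normr_cos_le1.
  - by rewrite normrN normr_sin_le1.
have HS : H1_grad Omega (fun x => sin (dot xi x))
    (fun i x => xi ord0 i * cos (dot xi x)).
  apply: (plane_wave_H1 xi) => [|t|t].
  - exact: continuous_cos.
  - exact: normr_sin_le1.
  - exact: normr_cos_le1.
have [C [GC [CE GCE HC']]] := H1_grad_lift HC.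
have [S [GS [SE GSE HS']]] := H1_grad_lift HS.
have CE0 : {in Omega, C =1 fun x => cos (dot xi x + 0)}.
  by move=> x xO; rewrite CE// addr0.
have SE0 : {in Omega, S =1 fun x => sin (dot xi x + 0)}.
  by move=> x xO; rewrite SE// addr0.
have -> : energy xi = \sum_(k < K) c k * ip (e k) C ^+ 2 + \sum_(k < K) c k * ip (e k) S ^+ 2.
  rewrite -big_split; apply: eq_bigr => k _.
  by rewrite (fourier_sqr_ip _ CE0 SE0) mulrDr.
apply: le_trans (lerD (riesz HC') (riesz HS')).
rewrite addrACA -mulrDr (ip_wave CE0 SE0) -opprD.
have -> : dform ip GC GC + dform ip GS GS = sqnorm xi * volume Omega.
  rewrite -big_split mulr_suml; apply: eq_bigr => i _.
  rewrite /= /ip2 -RintegralD//; try exact: integrable_mulL.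
  rewrite -(Rintegral_cst leb mO); apply: eq_Rintegral => x xO.
  rewrite GCE// GSE//.
  have := cos2Dsin2 (dot xi x); set co := cos _; set si := sin _ => E.
  by rewrite -[RHS]mulr1 -E; ring.
by rewrite mulrBr [sqnorm _ * _]mulrC [g * _]mulrC.
Qed.

Lemma normr_sin_le (t : R) : `|sin t| <= `|t|.
Proof.
wlog t0 : t / 0 <= t.
  move=> h; have [/h//|t0] := leP 0 t.
  by rewrite -normrN -sinN -[leRHS]normrN; apply: h; rewrite oppr_ge0 ltW.
have [|s _] := @MVT_segment _ sin cos 0 t t0 (fun x _ => is_derive_sin x).
  by apply: continuous_subspaceT; exact: continuous_sin.
by rewrite sin0 !subr0 => ->; rewrite normrM ler_piMl// normr_cos_le1.
Qed.

(** A chord of the unit circle is shorter than the arc. *)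
Lemma sqr_chord_le (s t : R) :
  (cos s - cos t) ^+ 2 + (sin s - sin t) ^+ 2 <= (s - t) ^+ 2.
Proof.
pose h := (s - t) / 2.
have -> : (cos s - cos t) ^+ 2 + (sin s - sin t) ^+ 2 = 4 * sin h ^+ 2.
  have E : cos (s - t) = 1 - 2 * sin h ^+ 2.
    have -> : s - t = h *+ 2 by rewrite /h -mulr_natr; field.
    by rewrite cos_mulr2n cos2sin2; ring.
  have -> : (cos s - cos t) ^+ 2 + (sin s - sin t) ^+ 2 =
     (cos s ^+ 2 + sin s ^+ 2) + (cos t ^+ 2 + sin t ^+ 2) -
     2 * (cos s * cos t + sin s * sin t) by ring.
  by rewrite !cos2Dsin2 -cosB E; ring.
have -> : (s - t) ^+ 2 = 4 * h ^+ 2 by rewrite /h; field.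
rewrite ler_pM2l// -real_normK ?num_real// -[leRHS]real_normK ?num_real//.
by rewrite lerXn2r ?nnegrE// normr_sin_le.
Qed.

Lemma semi_inner_dot : semi_inner (@dot R n).
Proof.
split.
- by move=> u v; rewrite dotC.
- by move=> u v w; rewrite -big_split; apply: eq_bigr => i _; rewrite mxE mulrDl.
- by move=> a u w; rewrite mulr_sumr; apply: eq_bigr => i _; rewrite mxE mulrA.
- by move=> u; apply: sumr_ge0 => i _; rewrite -expr2 sqr_ge0.
Qed.

Lemma dot_sqnorm (x : 'rV[R]_n) : dot x x = sqnorm x.
Proof. by apply: eq_bigr => i _; rewrite expr2. Qed.

Hypothesis bO : bounded_set Omega.

Lemma integrable_sqnorm (a : 'rV[R]_n) :
  leb.-integrable Omega (EFin \o (fun x => sqnorm (x - a))).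
Proof.
apply: measurable_bounded_integrable => //.
  apply: measurable_funTS; apply: measurable_sum => i; apply: measurable_funX.
  rewrite (_ : (fun x : 'rV[R]_n => _) = (fun x : 'rV[R]_n => x ord0 i - a ord0 i)); last first.
    by apply/funext => x; rewrite !mxE.
  by apply: measurable_funB => //; exact: measurable_coord.
have [M [_ hM]] := bO; pose B := `|M| + 1.
have xB x : Omega x -> `|x| <= B.
  by apply: hM; rewrite (le_lt_trans (ler_norm M))// ltrDl.
exists (\sum_(i < n) (B + `|a ord0 i|) ^+ 2); split; first exact: num_real.
move=> y By x Ox /=; rewrite (le_trans _ (ltW By))// ger0_norm ?sqnorm_ge0//.
apply: ler_sum => i _; rewrite !mxE -(real_normK (num_real (_ - _))).
rewrite lerXn2r ?nnegrE// ?addr_ge0//.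
apply: le_trans (ler_normB _ _) _; rewrite lerD2r.
by apply: le_trans (coord_le_norm x i) _; exact: xB.
Qed.

(** The phases - xi . a and - eta . a centre both waves at a. By Bessel's
    inequality the coefficients differ by at most the norm of the difference of
    the waves, and this difference has modulus at most |xi - eta| |x - a|. *)
Lemma energy_lipschitz_at (a xi eta : 'rV[R]_n) :
  (Num.sqrt (energy xi) - Num.sqrt (energy eta)) ^+ 2 <=
  g * sqnorm (xi - eta) * \int[leb]_(x in Omega) sqnorm (x - a).
Proof.
have [C CE] := wave_lift xi (- dot xi a) (@continuous_cos R) (@normr_cos_le1 R).
have [S SE] := wave_lift xi (- dot xi a) (@continuous_sin R) (@normr_sin_le1 R).
have [C' CE'] := wave_lift eta (- dot eta a) (@continuous_cos R) (@normr_cos_le1 R).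
have [S' SE'] := wave_lift eta (- dot eta a) (@continuous_sin R) (@normr_sin_le1 R).
have sQ := semi_inner_pair (semi_inner_expansion sip e c0).
pose Q (p q : V * V) := \sum_(k < K) c k * (ip (e k) p.1 * ip (e k) q.1) +
                        \sum_(k < K) c k * (ip (e k) p.2 * ip (e k) q.2).
have QE (p : V * V) : Q p p = \sum_(k < K) c k * (ip (e k) p.1 ^+ 2 + ip (e k) p.2 ^+ 2).
  by rewrite /Q -big_split; apply: eq_bigr => k _; rewrite mulrDr !expr2.
have -> : energy xi = Q (C, S) (C, S).
  by rewrite QE; apply: eq_bigr => k _; rewrite (fourier_sqr_ip _ CE SE).
have -> : energy eta = Q (C', S') (C', S').
  by rewrite QE; apply: eq_bigr => k _; rewrite (fourier_sqr_ip _ CE' SE').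
apply: le_trans (sqrt_ip_lipschitz sQ _ _) _.
set d := _ - _; rewrite -[leLHS]/(Q d d) QE.
apply: (@le_trans _ _ (g * (ip d.1 d.1 + ip d.2 d.2))).
  apply: (@le_trans _ _ (\sum_(k < K) g * (ip (e k) d.1 ^+ 2 + ip (e k) d.2 ^+ 2))).
    by apply: ler_sum => k _; rewrite ler_wpM2r ?cg// addr_ge0 ?sqr_ge0.
  rewrite -mulr_sumr ler_wpM2l// big_split.
  by rewrite lerD// (bessel sip).
rewrite -mulrA ler_wpM2l// -RintegralD//; try exact: integrable_mulL.
rewrite -RintegralZl//; last exact: integrable_sqnorm.
have i1 (w : V) := integrable_mulL mO w w.
apply: le_Rintegral => //.
- by have := integrableD mO (i1 d.1) (i1 d.2).
- by have := integrableZl mO (sqnorm (xi - eta)) (integrable_sqnorm a).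
move=> x Ox; have xO : x \in Omega by exact/mem_set.
rewrite -[d.1 x]/(C x - C' x) -[d.2 x]/(S x - S' x) CE// SE// CE'// SE'//.
rewrite -!expr2; apply: le_trans (sqr_chord_le _ _) _.
rewrite -!dotBr -!dot_sqnorm.
have -> : dot xi (x - a) - dot eta (x - a) = dot (xi - eta) (x - a).
  by rewrite (ipDl semi_inner_dot) (ipNl semi_inner_dot).
exact: cauchy_schwarz semi_inner_dot _ _.
Qed.

Lemma energy_lipschitz (xi eta : 'rV[R]_n) :
  (Num.sqrt (energy xi) - Num.sqrt (energy eta)) ^+ 2 <=
  g * moment_of_inertia Omega * sqnorm (xi - eta).
Proof.
rewrite mulrAC; have := energy_lipschitz_at ^~ xi ^~ eta.
have : 0 <= g * sqnorm (xi - eta) by rewrite mulr_ge0// sqnorm_ge0.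
rewrite le_eqVlt => /orP[/eqP <- /(_ 0)|p h]; first by rewrite !mul0r.
rewrite -ler_pdivrMl//; apply: lb_le_inf.
  by exists (\int[leb]_(x in Omega) sqnorm (x - 0)); exists 0.
by move=> _ [a _ <-]; rewrite ler_pdivrMl.
Qed.

End Expansion.
End PlaneWaves.

(** * The integral of the energy *)

Section EnergyIntegral.
Variables (R : realType) (n : nat) (Omega : set 'rV[R]_n).
Hypothesis mO : measurable Omega.
Local Notation leb := (lebesgue_rV R n).
Local Notation V := (LfunType leb (le1_2 R)).
Local Notation ip := (@ip2 _ _ _ leb Omega).
Hypothesis fO : (leb Omega < +oo)%E.

Lemma integrable_restrict_Lfun (u : V) : leb.-integrable setT (EFin \o (u \_ Omega)).
Proof.
have [one oneE] : exists one : V, {in Omega, one =1 fun=> 1}.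
  by apply: (bounded_lift mO fO (B := 1)) => // x; rewrite normr1.
rewrite -restrict_EFin; apply/(integrable_mkcond _ mO).1.
apply: eq_integrable (integrable_mulL mO u one) => // x xO /=.
by rewrite oneE// mulr1.
Qed.

Variables (K : nat) (e : nat -> V) (c : nat -> R).
Hypothesis on : forall i j, ip (e i) (e j) = (i == j)%:R.
Hypothesis c0 : forall k, (k < K)%N -> 0 <= c k.

Lemma measurable_energy : measurable_fun setT (energy Omega K e c).
Proof.
apply: measurable_sum => k; apply: measurable_funM => //.
by apply: measurable_fourier_sqr; exact: integrable_restrict_Lfun.
Qed.

Lemma integral_energy_le :
  (\int[leb]_xi (energy Omega K e c xi)%:E <=
   ((2 * pi) ^+ n * \sum_(k < K) c k)%:E)%E.
Proof.
under eq_integral do rewrite /energy -sumEFin.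
rewrite ge0_integral_sum//; last 2 first.
- move=> k; apply/measurable_EFinP; apply: measurable_funM => //.
  by apply: measurable_fourier_sqr; exact: integrable_restrict_Lfun.
- by move=> k x _; rewrite lee_fin mulr_ge0 ?c0 ?fourier_sqr_ge0.
rewrite mulr_sumr -sumEFin; apply: lee_sum => k _.
under eq_integral do rewrite EFinM.
rewrite ge0_integralZl_EFin; [|by []| |  |exact: c0]; last 2 first.
- by move=> x _; rewrite lee_fin fourier_sqr_ge0.
- apply/measurable_EFinP.
  by apply: measurable_fourier_sqr; exact: integrable_restrict_Lfun.
rewrite mulrC EFinM lee_wpmul2l ?lee_fin ?c0//.
apply: le_trans (plancherel_le (integrable_restrict_Lfun (e k)) _) _.
  by rewrite ip2_sqr_restrict// ltry.
by rewrite ip2_sqr_restrict// on eqxx mule1.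
Qed.

End EnergyIntegral.

(** * A radial lower profile and its integral *)

Section Radial.
Variable R : realType.
Local Notation mu := (@lebesgue_measure R).

Lemma integral_antiderivative (f F : R -> R) (a b : R) : a < b -> continuous f ->
  (forall t : R, is_derive t 1 F (f t)) ->
  (\int[mu]_(t in `[a, b]) (f t)%:E = (F b - F a)%:E)%E.
Proof.
move=> ab cf dF; have cF := is_derive_continuous dF.
rewrite (@continuous_FTC2 _ f F)//.
- exact: continuous_subspaceT.
- split; [by move=> y _; apply: ex_derive| |].
  + by apply: cvg_at_right_filter; exact: cF.
  + by apply: cvg_at_left_filter; exact: cF.
- by move=> s _; rewrite derive1E; apply: derive_val.
Qed.

Lemma is_derive_exprn m (s : R) : is_derive s 1 (fun t : R => t ^+ m) (m%:R * s ^+ m.-1).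
Proof.
apply: DeriveDef; first exact: exprn_derivable.
by rewrite -derive1E exp_derive1.
Qed.

Lemma is_derive_sqr (v : R) (s : R) : is_derive s 1 (fun t : R => v * t ^+ 2) (2 * v * s).
Proof. by apply: is_derive_eq; rewrite /GRing.scale/=; ring. Qed.


(** Every term of s^(n-1) + s^(n-2) q + ... + q^(n-1) is at least q^(n-1). *)
Lemma subrX_ge (s q : R) n : 0 <= q -> q <= s ->
  n%:R * q ^+ n.-1 * (s - q) <= s ^+ n - q ^+ n.
Proof.
move=> q0 qs; rewrite subrXX [leRHS]mulrC ler_wpM2r ?subr_ge0//.
have -> : n%:R * q ^+ n.-1 = \sum_(i < n) q ^+ n.-1.
  by rewrite sumr_const card_ord mulr_natl.
apply: ler_sum => i _; have i1 : (i <= n.-1)%N by rewrite -ltnS (ltn_predK (ltn_ord i)).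
rewrite -{1}(subnK i1) exprD ler_wpM2r ?exprn_ge0//.
by rewrite lerXn2r ?nnegrE// (le_trans q0).
Qed.

Variable n : nat.
Hypothesis n0 : (0 < n)%N.
Local Notation leb := (lebesgue_rV R n).

(** The profile vol (q^2 - |x|^2) on the ball of radius q, written as a
    difference of values of an antiderivative so that [radial_integral] applies
    as it stands. *)
Definition cap (vol q : R) (x : 'rV[R]_n) : R :=
  if 0 ^+ 2 <= sqnorm x < q ^+ 2 then vol * q ^+ 2 - vol * Num.sqrt (sqnorm x) ^+ 2 else 0.

(** The profile slope2 (r - |x|)^2 on the shell q <= |x| < r, in the same
    form. *)
Definition skirt (slope2 q r : R) (x : 'rV[R]_n) : R :=
  if q ^+ 2 <= sqnorm x < r ^+ 2
  then - slope2 * (r - r) ^+ 2 - - slope2 * (r - Num.sqrt (sqnorm x)) ^+ 2 else 0.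

Lemma continuous_affine_pow (a b c : R) (m : nat) :
  continuous (fun s : R => (a + b * s) * s ^+ m * c).
Proof.
move=> s; apply: cvgM; last exact: cvg_cst.
apply: cvgM; last exact: exprn_continuous.
apply: (@cvgD _ R^o); first exact: cvg_cst.
by apply: cvgM; [exact: cvg_cst|exact: cvg_id].
Qed.

Lemma integral_cap (vol q : R) : 0 <= vol -> 0 < q ->
  (\int[leb]_x (cap vol q x)%:E =
   (2 * vol * ball_volume R n * q ^+ n.+2 / n.+2%:R)%:E)%E.
Proof.
move=> vol0 q0; set w := ball_volume R n.
transitivity (\int[mu]_(s in `[0%R, q]) (2 * vol * s * ((s ^+ n - 0 ^+ n) * w))%:E)%E.
  apply: (@radial_integral _ _ (fun s => 2 * vol * s) (fun s => vol * s ^+ 2)) => //.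
  - exact: ltW.
  - by move=> s; apply: cvgM; [exact: cvg_cst|exact: cvg_id].
  - by move=> s; exact: is_derive_sqr.
  - by move=> s /andP[s0 _]; rewrite !mulr_ge0.
rewrite expr0n gtn_eqF//=.
pose F (s : R) := 2 * vol * w / n.+2%:R * s ^+ n.+2.
rewrite (_ : _%:E = (F q - F 0)%:E); last first.
  by rewrite /F expr0n/= mulr0 subr0; congr EFin; ring.
apply: (@integral_antiderivative (fun s => 2 * vol * s * ((s ^+ n - 0) * w)) F) => //.
- rewrite (_ : (fun s => _) = fun s => (0 + (2 * vol * w) * s) * s ^+ n * 1); last first.
    by apply/funext => s; ring.
  exact: continuous_affine_pow.
- move=> s; rewrite /F; have dX := is_derive_exprn n.+2 s.
  apply: is_derive_eq; rewrite /GRing.scale/= exprS.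
  have : n.+2%:R != 0 :> R by rewrite pnatr_eq0.
  by move: (n.+2%:R : R) => m m0; field.
Qed.

Lemma integral_skirt_ge (slope2 q r : R) : 0 <= slope2 -> 0 < q -> q < r ->
  ((slope2 * (ball_volume R n * (n%:R * q ^+ n.-1)) * (r - q) ^+ 3 / 3)%:E <=
   \int[leb]_x (skirt slope2 q r x)%:E)%E.
Proof.
move=> slope2_ge0 q0 qr; set w := ball_volume R n.
have w0 : 0 <= w by exact: ball_volume_ge0.
have -> : (\int[leb]_x (skirt slope2 q r x)%:E =
    \int[mu]_(s in `[q, r]) (2 * slope2 * (r - s) * ((s ^+ n - q ^+ n) * w))%:E)%E.
  apply: (@radial_integral _ _ (fun s => 2 * slope2 * (r - s)) (fun s => - slope2 * (r - s) ^+ 2)) => //.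
  - exact: ltW.
  - exact: ltW.
  - rewrite (_ : (fun s => _) = fun s => (2 * slope2 * r + (- (2 * slope2)) * s) * s ^+ 0 * 1); last first.
      by apply/funext => s; rewrite expr0; ring.
    exact: continuous_affine_pow.
  - by move=> s; apply: is_derive_eq; rewrite /GRing.scale/=; ring.
  - by move=> s /andP[_ sr]; rewrite !mulr_ge0// subr_ge0.
pose k := n%:R * q ^+ n.-1.
have k0 : 0 <= k by rewrite mulr_ge0// exprn_ge0// ltW.
pose F (s : R) := 2 * slope2 * k * w * ((s - q) ^+ 2 / 2 * (r - q) - (s - q) ^+ 3 / 3).
have cont (c d : R) m : continuous (fun s : R => (r - s) * ((s ^+ m - c) * d)).
  move=> s; apply: cvgM.
    by apply: (@cvgB _ R^o); [exact: cvg_cst|exact: cvg_id].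
  apply: cvgM; last exact: cvg_cst.
  by apply: (@cvgB _ R^o); [exact: exprn_continuous|exact: cvg_cst].
have cf1 : continuous (fun s : R => 2 * slope2 * (r - s) * (k * (s - q) * w)).
  rewrite (_ : (fun s => _) = fun s => (r - s) * ((s ^+ 1 - q) * (2 * slope2 * k * w)))//.
  by apply/funext => s; rewrite expr1; ring.
have cf2 : continuous (fun s : R => 2 * slope2 * (r - s) * ((s ^+ n - q ^+ n) * w)).
  rewrite (_ : (fun s => _) = fun s => (r - s) * ((s ^+ n - q ^+ n) * (2 * slope2 * w)))//.
  by apply/funext => s; ring.
have <- : (\int[mu]_(s in `[q, r]) (2 * slope2 * (r - s) * (k * (s - q) * w))%:E =
    (slope2 * (w * k) * (r - q) ^+ 3 / 3)%:E)%E.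
  rewrite (_ : (_ / 3)%:E = (F r - F q)%:E); last by rewrite /F; congr EFin; field.
  apply: (@integral_antiderivative (fun s => 2 * slope2 * (r - s) * (k * (s - q) * w)) F) => //.
  by move=> s; rewrite /F; apply: is_derive_eq; rewrite /GRing.scale/=; field.
apply: ge0_le_integral; [by []|..].
- move=> s; rewrite /= in_itv /= => /andP[qs sr].
  rewrite lee_fin; apply: mulr_ge0; first by rewrite !mulr_ge0// subr_ge0.
  by apply: mulr_ge0 => //; rewrite mulr_ge0// subr_ge0.
- by apply/measurable_EFinP; apply: measurable_funTS; exact: continuous_measurable_fun.
- by apply/measurable_EFinP; apply: measurable_funTS; exact: continuous_measurable_fun.
- move=> s; rewrite /= in_itv /= => /andP[qs sr].
  rewrite lee_fin; apply: ler_wpM2l; first by rewrite !mulr_ge0// subr_ge0.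
  by rewrite ler_wpM2r// /k subrX_ge// ltW.
Qed.

Lemma measurable_radial (q r b : R) (G : R -> R) : continuous G ->
  measurable_fun setT (fun x : 'rV[R]_n =>
    if q ^+ 2 <= sqnorm x < r ^+ 2 then b - G (Num.sqrt (sqnorm x)) else 0).
Proof.
move=> cG; pose D := [set x : 'rV[R]_n | q ^+ 2 <= sqnorm x < r ^+ 2].
rewrite (_ : (fun x => _) = fun x => \1_D x * (b - G (Num.sqrt (sqnorm x)))).
  apply: measurable_funM; first by apply: measurable_indic; exact: measurable_shell.
  apply: measurable_funB => //.
  apply: (measurableT_comp (continuous_measurable_fun cG)).
  apply: (measurableT_comp (continuous_measurable_fun (@sqrt_continuous R))).
  exact: measurable_sqnorm.
apply/funext => x; rewrite indicE; case: ifPn => h.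
  by rewrite mem_set// mul1r.
by rewrite memNset ?mul0r//; exact/negP.
Qed.

Lemma measurable_cap (vol q : R) : measurable_fun setT (cap vol q).
Proof.
apply: (@measurable_radial _ _ _ (fun s => vol * s ^+ 2)) => s.
by apply: cvgM; [exact: cvg_cst|exact: exprn_continuous].
Qed.

Lemma measurable_skirt (slope2 q r : R) : measurable_fun setT (skirt slope2 q r).
Proof.
apply: (@measurable_radial _ _ _ (fun s => - slope2 * (r - s) ^+ 2)) => s.
apply: cvgM; first exact: cvg_cst.
apply: (@continuous_comp _ _ _ (fun s => r - s) (fun s => s ^+ 2)); last exact: exprn_continuous.
by apply: (@cvgB _ R^o); [exact: cvg_cst|exact: cvg_id].
Qed.

Section Profile.
Variables (E : 'rV[R]_n -> R) (vol I g : R).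
Hypothesis g0 : 0 < g.
Hypothesis E0 : forall xi, 0 <= E xi.
Hypothesis E1 : forall xi, vol * (g - sqnorm xi) <= E xi.
Hypothesis E2 : forall xi eta,
  (Num.sqrt (E xi) - Num.sqrt (E eta)) ^+ 2 <= g * I * sqnorm (xi - eta).

Let q := Num.sqrt g.
Let q0 : 0 < q. Proof. by rewrite sqrtr_gt0. Qed.
Let qq : q ^+ 2 = g. Proof. by rewrite sqr_sqrtr// ltW. Qed.

Lemma cap_ge0 xi : 0 <= vol -> 0 <= cap vol q xi.
Proof.
move=> vol0; rewrite /cap; case: ifP => // /andP[_ h].
by rewrite -mulrBr mulr_ge0// sqr_sqrtr ?sqnorm_ge0// subr_ge0 ltW.
Qed.

Lemma cap_le xi : cap vol q xi <= E xi.
Proof.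
rewrite /cap; case: ifP => // _; rewrite -mulrBr sqr_sqrtr ?sqnorm_ge0// qq.
exact: E1.
Qed.

Hypothesis vol0 : 0 < vol.
Hypothesis I0 : 0 < I.

Let r := Num.sqrt (vol / I + g).
Let rr : r ^+ 2 = vol / I + g.
Proof. by rewrite sqr_sqrtr// addr_ge0 ?divr_ge0// ltW. Qed.
Let r0 : 0 < r.
Proof. by rewrite sqrtr_gt0 addr_gt0// divr_gt0. Qed.

(** Here r^2 = vol / I + g. The Lipschitz bound transfers the first lower bound
    from the point eta of modulus s = g / r in the direction of xi. At this
    modulus vol (g - s^2) = g I (r - s)^2, and the two sides have the same
    derivative in s: the parabola is tangent to the cap, which makes the choice
    of s optimal. *)
Lemma skirt_le xi : skirt (g * I) q r xi <= E xi.
Proof.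
rewrite /skirt; case: ifP => // /andP[h1 h2].
rewrite subrr expr0n mulr0 sub0r mulNr opprK.
pose rho := Num.sqrt (sqnorm xi).
have rhoE : sqnorm xi = rho ^+ 2 by rewrite sqr_sqrtr// sqnorm_ge0.
rewrite -/rho; rewrite rhoE in h1 h2.
have qrho : q <= rho by rewrite -ler_sqr ?nnegrE ?sqrtr_ge0// ltW.
have rhor : rho < r by rewrite -ltr_sqr ?nnegrE ?sqrtr_ge0// ltW.
have rho0 : 0 < rho := lt_le_trans q0 qrho.
pose s := g / r.
have srho : s <= rho.
  rewrite ler_pdivrMr// -qq expr2; apply: ler_pM => //; try exact: ltW.
  exact: ltW (le_lt_trans qrho rhor).
pose eta := (s / rho) *: xi.
have etaE : sqnorm eta = s ^+ 2.
  by rewrite sqnormZ rhoE; field; rewrite gt_eqF.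
have diffE : sqnorm (eta - xi) = (rho - s) ^+ 2.
  have -> : eta - xi = (s / rho - 1) *: xi by rewrite scalerBl scale1r.
  by rewrite sqnormZ rhoE; field; rewrite gt_eqF.
pose L := Num.sqrt (g * I).
have L0 : 0 < L by rewrite sqrtr_gt0 mulr_gt0.
have LL : L ^+ 2 = g * I by rewrite sqr_sqrtr// ltW// mulr_gt0.
have volE : vol = I * (r ^+ 2 - g) by rewrite rr; field; rewrite gt_eqF.
have low : L * (r - s) <= Num.sqrt (E eta).
  have rs0 : 0 <= L * (r - s).
    by apply: mulr_ge0; [exact: ltW|rewrite subr_ge0 ltW// (le_lt_trans srho)].
  rewrite -(ger0_norm rs0) -sqrtr_sqr ler_wsqrtr//.
  apply: le_trans (E1 eta); rewrite etaE exprMn LL volE /s.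
  rewrite (_ : g * I * _ = I * (r ^+ 2 - g) * (g - (g / r) ^+ 2))//.
  by field; rewrite gt_eqF.
have lip : Num.sqrt (E eta) - Num.sqrt (E xi) <= L * (rho - s).
  have rs0 : 0 <= L * (rho - s) by rewrite mulr_ge0 ?subr_ge0// ltW.
  rewrite (le_trans (ler_norm _))// -(ger0_norm rs0) -!sqrtr_sqr ler_wsqrtr//.
  by rewrite exprMn LL -diffE.
have : L * (r - rho) <= Num.sqrt (E xi).
  by move: low lip; rewrite !mulrBr; lra.
rewrite -LL -exprMn => h; rewrite -[leRHS]sqr_sqrtr//.
by rewrite lerXn2r ?nnegrE ?sqrtr_ge0// mulr_ge0 ?ltW// subr_gt0.
Qed.

Lemma cap_add_skirt_le xi : cap vol q xi + skirt (g * I) q r xi <= E xi.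
Proof.
have := cap_le xi; have := skirt_le xi; rewrite /cap /skirt.
have [h|h] := ltP (sqnorm xi) (q ^+ 2).
  by rewrite /= addr0.
by rewrite andbF add0r.
Qed.

Lemma skirt_ge0 xi : 0 <= skirt (g * I) q r xi.
Proof.
rewrite /skirt; case: ifP => // _.
by rewrite subrr expr0n mulr0 sub0r mulNr opprK mulr_ge0 ?sqr_ge0// mulr_ge0 ?ltW.
Qed.

End Profile.

End Radial.

(** * The Riesz mean inequality *)

Lemma powR_half_mul (R : realType) (a : R) (m : nat) : 0 <= a ->
  a `^ (m%:R / 2) = Num.sqrt a ^+ m.
Proof.
move=> a0; rewrite -powR12_sqrt// -powR_mulrn ?powR_ge0// -powRrM.
by congr (_ `^ _); rewrite mulrC.
Qed.

(** From (r - q) (r + q) = 4 J2 and r + q <= 2 r. *)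
Lemma cube_gap_ge (R : realFieldType) (J2 q r : R) : 0 <= J2 -> 0 < q -> 0 < r ->
  q <= r -> r ^+ 2 = 4 * J2 + q ^+ 2 -> 8 * J2 ^+ 3 / r ^+ 3 <= (r - q) ^+ 3.
Proof.
move=> J0 q0 r0 qr rr.
have d : 2 * J2 / r <= r - q.
  rewrite ler_pdivrMr//.
  have -> : 2 * J2 = (r - q) * (r + q) / 2 by rewrite -subr_sqr rr; field.
  by rewrite -mulrA ler_wpM2l ?subr_ge0//; lra.
have -> : 8 * J2 ^+ 3 / r ^+ 3 = (2 * J2 / r) ^+ 3 by field; rewrite gt_eqF.
by rewrite lerXn2r ?nnegrE ?subr_ge0// divr_ge0 ?mulr_ge0// ltW.
Qed.

Theorem theorem1p3 (R : realType) (n : nat) (Omega : set 'rV[R]_n)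
    (gamma : nat -> R)
    (n_ge2 : (2 <= n)%N)
    (Omega_neq0 : Omega !=set0)
    (Omega_open : open Omega)
    (Omega_bounded : bounded_set Omega)
    (Omega_spec : discrete_spectrum Omega gamma)
    (gamma0 : gamma 0%N = 0)
    (g : R) (g_gt0 : 0 < g) :
  \sum_(k \in [set k | gamma k < g]) (g - gamma k) >=
  ball_volume R n * volume Omega / (2 * pi) ^+ n *
  (2 * g `^ (1 + n%:R / 2) / (n%:R + 2)) *
  (1 + n%:R * (n%:R + 2) / 3 *
       (J1 Omega ^+ 4 /
        (g `^ (1 / 2) * (4 * J1 Omega ^+ 2 + g) `^ (3 / 2)))).
Proof.
have mO : measurable Omega by exact: open_measurable_rV.
have fO := bounded_set_lebesgue_rV mO Omega_bounded.
have n0 : (0 < n)%N by exact: ltnW.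
have [K [e [KE on riesz]]] := neumann_riesz_mean mO fO Omega_spec gamma0 g_gt0.
have [ndg _ _ _] := Omega_spec.
pose c k := g - gamma k.
have c0 k : (k < K)%N -> 0 <= c k.
  move=> kK; have : [set k | gamma k < g] k by rewrite KE.
  by rewrite /= /c subr_ge0 => /ltW.
have cg k : (k < K)%N -> c k <= g.
  by move=> _; rewrite /c lerBlDr lerDl -gamma0; exact: ndg.
have -> : \sum_(k \in [set k | gamma k < g]) (g - gamma k) = \sum_(k < K) c k.
  by rewrite KE -fsbig_ord.
set S := \sum_(k < K) c k.
pose E := energy Omega K e c.
have E0 xi : 0 <= E xi by exact: energy_ge0.
have E1 xi : volume Omega * (g - sqnorm xi) <= E xi.
  exact: (energy_ge mO fO riesz).
have E2 xi eta : (Num.sqrt (E xi) - Num.sqrt (E eta)) ^+ 2 <=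
    g * moment_of_inertia Omega * sqnorm (xi - eta).
  exact: (energy_lipschitz mO fO on c0 cg (ltW g_gt0) Omega_bounded).
have mE : measurable_fun setT E by exact: measurable_energy.
have iE := integral_energy_le mO fO on c0; rewrite -/E -/S in iE.
pose q := Num.sqrt g.
have q0 : 0 < q by rewrite sqrtr_gt0.
have qq : q ^+ 2 = g by rewrite sqr_sqrtr// ltW.
pose vol := volume Omega; pose w := ball_volume R n.
have vol0 : 0 <= vol by exact: fine_ge0.
have w0 : 0 <= w by exact: ball_volume_ge0.
pose I := moment_of_inertia Omega.
have I0 : 0 <= I.
  apply: lb_le_inf => [|_ [a _ <-]].
    by exists (\int[lebesgue_rV R n]_(x in Omega) sqnorm (x - 0)); exists 0.
  by apply: Rintegral_ge0 => x _; exact: sqnorm_ge0.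
pose J2 := vol / I / 4.
(* This also holds when I = 0, both sides being 0 by the convention on 1 / 0. *)
have JJ : J1 Omega ^+ 2 = J2.
  rewrite /J1 expr_div_n exprMn !sqr_sqrtr// -/vol -/I /J2.
  have [->|I1] := eqVneq I 0; first by rewrite mulr0 invr0 mulr0 mul0r.
  by field.
have J20 : 0 <= J2 by rewrite -JJ sqr_ge0.
pose r := Num.sqrt (4 * J2 + g).
have rg0 : 0 <= 4 * J2 + g by apply: addr_ge0; [exact: mulr_ge0|exact: ltW].
have rr : r ^+ 2 = 4 * J2 + g by rewrite sqr_sqrtr.
have r0 : 0 < r by rewrite sqrtr_gt0 ltr_wpDl// mulr_ge0.
have twopi0 : 0 < (2 * pi) ^+ n :> R by rewrite exprn_gt0// mulr_gt0// pi_gt0.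
rewrite (_ : g `^ (1 + n%:R / 2) = q ^+ n.+2); last first.
  rewrite -powR_half_mul ?ltW//; congr (_ `^ _).
  by rewrite -addn2 natrD; field.
rewrite (_ : g `^ (1 / 2) = q); last by rewrite (@powR_half_mul _ _ 1) ?ltW// expr1.
rewrite (_ : (_ + _) `^ (3 / 2) = r ^+ 3); last first.
  by rewrite JJ (@powR_half_mul _ _ 3).
rewrite (_ : J1 Omega ^+ 4 = J2 ^+ 2); last by rewrite -JJ -exprM.
rewrite -/vol -/w.
have n2E : n.+2%:R = n%:R + 2 :> R by rewrite -addn2 natrD.
(* The target, after multiplication by (2 pi)^n: the integral of the cap plus a
   lower bound of the integral of the skirt. *)
suff : 2 * vol * w * q ^+ n.+2 / n.+2%:R +
    2 / 3 * vol * w * n%:R * q ^+ n.+1 * J2 ^+ 2 / r ^+ 3 <= (2 * pi) ^+ n * S.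
  rewrite -ler_pdivrMl//; apply: le_trans; rewrite n2E exprS.
  rewrite le_eqVlt; apply/orP; left; apply/eqP; field.
  by rewrite !gt_eqF// ltr_wpDl.
have icap := integral_cap n0 vol0 q0.
have mcap := measurable_cap (n := n) vol q.
(* If J2 = 0 then r = q: the shell is empty and the cap alone suffices. *)
have [JV|J0] := eqVneq J2 0.
  rewrite JV expr0n/= mulr0 mul0r addr0 -lee_fin -icap.
  apply: le_trans iE; apply: ge0_le_integral => //.
  - by move=> x _; rewrite lee_fin cap_ge0.
  - exact/measurable_EFinP.
  - exact/measurable_EFinP.
  - by move=> x _; rewrite lee_fin cap_le.
have {}J0 : 0 < J2 by rewrite lt_neqAle eq_sym J0.
have I1 : 0 < I.
  rewrite lt_neqAle I0 andbT eq_sym; apply: contraTN J0 => /eqP I_0.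
  by rewrite /J2 I_0 invr0 mulr0 mul0r ltxx.
have vol1 : 0 < vol.
  rewrite lt_neqAle vol0 andbT eq_sym; apply: contraTN J0 => /eqP v_0.
  by rewrite /J2 v_0 !mul0r ltxx.
have volE : vol = 4 * J2 * I by rewrite /J2; field; rewrite gt_eqF.
have rE : r = Num.sqrt (vol / I + g) by congr (Num.sqrt (_ + _)); rewrite /J2; field; rewrite gt_eqF.
have J4 : 0 < 4 * J2 by rewrite mulr_gt0.
have qr : q < r by rewrite ltr_sqrt ?ltrDr// addr_gt0.
have gI0 : 0 <= g * I by rewrite mulr_ge0// ltW.
have iskirt := integral_skirt_ge n0 gI0 q0 qr.
rewrite -lee_fin; apply: le_trans iE.
apply: (@le_trans _ _ (\int[lebesgue_rV R n]_x (cap vol q x)%:E +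
                       \int[lebesgue_rV R n]_x (skirt (g * I) q r x)%:E)%E).
  rewrite icap EFinD leeD2l//; apply: le_trans iskirt; rewrite lee_fin.
  have := cube_gap_ge J20 q0 r0 (ltW qr).
  rewrite qq => /(_ rr); set d := (r - q) ^+ 3 => hd.
  have -> : 2 / 3 * vol * w * n%:R * q ^+ n.+1 * J2 ^+ 2 / r ^+ 3 =
      g * I * (w * (n%:R * q ^+ n.-1)) * (8 * J2 ^+ 3 / r ^+ 3) / 3.
    have -> : q ^+ n.+1 = q * q * q ^+ n.-1.
      by rewrite -[in LHS](prednK n0) !exprS mulrA.
    rewrite volE -qq; move: (q ^+ n.-1) (n%:R : R) => p m; field.
    by rewrite gt_eqF.
  have qn : 0 <= q ^+ n.-1 by rewrite exprn_ge0 ?ltW.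
  rewrite ler_pM2r// ler_wpM2l//.
  exact: (mulr_ge0 gI0 (mulr_ge0 w0 (mulr_ge0 (ler0n R n) qn))).
have s0 x : 0 <= skirt (g * I) q r x.
  by rewrite rE; apply: skirt_ge0.
rewrite -ge0_integralD//; last 4 first.
- by move=> x _; rewrite lee_fin cap_ge0.
- exact/measurable_EFinP.
- by move=> x _; rewrite lee_fin.
- by apply/measurable_EFinP; exact: measurable_skirt.
apply: ge0_le_integral => //.
- by move=> x _; rewrite lee_fin addr_ge0// cap_ge0.
- by apply/measurable_EFinP; apply: measurable_funD => //; exact: measurable_skirt.
- exact/measurable_EFinP.
- by move=> x _; rewrite -EFinD lee_fin rE; apply: cap_add_skirt_le.
Qed.
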